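(* Let $\Lambda\subset\mathbb{R}^{2d}$ be a lattice. If $g,h\in L^2_{w,\Lambda}(\mathbb{R}^d)$, then $S_{\Lambda,g,h}$ maps $L^2_{w,\Lambda}(\mathbb{R}^d)$ boundedly into itself. If $g=h$ and if $A^w_{\Lambda,g}:=S_{\Lambda,g}|_{L^2_{w,\Lambda}(\mathbb{R}^d)}$ denotes the restriction of $S_{\Lambda,g}=S_{\Lambda,g,g}$ to $L^2_{w,\Lambda}(\mathbb{R}^d)$, regarded as a bounded operator on $L^2_{w,\Lambda}(\mathbb{R}^d)$, then $$\sigma(A^w_{\Lambda,g})=\sigma(S_{\Lambda,g}),$$ where $\sigma(S_{\Lambda,g})$ is the spectrum of $S_{\Lambda,g}$ as an operator on $L^2(\mathbb{R}^d)$.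
   Context: A lattice in $\mathbb{R}^{2d}$ is a set $\Lambda=A\mathbb{Z}^{2d}$ with $A\in\mathbb{R}^{2d\times2d}$ invertible. $T_af(x)=f(x-a)$, $M_bf(x)=e^{2\pi ib\cdot x}f(x)$, $\pi(a,b)=T_aM_b$ for $a,b\in\mathbb{R}^d$. For $g\in L^2(\mathbb{R}^d)$, the analysis operator is $C_{\Lambda,g}f=(\langle f,\pi(\lambda)g\rangle)_{\lambda\in\Lambda}$, and $\mathcal{B}_\Lambda$ is the set of all $g\in L^2(\mathbb{R}^d)$ for which $C_{\Lambda,g}$ is a bounded operator $L^2(\mathbb{R}^d)\to\ell^2(\Lambda)$. For $g,h\in\mathcal{B}_\Lambda$ the cross frame operator is $S_{\Lambda,g,h}=C_{\Lambda,h}^*C_{\Lambda,g}$, i.e. $S_{\Lambda,g,h}f=\sum_{\lambda\in\Lambda}\langle f,\pi(\lambda)g\rangle\pi(\lambda)h$, and $S_{\Lambda,g}:=S_{\Lambda,g,g}$. With $w(x)=1+|x|$, $L^2_w(\mathbb{R}^d)=\{f:\mathbb{R}^d\to\mathbb{C}:wf\in L^2\}$ has norm $\|f\|_{L^2_w}=\|wf\|_{L^2}$, and $L^2_{w,\Lambda}(\mathbb{R}^d):=L^2_w(\mathbb{R}^d)\cap\mathcal{B}_\Lambda$ is a Banach space with norm $\|f\|_{L^2_{w,\Lambda}}=\|f\|_{L^2_w}+\|C_{\Lambda,f}\|_{L^2\to\ell^2}$. For a bounded operator $T$ on a complex Banach space $X$, $\sigma(T)$ is the set of $z\in\mathbb{C}$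 for which $T-zI:X\to X$ is not bijective. *)

(* Defs.v *)
From HB Require Import structures.
From mathcomp Require Import all_boot all_order all_algebra.
From mathcomp Require Import complex.
From mathcomp Require Import all_classical all_reals all_analysis.
From mathcomp Require Import measurable_realfun.

Set Implicit Arguments.
Unset Strict Implicit.
Unset Printing Implicit Defensive.

Import Order.TTheory GRing.Theory Num.Theory.
Import numFieldNormedType.Exports.
Import Normc.

Local Open Scope classical_set_scope.
Local Open Scope ring_scope.
Local Open Scope complex_scope.
Local Open Scope quotient_scope.

Notation euclid R d := (d.-tuple (measurableTypeR R)) (only parsing).

(* Lebesgue measure on R^n: the n-fold product of lebesgue_measure, transported
   along (x, t) |-> x :: t. *)
Section lebesgue.
Context {R : realType}.

Section cons.
Variables (n : nat) (mu : {sigma_finite_measure set (euclid R n) -> \bar R}).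

Let consE (p : measurableTypeR R * euclid R n) : euclid R n.+1 :=
  [tuple of p.1 :: p.2].

Let measurable_consE : measurable_fun setT consE.
Proof. exact: measurable_cons. Qed.

Definition lebesgue_cons : set (euclid R n.+1) -> \bar R :=
  pushforward (lebesgue_measure \x mu)%E consE.

Let lebesgue_cons0 : lebesgue_cons set0 = 0%E.
Proof. by rewrite /lebesgue_cons /pushforward preimage_set0 measure0. Qed.

Let lebesgue_cons_ge0 A : (0 <= lebesgue_cons A)%E.
Proof. exact: measure_ge0. Qed.

Let lebesgue_cons_sigma_additive : semi_sigma_additive lebesgue_cons.
Proof. exact: (@measure_semi_sigma_additive _ _ _
  (@pushforward _ _ _ _ _ (lebesgue_measure \x mu)%E consE)). Qed.

HB.instance Definition _ := isMeasure.Build _ _ _ lebesgue_cons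
  lebesgue_cons0 lebesgue_cons_ge0 lebesgue_cons_sigma_additive.

Let lebesgue_cons_sigma_finite : sigma_finite setT lebesgue_cons.
Proof.
have /sigma_finiteP[F [TF ndF Foo]] := sigma_finiteT (@lebesgue_measure R).
have /sigma_finiteP[G [TG ndG Goo]] := sigma_finiteT mu.
pose unc (t : euclid R n.+1) : measurableTypeR R * euclid R n :=
  (thead t, [tuple of behead t]).
have munc : measurable_fun setT unc.
  apply/measurable_fun_pairP; split => /=.
    exact: measurable_tnth.
  exact: measurable_behead.
have uncK p : unc (consE p) = p.
  by case: p => x t; congr pair; apply/val_inj.
exists (fun k => unc @^-1` (F k `*` G k)).
  apply/seteqP; split=> // t _.
  have [i _ Fi] : (\bigcup_k F k) (unc t).1 by rewrite -TF.
  have [j _ Gj] : (\bigcup_k G k) (unc t).2 by rewrite -TG.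
  exists (maxn i j) => //; split.
    by move: Fi; exact/subsetPset/ndF/leq_maxl.
  by move: Gj; exact/subsetPset/ndG/leq_maxr.
move=> k; have [mF Fk] := Foo k; have [mG Gk] := Goo k; split.
  by rewrite -[X in measurable X]setTI; apply: munc => //; exact: measurableX.
rewrite /lebesgue_cons /pushforward -comp_preimage.
rewrite (_ : unc \o consE = id) ?preimage_id; last exact/funext.
by rewrite product_measure1E// lte_mul_pinfty// ge0_fin_numE.
Qed.

HB.instance Definition _ := Measure_isSigmaFinite.Build _ _ _ lebesgue_cons
  lebesgue_cons_sigma_finite.

End cons.

Fixpoint lebesgue_tuple (n : nat) :
    {sigma_finite_measure set (euclid R n) -> \bar R} :=
  match n with
  | 0%N => \d_([tuple] : euclid R 0)
  | m.+1 => lebesgue_cons (lebesgue_tuple m)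
  end.

End lebesgue.

Section square_integrable.
Context {R : realType} {d : nat}.
Local Notation C := R[i].
Local Notation E := (euclid R d).
Local Notation leb := (@lebesgue_tuple R d).
Implicit Types f g : E -> C.

Definition complex_measurable f :=
  measurable_fun setT (fun x => complex.Re (f x)) /\
  measurable_fun setT (fun x => complex.Im (f x)).

Definition L2norm f : \bar R := Lnorm leb 2%:E (fun x => (normc (f x))%:E).

Definition square_integrable f := complex_measurable f /\ (L2norm f < +oo)%E.

Definition L2inner f g : C :=
  (\int[leb]_x complex.Re (f x * (g x)^*)) +i*
  (\int[leb]_x complex.Im (f x * (g x)^*)).

Lemma complex_measurable_normc f : complex_measurable f ->
  measurable_fun setT (fun x => normc (f x)).
Proof.
move=> [mRe mIm].
rewrite (_ : (fun x => _) = fun x =>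
    Num.sqrt (complex.Re (f x) ^+ 2 + complex.Im (f x) ^+ 2)); last first.
  by apply/funext => x; case: (f x).
apply: (@measurableT_comp _ _ _ _ _ _ (@Num.sqrt R)).
  by apply: continuous_measurable_fun; exact: sqrt_continuous.
by apply: measurable_funD; exact: measurable_funX.
Qed.

Lemma complex_measurableD f g : complex_measurable f -> complex_measurable g ->
  complex_measurable (fun x => f x + g x).
Proof.
move=> [fr fi] [gr gi]; split.
- rewrite (_ : (fun x => _) = fun x => complex.Re (f x) + complex.Re (g x)).
    exact: measurable_funD.
  by apply/funext => x; rewrite raddfD.
- rewrite (_ : (fun x => _) = fun x => complex.Im (f x) + complex.Im (g x)).
    exact: measurable_funD.
  by apply/funext => x; rewrite raddfD.
Qed.

Lemma complex_measurableZ (a : C) f : complex_measurable f ->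
  complex_measurable (fun x => a * f x).
Proof.
case: a => a b [fr fi]; split.
- rewrite (_ : (fun x => _) =
      fun x => a * complex.Re (f x) - b * complex.Im (f x)).
    by apply: measurable_funB; exact: measurable_funM.
  by apply/funext => x; case: (f x).
- rewrite (_ : (fun x => _) =
      fun x => a * complex.Im (f x) + b * complex.Re (f x)).
    by apply: measurable_funD; exact: measurable_funM.
  by apply/funext => x; case: (f x).
Qed.

Let square_integrableLfun f : square_integrable f ->
  (fun x => normc (f x)) \in Lfun leb 2%:E.
Proof.
move=> [mf nf]; apply/andP; split; rewrite inE //=.
exact: complex_measurable_normc.
Qed.

Let square_integrable_dom f (h : E -> R) : complex_measurable f ->
  h \in Lfun leb 2%:E -> (forall x, normc (f x) <= h x) -> square_integrable f.
Proof.
move=> mf /andP[]; rewrite !inE /= /finite_norm => mh nh fh; split => //.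
have n0 x : 0 <= normc (f x) by case: (f x) => a b; exact: sqrtr_ge0.
apply: le_lt_trans nh; rewrite /L2norm unlock /=.
have mpow (k : E -> R) : measurable_fun setT k ->
    measurable_fun setT (fun x => `|(k x)%:E| `^ 2)%E.
  move=> mk; apply: (@measurableT_comp _ _ _ _ _ _ (@poweR R ^~ 2)).
    exact: measurable_poweR.
  by apply: measurableT_comp => //; exact/measurable_EFinP.
rewrite gt0_ler_poweR ?invr_ge0//.
- by rewrite in_itv/= leey integral_ge0// => x _; exact: poweR_ge0.
- by rewrite in_itv/= leey integral_ge0// => x _; exact: poweR_ge0.
apply: ge0_le_integral => //.
- by apply: mpow; exact: complex_measurable_normc.
- exact: mpow.
move=> x _; rewrite /= lee_fin ge0_ler_powR ?nnegrE//.
by rewrite !ger0_norm ?(le_trans (n0 x)).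
Qed.

Lemma square_integrableD f g : square_integrable f -> square_integrable g ->
  square_integrable (fun x => f x + g x).
Proof.
move=> sf sg.
apply: (@square_integrable_dom _ (fun x => normc (f x) + normc (g x))).
- exact: complex_measurableD sf.1 sg.1.
- have [_ cl] := Lfun_submod_closed leb (lee1n 2).
  have := cl 1 _ _ (square_integrableLfun sf) (square_integrableLfun sg).
  by rewrite scale1r.
- move=> x; have := ler_normD (f x) (g x).
  by rewrite !normc_def; case: (f x) (g x) => a b [c e] /=; rewrite -rmorphD lecR.
Qed.

Lemma square_integrableZ (a : C) f : square_integrable f ->
  square_integrable (fun x => a * f x).
Proof.
move=> sf; apply: (@square_integrable_dom _ (fun x => normc a * normc (f x))).
- exact: complex_measurableZ sf.1.
- have [z cl] := Lfun_submod_closed leb (lee1n 2).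
  have := cl (normc a) _ _ (square_integrableLfun sf) z.
  by rewrite addr0.
- by move=> x; rewrite normcM.
Qed.

Lemma square_integrable0 : square_integrable (fun=> 0).
Proof.
split; first by split; exact: measurable_cst.
rewrite /L2norm (_ : (fun=> _) = cst 0%E) ?Lnorm0 ?ltry//.
by apply/funext => x; rewrite normc0.
Qed.

End square_integrable.

Section L2.
Context {R : realType} {d : nat}.
Local Notation C := R[i].
Local Notation E := (euclid R d).
Local Notation leb := (@lebesgue_tuple R d).

Record L2fun := MkL2fun {
  L2fun_val :> E -> C;
  L2funP : square_integrable L2fun_val }.

HB.instance Definition _ := gen_eqMixin L2fun.
HB.instance Definition _ := gen_choiceMixin L2fun.

Definition L2fun_ae_eq (f g : L2fun) := `[< ae_eq leb setT f g >].

Let L2fun_ae_eq_refl : reflexive L2fun_ae_eq.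
Proof. by move=> f; exact/asboolP/ae_eq_refl. Qed.

Let L2fun_ae_eq_sym : symmetric L2fun_ae_eq.
Proof.
by move=> f g; apply/idP/idP => /asboolP h; exact/asboolP/ae_eq_sym.
Qed.

Let L2fun_ae_eq_trans : transitive L2fun_ae_eq.
Proof.
by move=> g f h /asboolP fg /asboolP gh; exact/asboolP/(ae_eq_trans fg gh).
Qed.

Canonical L2fun_ae_eq_equiv :=
  EquivRel L2fun_ae_eq L2fun_ae_eq_refl L2fun_ae_eq_sym L2fun_ae_eq_trans.

Definition L2space : Type := {eq_quot L2fun_ae_eq}.
HB.instance Definition _ := Choice.on L2space.
HB.instance Definition _ := EqQuotient.on L2space.

(* An arbitrary representative: use it only where the result is invariant under
   a.e. equality. *)
Definition L2space_fun (u : L2space) : E -> C := repr u.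
Coercion L2space_fun : L2space >-> Funclass.

Let L2funD (f g : L2fun) := MkL2fun (square_integrableD (L2funP f) (L2funP g)).
Let L2funZ a (f : L2fun) := MkL2fun (square_integrableZ a (L2funP f)).
Let L2fun0 := MkL2fun (@square_integrable0 R d).

Let L2eqP (f g : L2fun) :
  ae_eq leb setT f g <-> \pi_L2space f = \pi_L2space g.
Proof.
split => [fg|/eqP]; first by apply/eqP; rewrite eqmodE; exact/asboolP.
by rewrite eqmodE => /asboolP.
Qed.

Let L2reprK (f : L2fun) : ae_eq leb setT (repr (\pi_L2space f)) f.
Proof. by apply/L2eqP; rewrite reprK. Qed.

Definition L2zero : L2space := \pi_L2space L2fun0.
Definition L2add (u v : L2space) : L2space :=
  \pi_L2space (L2funD (repr u) (repr v)).
Definition L2scale (a : C) (u : L2space) : L2space :=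
  \pi_L2space (L2funZ a (repr u)).
Definition L2opp (u : L2space) : L2space := L2scale (-1) u.

Let L2addE f g : L2add (\pi_L2space f) (\pi_L2space g) = \pi_L2space (L2funD f g).
Proof.
apply/L2eqP; move: (L2reprK f) (L2reprK g); apply: filterS2 => x /= hf hg _.
by rewrite hf ?hg.
Qed.

Let L2scaleE a f : L2scale a (\pi_L2space f) = \pi_L2space (L2funZ a f).
Proof.
by apply/L2eqP; move: (L2reprK f); apply: filterS => x /= hf _; rewrite hf.
Qed.

Let L2ext (f g : L2fun) : f =1 g -> \pi_L2space f = \pi_L2space g.
Proof. by move=> fg; apply/L2eqP; apply: aeW => x _; exact: fg. Qed.

Let L2addA : associative L2add.
Proof.
elim/quotW=> f; elim/quotW=> g; elim/quotW=> h.
rewrite (L2addE g h) (L2addE f g) (L2addE f) (L2addE _ h).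
by apply: L2ext => x /=; rewrite addrA.
Qed.

Let L2addC : commutative L2add.
Proof.
elim/quotW=> f; elim/quotW=> g; rewrite (L2addE f g) (L2addE g f).
by apply: L2ext => x /=; rewrite addrC.
Qed.

Let L2add0 : left_id L2zero L2add.
Proof.
elim/quotW=> f; rewrite (L2addE L2fun0 f).
by apply: L2ext => x /=; rewrite add0r.
Qed.

Let L2addN : left_inverse L2zero L2opp L2add.
Proof.
elim/quotW=> f; rewrite /L2opp (L2scaleE (-1) f) (L2addE _ f).
by apply: L2ext => x /=; rewrite mulN1r addNr.
Qed.

HB.instance Definition _ :=
  GRing.isZmodule.Build L2space L2addA L2addC L2add0 L2addN.

Let L2scaleA a b u : L2scale a (L2scale b u) = L2scale (a * b) u.
Proof.
elim/quotW: u => f; rewrite (L2scaleE b f) (L2scaleE a) (L2scaleE (a * b) f).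
by apply: L2ext => x /=; rewrite mulrA.
Qed.

Let L2scale1 : left_id 1 L2scale.
Proof.
elim/quotW=> f; rewrite (L2scaleE 1 f).
by apply: L2ext => x /=; rewrite mul1r.
Qed.

Let L2scaleDr : right_distributive L2scale +%R.
Proof.
move=> a; elim/quotW=> f; elim/quotW=> g.
change (L2scale a (L2add (\pi f) (\pi g)) =
  L2add (L2scale a (\pi f)) (L2scale a (\pi g))).
rewrite (L2addE f g) (L2scaleE a f) (L2scaleE a g) (L2scaleE a) L2addE.
by apply: L2ext => x /=; rewrite mulrDr.
Qed.

Let L2scaleDl u : {morph L2scale^~ u : a b / a + b}.
Proof.
elim/quotW: u => f a b.
change (L2scale (a + b) (\pi f) =
  L2add (L2scale a (\pi f)) (L2scale b (\pi f))).
rewrite (L2scaleE (a + b) f) (L2scaleE a f) (L2scaleE b f) L2addE.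
by apply: L2ext => x /=; rewrite mulrDl.
Qed.

HB.instance Definition _ := GRing.Zmodule_isLmodule.Build C L2space
  L2scaleA L2scale1 L2scaleDr L2scaleDl.

End L2.
Arguments L2space : clear implicits.

Section operators.
Context {K : pzRingType} {V : lmodType K}.

(* The subspace X carries its own norm N, which need not be the restriction of
   a norm on V. *)
Definition bounded_operator_on {R : realType} (X : set V) (N : V -> R)
    (T : V -> V) :=
  [/\ set_fun X X T,
      {in X &, forall (u v : V) (a : K), T (a *: u + v) = a *: T u + T v} &
      exists M : R, {in X, forall u, N (T u) <= M * N u}].

Definition spectrum (X : set V) (T : V -> V) : set K :=
  [set z | ~ set_bij X X (fun u => T u - z *: u)].

End operators.

Section gabor.
Context {R : realType} {d : nat}.
Local Notation C := R[i].
Local Notation E := (euclid R d).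
Local Notation L2 := (L2space R d).
Implicit Types (a b : 'cV[R]_d) (l : 'cV[R]_(d + d)) (L : set 'cV[R]_(d + d)).

Definition is_lattice n (L : set 'cV[R]_n) :=
  exists2 A : 'M[R]_n, A \in unitmx &
    L = [set A *m map_mx intr z | z in [set: 'cV[int]_n]].

Definition translation a (f : E -> C) : E -> C :=
  fun x => f [tuple tnth x i - a i 0 | i < d].

Definition modulation b (f : E -> C) : E -> C := fun x =>
  let t := 2 * pi * \sum_(i < d) b i 0 * tnth x i in
  (cos t +i* sin t) * f x.

Definition tfshift l (f : E -> C) : E -> C :=
  translation (usubmx l) (modulation (dsubmx l) f).

(* Defined on all of the phase space; C_{L,g} f is its restriction to L, and
   only that restriction enters below. *)
Definition analysis (g f : L2) : 'cV[R]_(d + d) -> C :=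
  fun l => L2inner f (tfshift l g).

Definition ell2norm L (c : 'cV[R]_(d + d) -> C) : \bar R :=
  ((\esum_(l in L) (normc (c l) ^+ 2)%:E) `^ 2^-1)%E.

Definition analysis_bound L (g : L2) : set R :=
  [set M | 0 <= M /\
    forall f : L2, (ell2norm L (analysis g f) <= M%:E * L2norm f)%E].

(* The set B_L of the g for which C_{L,g} : L^2 -> ell^2(L) is bounded. *)
Definition bessel L : set L2 := [set g | analysis_bound L g !=set0].

Definition analysis_opnorm L (g : L2) : R := inf (analysis_bound L g).

(* The adjoint of C_{L,h}, c |-> sum_{l in L} c_l pi(l) h, the sum being the
   limit in L^2 of the net of finite partial sums.  The default value 0
   is for divergent sums, which do not occur for h in bessel L and c in
   ell^2(L). *)
Definition synthesis L (h : L2) (c : 'cV[R]_(d + d) -> C) : L2 :=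
  xget 0 [set u : L2 | forall e : R, 0 < e ->
    exists2 A, fsets L A & forall B, fsets L B -> A `<=` B ->
      (L2norm (fun x => (\sum_(l \in B) c l * tfshift l h x) - u x)%R < e%:E)%E].

Definition frame_operator L (g h f : L2) : L2 := synthesis L h (analysis g f).

Definition weight (x : E) : R := 1 + Num.sqrt (\sum_(i < d) tnth x i ^+ 2).

Definition weighted (f : E -> C) : E -> C := fun x => (weight x)%:C * f x.

Definition L2w_bessel L : set L2 :=
  [set f : L2 | square_integrable (weighted f)] `&` bessel L.

Definition L2w_bessel_norm L (f : L2) : R :=
  fine (L2norm (weighted f)) + analysis_opnorm L f.

End gabor.

(* Main.v *)
(* Every estimate for the frame operator S_(g,h) f holds, by duality, with the
   roles of g, h and f exchanged; the key one bounds |S_(g,x) f| by |x| and the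
   Bessel bounds of f and g.  It follows from Lax's argument: the norms of the
   iterates of a symmetrized operator form a log-convex sequence, whose growth is
   controlled in a stronger norm.  Multiplication by x_j generates the modulations
   M_t in the direction j, so f is in L^2_w if and only if |M_t f - f| = O(t) for
   all j.  The commutator of S = S_(g,h) with M_t is a sum of frame operators with
   windows M_t g - g and M_t h - h.  Hence S is bounded on the weighted Bessel
   space X, and X is invariant under (S - z)^-1 if S - z is invertible on L^2.

   Conversely, let S - z be bijective on X, with g = h.  If z is not real, S - z
   is invertible on L^2 since S is self-adjoint.  If z is real, Banach's theorem
   bounds the inverse on X, Lax's argument bounds it for the L^2 norm, and X is
   dense: tensor products of compactly supported C^{1,1} functions are in X by
   the Schur test, since their ambiguity functions decay quadratically in each
   coordinate, and they approximate the indicator functions of boxes. *)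

Require Import Defs.
From mathcomp Require Import all_boot all_order all_algebra.
From mathcomp Require Import complex ring lra.
From mathcomp Require Import all_classical all_reals all_analysis.
From mathcomp Require Import measurable_realfun.

Set Implicit Arguments.
Unset Strict Implicit.
Unset Printing Implicit Defensive.

Import Order.TTheory GRing.Theory Num.Theory.
Import numFieldNormedType.Exports.
Import Normc.

Local Open Scope classical_set_scope.
Local Open Scope ring_scope.
Local Open Scope complex_scope.
Local Open Scope quotient_scope.

(** * Inner product spaces and Banach's theorem *)

(** The estimate that shapes the proof is the one in which the second window [x] of [frame g x f]
    varies: the Bessel inequality only bounds such a sum by the Bessel constant of [x]. The
    commutator needs the norm of [x] instead, since [P m h - h] is O(t) in norm while nothing makes
    its Bessel constant small. For the first window the symmetry of the coefficients already
    suffices.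

    Differences [P (freq j t) u - u] stand in for multiplication by x_j because the shifts are
    everywhere defined isometries that carry a frame operator exactly to another one. The commutator
    bound sees the signal only through its Bessel constant. It therefore applies to a solution [u]
    of [T u = f] before [u] is known to have any moment, and no a priori regularity of [u] enters.

    Up to the equivalence of the two bijectivities, the argument lives in a Hilbert space with a
    projective representation. The weighted norm occurs there as a family of balls with a single
    constant, since boundedness and bijectivity see a norm only up to equivalence. *)

Section complex_numbers.
Context {R : realType}.
Implicit Types (z w : R[i]) (x : R).

Lemma normc_ge0 z : 0 <= normc z.
Proof. by case: z => a b; exact: sqrtr_ge0. Qed.

Lemma normc_conj z : normc (conjc z) = normc z.
Proof. by case: z => a b /=; rewrite sqrrN. Qed.

Lemma normc_sqrE z : normc z ^+ 2 = complex.Re z ^+ 2 + complex.Im z ^+ 2.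
Proof. by case: z => a b /=; rewrite sqr_sqrtr// addr_ge0// sqr_ge0. Qed.

Lemma mul_conjc z : z * conjc z = (normc z ^+ 2)%:C.
Proof.
rewrite normc_sqrE; case: z => a b /=.
by apply/eqP; rewrite eq_complex /=; apply/andP; split; apply/eqP; ring.
Qed.

Lemma normr_Re_le_normc z : `|complex.Re z| <= normc z.
Proof.
rewrite -[leRHS]ger0_norm ?normc_ge0// -ler_sqr ?nnegrE// !real_normK ?num_real//.
by rewrite normc_sqrE lerDl sqr_ge0.
Qed.

Lemma Im_le_normc z : `|complex.Im z| <= normc z.
Proof.
rewrite -[leRHS]ger0_norm ?normc_ge0// -ler_sqr ?nnegrE// !real_normK ?num_real//.
by rewrite normc_sqrE lerDr sqr_ge0.
Qed.

Lemma Re_le_normc z : complex.Re z <= normc z.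
Proof. exact: le_trans (ler_norm _) (normr_Re_le_normc z). Qed.

Lemma normc_real x : normc x%:C = `|x|.
Proof. by rewrite /= expr0n /= addr0 sqrtr_sqr. Qed.

Lemma ReD z w : complex.Re (z + w) = complex.Re z + complex.Re w.
Proof. by rewrite raddfD. Qed.

Lemma ReN z : complex.Re (- z) = - complex.Re z.
Proof. by rewrite raddfN. Qed.

Lemma ImD z w : complex.Im (z + w) = complex.Im z + complex.Im w.
Proof. by rewrite raddfD. Qed.

Lemma Re_conj z : complex.Re (conjc z) = complex.Re z.
Proof. by case: z. Qed.

Lemma Re_realM x z : complex.Re (x%:C * z) = x * complex.Re z.
Proof. by case: z => a b /=; rewrite mul0r subr0. Qed.

Lemma conjc_realM x z : conjc (x%:C * z) = x%:C * conjc z.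
Proof. by rewrite rmorphM; congr (_ * _); rewrite /= oppr0. Qed.

Lemma complex_realE z : complex.Im z = 0 -> z = (complex.Re z)%:C.
Proof. by case: z => a b /= ->. Qed.

Lemma normc_sum (I : Type) (s : seq I) (F : I -> R[i]) :
  normc (\sum_(i <- s) F i) <= \sum_(i <- s) normc (F i).
Proof.
elim: s => [|i s IH]; first by rewrite !big_nil normc0.
by rewrite !big_cons (le_trans (le_normcD _ _))// lerD2l.
Qed.

Lemma unimodular_normc z : z * conjc z = 1 -> normc z = 1.
Proof.
rewrite mul_conjc => /(congr1 (@complex.Re R)) /= h.
by apply/eqP; rewrite -(@eqrXn2 _ 2) ?normc_ge0// h expr1n.
Qed.

End complex_numbers.

Section logconvex.
Context {R : realType}.

Lemma sum_CauchySchwarz (I : Type) (s : seq I) (a b : I -> R) :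
  (\sum_(i <- s) a i * b i) ^+ 2 <=
  (\sum_(i <- s) a i ^+ 2) * (\sum_(i <- s) b i ^+ 2).
Proof.
elim: s => [|i s IH]; first by rewrite !big_nil expr0n mulr0.
rewrite !big_cons.
set S := \sum_(i <- s) a i * b i in IH *.
set A := \sum_(i <- s) a i ^+ 2 in IH *; set B := \sum_(i <- s) _ in IH *; move: (a i) (b i) => x y.
have A0 : 0 <= A by apply: sumr_ge0 => j _; exact: sqr_ge0.
have B0 : 0 <= B by apply: sumr_ge0 => j _; exact: sqr_ge0.
have xyS : 2 * (x * y * S) <= x ^+ 2 * B + y ^+ 2 * A.
  apply: le_trans (ler_norm _) _.
  have p0 : 0 <= x ^+ 2 * B + y ^+ 2 * A.
    by rewrite addr_ge0// mulr_ge0// sqr_ge0.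
  rewrite -[leRHS]ger0_norm// -ler_sqr ?nnegrE// !real_normK ?num_real//.
  have : x ^+ 2 * y ^+ 2 * S ^+ 2 <= x ^+ 2 * y ^+ 2 * (A * B).
    by rewrite ler_wpM2l// mulr_ge0// sqr_ge0.
  have : 0 <= (x ^+ 2 * B - y ^+ 2 * A) ^+ 2 by exact: sqr_ge0.
  by nra.
by nra.
Qed.

(* Log-convexity makes the successive ratios nondecreasing, so an exponential
   growth rate bounds the first one. *)
Lemma logconvex_le (a : nat -> R) (K M : R) : 0 <= M ->
  (forall n, 0 <= a n) -> (forall n, a n.+1 ^+ 2 <= a n.+2 * a n) ->
  (forall n, a n <= K * M ^+ n) -> a 1%N <= M * a 0%N.
Proof.
move=> M0 a0 acvx aK; rewrite leNgt; apply/negP => h.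
have a1 : 0 < a 1%N by apply: le_lt_trans h; rewrite mulr_ge0.
have a00 : 0 < a 0%N.
  rewrite lt_neqAle a0 andbT; apply/eqP => e.
  by have := acvx 0%N; rewrite -e mulr0 leNgt exprn_gt0.
have Mpos : 0 < M.
  rewrite lt_neqAle M0 andbT; apply/eqP => e.
  by have := aK 1%N; rewrite -e expr1 mulr0 leNgt a1.
pose q := a 1%N / a 0%N.
have Mq : M < q by rewrite /q ltr_pdivlMr.
have q0 : 0 < q by exact: lt_trans Mq.
have step n : 0 < a n /\ q * a n <= a n.+1.
  elim: n => [|n [an IH]]; first by rewrite /q divfK ?gt_eqF.
  have an1 : 0 < a n.+1 by apply: lt_le_trans IH; rewrite mulr_gt0.
  split => //; rewrite -(ler_pM2r an); apply: le_trans (acvx n).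
  by rewrite -mulrA mulrCA expr2 ler_pM2l.
have geo n : q ^+ n * a 0%N <= a n.
  elim: n => [|n IH]; first by rewrite expr0 mul1r.
  rewrite exprS -mulrA; apply: le_trans (step n).2.
  by rewrite ler_wpM2l// ltW.
pose r := q / M.
have r1 : 1 < r by rewrite /r ltr_pdivlMr// mul1r.
have rK n : r ^+ n <= K / a 0%N.
  rewrite ler_pdivlMr// /r expr_div_n mulrAC ler_pdivrMr ?exprn_gt0//.
  exact: le_trans (geo n) (aK n).
(* Bernoulli's inequality makes [r ^+ n] unbounded, against [rK]. *)
have bern n : 1 + (r - 1) *+ n <= r ^+ n.
  elim: n => [|n IH]; first by rewrite expr0 mulr0n addr0.
  rewrite exprS mulrSr; have : 0 <= (r - 1) *+ n by rewrite mulrn_wge0// subr_ge0 ltW.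
  by nra.
have /archi_boundP : 0 <= K / a 0%N / (r - 1).
  rewrite divr_ge0 ?subr_ge0 ?(ltW r1)//.
  by apply: le_trans (rK 0%N); rewrite expr0.
set n := Num.bound _; rewrite ltr_pdivrMr ?subr_gt0// mulr_natl => hn.
by have := le_trans (bern n) (rK n); lra.
Qed.

End logconvex.

Section inner_product.
Context {R : realType} {V : lmodType R[i]}.

Record inner_product (ip : V -> V -> R[i]) : Prop := {
  ip_linear : forall a u v w, ip (a *: u + v) w = a * ip u w + ip v w;
  ip_conj : forall u v, ip v u = conjc (ip u v);
  ip_ge0 : forall u, 0 <= complex.Re (ip u u);
  ip_eq0 : forall u, ip u u = 0 -> u = 0 }.

Definition ipnorm (ip : V -> V -> R[i]) (u : V) : R :=
  Num.sqrt (complex.Re (ip u u)).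

Context (ip : V -> V -> R[i]) (ipP : inner_product ip).
Local Notation "'<|' u ',' v '|>'" := (ip u v) (at level 0, u, v at level 99).
Local Notation nrm := (ipnorm ip).
Implicit Types (u v w : V) (a : R[i]).

Lemma ip0l v : <| 0, v |> = 0.
Proof.
have := ip_linear ipP 1 0 0 v; rewrite scale1r addr0 mul1r => h.
by apply: (@addrI _ <|0, v|>); rewrite addr0 -h.
Qed.

Lemma ipDl u v w : <| u + v, w |> = <| u, w |> + <| v, w |>.
Proof. by rewrite -[X in X + _]scale1r (ip_linear ipP) mul1r. Qed.

Lemma ipZl a u w : <| a *: u, w |> = a * <| u, w |>.
Proof. by rewrite -[X in <|X, _|>]addr0 (ip_linear ipP) ip0l addr0. Qed.

Lemma ipNl u w : <| - u, w |> = - <| u, w |>.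
Proof. by rewrite -scaleN1r ipZl mulN1r. Qed.

Lemma ipBl u v w : <| u - v, w |> = <| u, w |> - <| v, w |>.
Proof. by rewrite ipDl ipNl. Qed.

Lemma ip0r v : <| v, 0 |> = 0.
Proof. by rewrite (ip_conj ipP) ip0l conjc0. Qed.

Lemma ipDr u v w : <| w, u + v |> = <| w, u |> + <| w, v |>.
Proof.
by rewrite (ip_conj ipP) ipDl rmorphD /= -!(ip_conj ipP).
Qed.

Lemma ipZr a u w : <| w, a *: u |> = conjc a * <| w, u |>.
Proof. by rewrite (ip_conj ipP) ipZl rmorphM /= -(ip_conj ipP). Qed.

Lemma ipNr u w : <| w, - u |> = - <| w, u |>.
Proof. by rewrite (ip_conj ipP) ipNl rmorphN /= -(ip_conj ipP). Qed.

Lemma ipBr u v w : <| w, u - v |> = <| w, u |> - <| w, v |>.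
Proof. by rewrite ipDr ipNr. Qed.

Lemma ip_suml (I : Type) (s : seq I) (F : I -> V) w :
  <| \sum_(i <- s) F i, w |> = \sum_(i <- s) <| F i, w |>.
Proof.
by elim: s => [|i s IH]; rewrite ?(big_nil, ip0l)// !big_cons ipDl IH.
Qed.

Lemma ip_sumr (I : Type) (s : seq I) (F : I -> V) w :
  <| w, \sum_(i <- s) F i |> = \sum_(i <- s) <| w, F i |>.
Proof.
by elim: s => [|i s IH]; rewrite ?(big_nil, ip0r)// !big_cons ipDr IH.
Qed.

Lemma ip_real u : complex.Im <| u, u |> = 0.
Proof.
have := ip_conj ipP u u; case: <|u, u|> => a b [] /= /eqP.
by rewrite -subr_eq0 opprK -mulr2n mulrn_eq0 /= => /eqP.
Qed.

Lemma ipnorm_ge0 u : 0 <= nrm u.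
Proof. exact: sqrtr_ge0. Qed.
Hint Resolve ipnorm_ge0 : core.

Lemma sqr_ipnorm u : nrm u ^+ 2 = complex.Re <| u, u |>.
Proof. by rewrite sqr_sqrtr//; exact: (ip_ge0 ipP). Qed.

Lemma ipuu u : <| u, u |> = (nrm u ^+ 2)%:C.
Proof. by rewrite sqr_ipnorm -complex_realE// ip_real. Qed.

Lemma ipnorm0 : nrm 0 = 0.
Proof. by rewrite /ipnorm ip0l sqrtr0. Qed.

Lemma ipnorm_eq0 u : nrm u = 0 -> u = 0.
Proof. by move=> u0; apply: (ip_eq0 ipP); rewrite ipuu u0 expr0n. Qed.

Lemma ipnormZ a u : nrm (a *: u) = normc a * nrm u.
Proof.
apply/eqP; rewrite -(@eqrXn2 _ 2) ?mulr_ge0 ?normc_ge0// exprMn !sqr_ipnorm.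
by rewrite ipZl ipZr mulrA mul_conjc Re_realM.
Qed.

Lemma ipnormN u : nrm (- u) = nrm u.
Proof. by rewrite -scaleN1r ipnormZ normcN normc1 mul1r. Qed.

Lemma ipnormBC u v : nrm (u - v) = nrm (v - u).
Proof. by rewrite -ipnormN opprB. Qed.

Lemma sqr_ipnormD u v :
  nrm (u + v) ^+ 2 = nrm u ^+ 2 + nrm v ^+ 2 + 2 * complex.Re <| u, v |>.
Proof.
rewrite !sqr_ipnorm ipDl !ipDr !ReD [<|v, u|>](ip_conj ipP) Re_conj.
by ring.
Qed.

Lemma parallelogram u v :
  nrm (u + v) ^+ 2 + nrm (u - v) ^+ 2 = 2 * nrm u ^+ 2 + 2 * nrm v ^+ 2.
Proof. by rewrite !sqr_ipnormD ipNr ReN ipnormN; ring. Qed.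

Lemma ip_CauchySchwarz u v : normc <| u, v |> <= nrm u * nrm v.
Proof.
set z := <|u, v|>.
have [v0|v0] := eqVneq (nrm v) 0.
  by rewrite /z (ipnorm_eq0 v0) ip0r normc0 mulr_ge0.
have vp : 0 < nrm v by rewrite lt_neqAle eq_sym v0/=.
pose t : R := (nrm v ^+ 2)^-1.
have := exprn_ge0 2 (ipnorm_ge0 (u - (t%:C * z) *: v)).
rewrite sqr_ipnormD ipnormN ipNr ipZr -/z ReN ipnormZ normcM normc_real.
rewrite (_ : conjc (t%:C * z) * z = (t * normc z ^+ 2)%:C); last first.
  by rewrite conjc_realM -mulrA [conjc z * z]mulrC mul_conjc -rmorphM.
rewrite /= -/t.
rewrite [`|t|]ger0_norm ?invr_ge0 ?sqr_ge0// /t => h.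
rewrite -ler_sqr ?nnegrE ?mulr_ge0 ?normc_ge0// exprMn.
rewrite -ler_pdivrMr ?exprn_gt0//.
have e : ((nrm v ^+ 2)^-1 * normc z * nrm v) ^+ 2 = normc z ^+ 2 / nrm v ^+ 2.
  by field.
by move: h; rewrite e; lra.
Qed.

Lemma ipnormD u v : nrm (u + v) <= nrm u + nrm v.
Proof.
rewrite -ler_sqr ?nnegrE ?addr_ge0// sqr_ipnormD.
have := le_trans (Re_le_normc <|u, v|>) (ip_CauchySchwarz u v).
by nra.
Qed.

Lemma ipnormB u v : nrm (u - v) <= nrm u + nrm v.
Proof. by rewrite (le_trans (ipnormD _ _))// ipnormN. Qed.

Lemma ipnorm_tri v u w : nrm (u - w) <= nrm (u - v) + nrm (v - w).
Proof. by rewrite -[u - w](subrKA v) ipnormD. Qed.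

Lemma ipnorm_leB u v : nrm u <= nrm v + nrm (u - v).
Proof. by rewrite -{1}[u](subrK v) addrC ipnormD. Qed.

Lemma ipnorm_sum (I : Type) (s : seq I) (F : I -> V) :
  nrm (\sum_(i <- s) F i) <= \sum_(i <- s) nrm (F i).
Proof.
elim: s => [|i s IH]; first by rewrite !big_nil ipnorm0.
by rewrite !big_cons (le_trans (ipnormD _ _))// lerD2l.
Qed.

Lemma eq0_small (x : R) : 0 <= x -> (forall e, 0 < e -> x <= e) -> x = 0.
Proof.
move=> x0 xe; apply/eqP; rewrite eq_le x0 andbT; apply/ler_addgt0Pr => e e0.
by rewrite add0r xe.
Qed.

Lemma eq_ipnorm_small u v : (forall e, 0 < e -> nrm (u - v) <= e) -> u = v.
Proof.
by move=> h; apply/eqP; rewrite -subr_eq0; apply/eqP/ipnorm_eq0/eq0_small.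
Qed.

Lemma eq_ip u v : (forall w, <| u, w |> = <| v, w |>) -> u = v.
Proof.
move=> h; apply/eqP; rewrite -subr_eq0; apply/eqP/(ip_eq0 ipP).
by rewrite ipBl h subrr.
Qed.

End inner_product.

Section bounded_inverse.
Context {R : realType} {V : lmodType R[i]}.

(* [ball C u] reads "the norm of u is at most C": a Banach norm on the subspace
   [[set u | exists C, ball C u]] given by its balls. *)
Record banach_ball (ball : R -> V -> Prop) : Prop := {
  ball_mono : forall C D u, C <= D -> ball C u -> ball D u;
  ballD : forall C D u v, ball C u -> ball D v -> ball (C + D) (u + v);
  ballZ : forall C a u, ball C u -> ball (normc a * C) (a *: u);
  ball_eq0 : forall u, (forall e : R, 0 < e -> ball e u) -> u = 0;
  ball_complete : forall (u : nat -> V) (r : nat -> R),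
    (forall n, 0 < r n) -> (forall n, r n.+1 <= r n / 2) ->
    (forall n, ball (r n) (u n)) ->
    exists l, forall n, ball (2 * r n) (l - \sum_(k < n) u k) }.

Context (ball : R -> V -> Prop) (ballP : banach_ball ball).

Lemma ballN C u : ball C u -> ball C (- u).
Proof.
by move=> /(ballZ ballP (-1)); rewrite normcN normc1 mul1r scaleN1r.
Qed.

Lemma ballB C D u v : ball C u -> ball D v -> ball (C + D) (u - v).
Proof. by move=> bu /ballN; exact: (ballD ballP). Qed.

Lemma ballZr C (x : R) u : 0 <= x -> ball C u -> ball (x * C) (x%:C *: u).
Proof. by move=> x0 /(ballZ ballP x%:C); rewrite normc_real ger0_norm. Qed.

Section inverse.
Context (T : V -> V) (t : R).
Hypothesis Tlin : forall a u v, T (a *: u + v) = a *: T u + T v.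
Hypothesis t0 : 0 < t.
Hypothesis Tbound : forall C u, ball C u -> ball (t * C) (T u).
Hypothesis Tsurj : forall C f, ball C f -> exists D u, ball D u /\ T u = f.
Hypothesis Tinj : forall C u, ball C u -> T u = 0 -> u = 0.

Let T0 : T 0 = 0.
Proof.
have := Tlin 1 0 0; rewrite !scale1r addr0 => h.
by apply: (@addrI _ (T 0)); rewrite addr0 -h.
Qed.

Let TD u v : T (u + v) = T u + T v.
Proof. by rewrite -[X in T (X + _)]scale1r Tlin scale1r. Qed.

Let TZ a u : T (a *: u) = a *: T u.
Proof. by rewrite -[X in T X]addr0 Tlin T0 addr0. Qed.

Let TB u v : T (u - v) = T u - T v.
Proof. by rewrite TD -scaleN1r TZ scaleN1r. Qed.

(* Baire: the sets T (ball n) cover the space, so one of them is dense in a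
   ball. *)
Let baire : (exists u D, ball D u) ->
  exists n x0 (r : R), [/\ exists D, ball D x0, 0 < r & forall y, ball r (y - x0) ->
    forall e : R, 0 < e -> exists2 u, ball n%:R u & ball e (y - T u)].
Proof.
move=> [u0 [D0 bu0]]; apply: contrapT => neg.
(* As [T (ball n)] is dense in no ball, some [y] near [x] keeps a distance [e] from it. The new
   radius is at most [e / 2] because the limit of the centres is only known to lie within twice each
   radius. If [p] is not a genuine ball, the choice is arbitrary. *)
have step (p : nat * (V * R)) : exists q : V * R,
    (exists D, ball D p.2.1) -> 0 < p.2.2 ->
    [/\ ball p.2.2 (q.1 - p.2.1), 0 < q.2, q.2 <= p.2.2 / 2 &
      forall u, ball p.1%:R u -> ~ ball (2 * q.2) (q.1 - T u)].
  case: p => n [x r] /=.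
  have [[[D bx] r0]|no] := pselect ((exists D, ball D x) /\ 0 < r); last first.
    by exists (0, 0) => h r0; exfalso; apply: no.
  suff [y [e [by_ e0 he]]] : exists y (e : R), [/\ ball r (y - x), 0 < e &
      forall u, ball n%:R u -> ~ ball e (y - T u)].
    exists (y, Num.min (r / 2) (e / 2)) => _ _ /=; split => //.
    - by rewrite lt_min !divr_gt0.
    - by rewrite ge_min lexx.
    - move=> u bu /(ball_mono ballP) h; apply: (he u bu); apply: h.
      by rewrite mulrC -ler_pdivlMr// ge_min lexx orbT.
  apply: contrapT => H; apply: neg; exists n, x, r; split => //; first by exists D.
  move=> y yr e e0; apply: contrapT => K; apply: H; exists y, e; split => //.
  by move=> u bu bT; apply: K; exists u.
have [next nextP] := choice step.
pose fix s n : V * R := if n is m.+1 then next (m, s m) else (0, 1).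
have s0 : exists D, ball D 0.
  by exists (normc (0 : R[i]) * D0); rewrite -(scale0r u0); exact: ballZ.
have sP n : (exists D, ball D (s n).1) /\ 0 < (s n).2.
  elim: n => [|n [[D bD] r0]]; first by split.
  have [b1 b2 _ _] := nextP (n, s n) (ex_intro _ D bD) r0; split => //.
  by exists ((s n).2 + D); rewrite -[(s n.+1).1](subrK (s n).1); exact: ballD.
have sN n := nextP (n, s n) (sP n).1 (sP n).2.
have [l lP] := ball_complete ballP (u := fun n => (s n.+1).1 - (s n).1)
  (r := fun n => (s n).2) (fun n => (sP n).2) (fun n => let: And4 _ _ h _ := sN n in h)
  (fun n => let: And4 h _ _ _ := sN n in h).
have tel n : \sum_(k < n) ((s k.+1).1 - (s k).1) = (s n).1.
  by rewrite -(big_mkord xpredT (fun k => (s k.+1).1 - (s k).1)) telescope_sumr//= subr0.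
have lB n : ball (2 * (s n).2) (l - (s n).1) by rewrite -tel; exact: lP.
(* [T] is onto, so the limit is [T u] with [u] in a ball of integer radius [n], which stage [n] has
   excluded. *)
have [D [u [bu Tu]]] : exists D u, ball D u /\ T u = l.
  apply: (@Tsurj (2 * (s 0%N).2 + 0)); have := lB 0%N; rewrite /= subr0 => h.
  by rewrite addr0.
have := (archi_boundP (normr_ge0 D)); set n := Num.bound _ => Dn.
have [_ _ _] := sN n; move=> /(_ u); apply.
  by apply: ball_mono bu => //; apply: le_trans (ler_norm D) (ltW Dn).
by rewrite Tu -opprB; apply: ballN; exact: lB n.+1.
Qed.

(** Open mapping by successive approximation: the dense image found by [baire] solves an equation up
    to half the radius of its right-hand side, and iteration gives an exact solution in a controlled
    ball. Injectivity identifies it with [u], so the bound depends on [C] and not on the ball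
    [D]. *)
Lemma bounded_inverse : exists2 M : R, 0 < M &
  forall (C D : R) u, 0 < C -> ball D u -> ball C (T u) -> ball (M * C) u.
Proof.
have [ne|ne] := pselect (exists u D, ball D u); last first.
  by exists 1 => // C D u _ bu; exfalso; apply: ne; exists u, D.
have [n [x0 [r [[D0 bx0] r0 dense]]]] := baire ne.
(* The centre [x0] is removed by writing [y] as half the difference of [x0 + y] and [x0 - y]. *)
have near0 y : ball r y -> forall e : R, 0 < e ->
    exists2 u, ball n%:R u & ball e (y - T u).
  move=> br e e0.
  have [|u1 bu1 e1] := dense (x0 + y) _ _ e0; first by rewrite addrC addKr.
  have [|u2 bu2 e2] := dense (x0 - y) _ _ e0.
    by rewrite addrC addKr; exact: ballN.
  have h2 : 0 <= 2^-1 :> R by rewrite invr_ge0.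
  have halfD (x : R) : 2^-1 * (x + x) = x by field.
  exists ((2^-1 : R)%:C *: (u1 - u2)).
    by have := ballZr h2 (ballB bu1 bu2); rewrite halfD.
  have := ballZr h2 (ballB e1 e2); rewrite halfD.
  congr (ball e _).
  rewrite TZ TB [in LHS]opprD addrACA -opprD [- (x0 - y)]opprB.
  rewrite [x0 + y]addrC addrACA subrr addr0 [in LHS]scalerBr; congr (_ - _).
  rewrite -mulr2n -[y *+ 2]scaler_nat scalerA (_ : _ * _ = 1) ?scale1r//.
  rewrite -(rmorph_nat (@real_complex R) 2) -rmorphM mulVf ?rmorph1//.
have near1 (C : R) y : 0 < C -> ball C y ->
    exists2 u, ball (n%:R / r * C) u & ball (C / 2) (y - T u).
  move=> C0 bC; have rC : 0 <= r / C by rewrite divr_ge0// ltW.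
  have [|u bu eu] := near0 ((r / C)%:C *: y) _ (r / 2) ltac:(by rewrite divr_gt0).
    by have := ballZr rC bC; rewrite divfK ?gt_eqF.
  have Cr : 0 <= C / r by rewrite divr_ge0// ltW.
  exists ((C / r)%:C *: u).
    by have := ballZr Cr bu; rewrite (_ : C / r * _ = n%:R / r * C)//; ring.
  have := ballZr Cr eu; rewrite scalerBr scalerA -TZ -rmorphM /=.
  rewrite (_ : C / r * (r / C) = 1) ?scale1r; last by field; rewrite !gt_eqF.
  by rewrite (_ : C / r * (r / 2) = C / 2)//; field; rewrite gt_eqF.
(* The [+ 1] keeps [M] positive when [n = 0]. *)
pose M := (n%:R + 1) / r.
have M0 : 0 < M by rewrite divr_gt0// ltr_wpDl.
exists (2 * M) => [|C D u C0 bu bTu]; first by rewrite mulr_gt0.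
have step (p : R * V) : exists w, 0 < p.1 -> ball p.1 p.2 ->
    ball (M * p.1) w /\ ball (p.1 / 2) (p.2 - T w).
  case: p => c y /=; have [[c0 bc]|no] := pselect (0 < c /\ ball c y); last first.
    by exists 0 => c0 bc; exfalso; apply: no.
  have [w bw ew] := near1 c y c0 bc; exists w => _ _; split => //.
  apply: ball_mono bw => //; rewrite ler_pM2r// /M ler_pM2r ?invr_gt0//.
  by rewrite lerDl.
have [next nextP] := choice step.
pose c n : R := C / 2 ^+ n.
have c0 k : 0 < c k by rewrite /c divr_gt0// exprn_gt0.
have cS k : c k.+1 = c k / 2 by rewrite /c exprS invfM mulrA mulrAC.
(* [y k] is what remains of [T u] after [k] corrections [w]; its radius [c k] halves each time. *)
pose fix y k : V := if k is m.+1 then y m - T (next (c m, y m)) else T u.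
pose w k := next (c k, y k).
have yP k : ball (c k) (y k).
  elim: k => [|k IH]; first by rewrite /c expr0 divr1.
  by have [_] := nextP (c k, y k) (c0 k) IH; rewrite /= -cS.
have wP k : ball (M * c k) (w k) by have [] := nextP (c k, y k) (c0 k) (yP k).
have McS k : M * c k.+1 <= M * c k / 2 by rewrite cS mulrA.
have [l lP] := ball_complete ballP (u := w) (r := fun k => M * c k)
  (fun k => mulr_gt0 M0 (c0 k)) McS wP.
have ysum k : y k = T u - T (\sum_(i < k) w i).
  elim: k => [|k IH]; first by rewrite big_ord0 T0 subr0.
  by rewrite big_ord_recr /= TD opprD addrA -IH.
have Tul : T (u - l) = 0.
  apply: (ball_eq0 ballP) => e e0.
  have K0 : 0 < (1 + t * (2 * M)) * C.
    by apply: mulr_gt0 => //; apply: addr_gt0 => //; do 2 apply: mulr_gt0 => //.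
  have := archi_boundP (ltW (divr_gt0 K0 e0)); set k := Num.bound _ => hk.
  have : ball (c k + t * (2 * (M * c k))) (T (u - l)).
    have := ballB (yP k) (Tbound (lP k)).
    by rewrite TB ysum addrAC -[_ - _ - _]addrA -opprD subrK TB.
  apply: ball_mono => //.
  rewrite (_ : _ + _ = (1 + t * (2 * M)) * C / 2 ^+ k); last by rewrite /c; ring.
  rewrite ler_pdivrMr ?exprn_gt0// [leRHS]mulrC -ler_pdivrMr//.
  apply: le_trans (ltW hk) _; rewrite -natrX ler_nat.
  exact/ltnW/ltn_expl.
have b0 := lP 0%N; rewrite big_ord0 subr0 /c expr0 divr1 in b0.
have -> : u = l.
  by apply/eqP; rewrite -subr_eq0; apply/eqP; apply: Tinj Tul; exact: ballB bu b0.
by rewrite -mulrA.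
Qed.

End inverse.
End bounded_inverse.

Lemma geometric_small {R : realType} (K e : R) : 0 < e ->
  exists n, K * (2 ^+ n)^-1 <= e.
Proof.
move=> e0; exists (Num.bound (`|K| / e)); rewrite ler_pdivrMr ?exprn_gt0//.
apply: le_trans (ler_norm K) _; rewrite [leRHS]mulrC -ler_pdivrMr//.
apply: le_trans (ltW (archi_boundP _)) _; first by rewrite divr_ge0// ltW.
by rewrite -natrX ler_nat; exact/ltnW/ltn_expl.
Qed.

Section hilbert.
Context {R : realType} {V : lmodType R[i]}.
Variable ip : V -> V -> R[i].
Hypothesis ipP : inner_product ip.
Local Notation "'<|' u ',' v '|>'" := (ip u v) (at level 0, u, v at level 99).
Local Notation nrm := (ipnorm ip).

(** Only sequences whose increments are bounded by an at least halving [r] are tested; the tail from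
    [n] on is then at most [r n + r n / 2 + ... = 2 * r n]. Every Cauchy sequence has such a
    subsequence. *)
Definition ip_complete := forall (u : nat -> V) (r : nat -> R),
  (forall n, 0 < r n) -> (forall n, r n.+1 <= r n / 2) ->
  (forall n, nrm (u n.+1 - u n) <= r n) ->
  exists l, forall n, nrm (l - u n) <= 2 * r n.

Hypothesis completeP : ip_complete.

Lemma ipnorm_ball : banach_ball (fun C u => nrm u <= C).
Proof.
split.
- by move=> C D u CD uC; exact: le_trans uC CD.
- by move=> C D u v uC vD; rewrite (le_trans (ipnormD ipP _ _))// lerD.
- by move=> C a u uC; rewrite ipnormZ// ler_wpM2l// normc_ge0.
- move=> u h; apply: (ipnorm_eq0 ipP); apply: eq0_small => //.
  exact: ipnorm_ge0.
- move=> u r r0 r2 ur.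
  have [|l lP] := completeP (u := fun n => \sum_(k < n) u k) r0 r2; last by exists l.
  by move=> n; rewrite big_ord_recr /= [_ + u n]addrC addrK.
Qed.

(* The projection of [f] on the closure of [X] is the limit of a minimizing
   sequence, which is Cauchy by the parallelogram law. *)
Lemma dense_of_orthogonal (X : set V) : X 0 ->
  (forall a u v, X u -> X v -> X (a *: u + v)) ->
  (forall f, (forall u, X u -> <|f, u|> = 0) -> f = 0) ->
  forall f e, 0 < e -> exists2 u, X u & nrm (f - u) <= e.
Proof.
move=> X0 Xlin Xorth f e e0.
have XD u v : X u -> X v -> X (u + v).
  by move=> Xu Xv; rewrite -[u]scale1r; exact: Xlin.
have XZ a u : X u -> X (a *: u).
  by move=> Xu; rewrite -[_ *: _]addr0; exact: Xlin.
pose D := [set nrm (f - u) ^+ 2 | u in X].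
have m0 : 0 <= inf D.
  apply: lb_le_inf; first by exists (nrm (f - 0) ^+ 2); exists 0.
  by move=> _ [u _ <-]; exact: sqr_ge0.
have hD : has_inf D.
  split; first by exists (nrm (f - 0) ^+ 2); exists 0.
  by exists 0 => _ [u _ <-]; exact: sqr_ge0.
set m := inf D in m0 *.
have mle u : X u -> m <= nrm (f - u) ^+ 2 by move=> Xu; apply: ge_inf; [case: hD|exists u].
have msup x : m < x -> exists2 u, X u & nrm (f - u) ^+ 2 < x.
  move=> mx; have [_ [u Xu <-] h] := inf_adherent (eps := x - m) ltac:(by rewrite subr_gt0) hD.
  by exists u => //; move: h; rewrite -/m [m + _]addrC subrK.
(* The midpoint of [u] and [v] is in [X], so its squared distance to [f] is at least [m]; the
   parallelogram law turns this into closeness of [u] and [v]. *)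
have close u v x : X u -> X v -> nrm (f - u) ^+ 2 <= m + x -> nrm (f - v) ^+ 2 <= m + x ->
    nrm (u - v) ^+ 2 <= 4 * x.
  move=> Xu Xv ux vx; have := parallelogram ipP (f - u) (f - v).
  have -> : f - u - (f - v) = - (u - v) by rewrite opprB [v - f]addrC addrACA subrr add0r opprB addrC.
  have -> : f - u + (f - v) = (2%:R : R[i]) *: (f - (2%:R^-1 : R[i]) *: (u + v)).
    rewrite scalerBr scalerA mulfV ?pnatr_eq0// scale1r addrACA -opprD.
    by rewrite scaler_nat mulr2n.
  rewrite ipnormN// ipnormZ// exprMn.
  have -> : normc (2%:R : R[i]) ^+ 2 = 4.
    by rewrite -(rmorph_nat (@real_complex R) 2) normc_real normr_nat -natrX.
  have := mle _ (XZ 2%:R^-1 _ (XD _ _ Xu Xv)).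
  by lra.
pose r n : R := (2 ^+ n)^-1.
have r0 n : 0 < r n by rewrite invr_gt0 exprn_gt0.
have rS n : r n.+1 = r n / 2 by rewrite /r exprS invfM mulrC.
have [u uP] : exists u : nat -> V, forall n, X (u n) /\ nrm (f - u n) ^+ 2 < m + r n ^+ 2 / 4.
  have [|u uP] := choice (P := fun n u => X u /\ nrm (f - u) ^+ 2 < m + r n ^+ 2 / 4).
    move=> n; have [|u Xu hu] := msup (m + r n ^+ 2 / 4); last by exists u.
    by rewrite ltrDl divr_gt0// exprn_gt0.
  by exists u.
have inc n : nrm (u n.+1 - u n) <= r n.
  rewrite -ler_sqr ?nnegrE ?ipnorm_ge0 ?(ltW (r0 n))//.
  rewrite [leRHS](_ : _ = 4 * (r n ^+ 2 / 4)); last by field.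
  have [Xn hn] := uP n; have [XS hS] := uP n.+1; apply: close => //; last exact: ltW.
  apply: le_trans (ltW hS) _; rewrite lerD2l ler_pM2r ?invr_gt0// ler_sqr ?nnegrE ?(ltW (r0 _))//.
  by rewrite rS ler_pdivrMr// mulrDr mulr1 lerDl ltW.
have rS2 n : r n.+1 <= r n / 2 by rewrite rS.
have [p pP] := completeP r0 rS2 inc.
suff fp : f - p = 0.
  have [k hk] := geometric_small 2 e0.
  exists (u k); first by have [] := uP k.
  by move/eqP: fp; rewrite subr_eq0 => /eqP ->; apply: le_trans (pP k) hk.
have a0 := ipnorm_ge0 ip (f - p).
have fpm : nrm (f - p) <= Num.sqrt m.
  rewrite -ler_sqr ?nnegrE ?sqrtr_ge0// (sqr_sqrtr m0).
  apply/ler_addgt0Pr => d d0.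
  have [k hk] := geometric_small (4 * nrm (f - p)) d0.
  have [_ hu] := uP k; have := ipnorm_tri ipP (u k) f p.
  have := pP k; rewrite (ipnormBC ipP p) => h1 h2.
  have := ipnorm_ge0 ip (f - u k); move: (r0 k) hk h1 h2 hu a0; rewrite -/(r k).
  move: (nrm (f - p)) (nrm (f - u k)) (nrm (u k - p)) (r k).
  move=> a s b r1 r10 hk h1 h2 hu a0 s0.
  have [ar|ar] := leP a (2 * r1).
    have : a * a <= a * (2 * r1) by rewrite ler_wpM2l.
    have : 0 <= a * r1 by rewrite mulr_ge0// ltW.
    rewrite expr2; lra.
  have : (a - 2 * r1) ^+ 2 <= s ^+ 2 by rewrite ler_sqr ?nnegrE ?subr_ge0//; lra.
  by nra.
have away w : X w -> nrm (f - p) <= nrm (f - p - w).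
  move=> Xw; apply: le_trans fpm _; apply/ler_addgt0Pr => d d0.
  have [k hk] := geometric_small 2 d0.
  have [Xk _] := uP k; have := mle _ (XD _ _ Xk Xw).
  rewrite -{1}(sqr_sqrtr m0) ler_sqr ?nnegrE ?sqrtr_ge0 ?ipnorm_ge0// => h.
  apply: le_trans h _; apply: le_trans (ipnorm_leB ipP _ (f - p - w)) _.
  rewrite lerD2l; apply: le_trans hk; rewrite [X in nrm X](_ : _ = p - u k)//.
  rewrite -[f - p - w]addrA -opprD opprB addrC subrKA.
  by rewrite opprD addrACA subrr addr0.
apply: Xorth => v Xv; move: (f - p) away a0 {fpm} => q away a0.
set z := <|q, v|>.
(* First variation of the distance in the direction [v]; the [+ 1] avoids a division by zero when
   [v = 0]. *)
pose s : R := (nrm v ^+ 2 + 1)^-1.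
have d0 : 0 < nrm v ^+ 2 + 1 by rewrite ltr_wpDl// sqr_ge0.
have := away _ (XZ (s%:C * z) _ Xv).
rewrite -ler_sqr ?nnegrE ?ipnorm_ge0// (sqr_ipnormD ipP) (ipnormN ipP) (ipnormZ ipP).
rewrite (ipNr ipP) (ipZr ipP) -/z ReN conjc_realM -mulrA [conjc z * z]mulrC mul_conjc.
rewrite -rmorphM /= normcM normc_real ger0_norm ?invr_ge0 ?(ltW d0)//.
move=> h; apply/eq0_normc; move: (normc_ge0 z) h.
move: (normc z) => y y0 h.
have sv : s * nrm v ^+ 2 <= 1.
  by rewrite /s mulrC ler_pdivrMr// mul1r lerDl.
have s0 : 0 < s by rewrite /s invr_gt0.
have h2 : 2 * y ^+ 2 <= s * nrm v ^+ 2 * y ^+ 2.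
  by rewrite -(ler_pM2l s0); lra.
have h3 : s * nrm v ^+ 2 * y ^+ 2 <= 1 * y ^+ 2 by rewrite ler_wpM2r// sqr_ge0.
have : y ^+ 2 <= 0 by lra.
by rewrite real_exprn_even_le0 ?num_real//= => /eqP.
Qed.

End hilbert.

Lemma le_small {R : realType} (x y K : R) : 0 <= K ->
  (forall e, 0 < e -> x <= y + K * e) -> x <= y.
Proof.
move=> K0 h; apply/ler_addgt0Pr => e e0.
have K1 : 0 < K + 1 by rewrite ltr_wpDl.
apply: le_trans (h (e / (K + 1)) (divr_gt0 e0 K1)) _.
by rewrite lerD2l mulrCA ler_piMr ?(ltW e0)// ler_pdivrMr// mul1r lerDl.
Qed.

(** * Abstract Gabor systems *)

Section unconditional_sums.
Context {R : realType} {V : lmodType R[i]} {G : zmodType}.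
Variables (ip : V -> V -> R[i]) (L : set G).
Hypothesis ipP : inner_product ip.
Local Notation nrm := (ipnorm ip).

Definition finite_in (B : seq G) := uniq B /\ forall l, l \in B -> L l.

Lemma finite_in_union A B : finite_in A -> finite_in B ->
  finite_in (undup (A ++ B)).
Proof.
move=> [_ LA] [_ LB]; split; first exact: undup_uniq.
by move=> l; rewrite mem_undup mem_cat => /orP[/LA|/LB].
Qed.

Lemma sub_unionl (A B : seq G) : {subset A <= undup (A ++ B)}.
Proof. by move=> l lA; rewrite mem_undup mem_cat lA. Qed.

Lemma sub_unionr (A B : seq G) : {subset B <= undup (A ++ B)}.
Proof. by move=> l lB; rewrite mem_undup mem_cat lB orbT. Qed.

Lemma finite_in_diff (A B : seq G) : finite_in B -> finite_in [seq l <- B | l \notin A].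
Proof.
move=> [uB LB]; split; first exact: filter_uniq.
by move=> l; rewrite mem_filter => /andP[_ /LB].
Qed.

Lemma sum_diff (W : nmodType) (F : G -> W) (A B : seq G) : uniq A -> uniq B ->
  {subset A <= B} ->
  \sum_(l <- B) F l = \sum_(l <- A) F l + \sum_(l <- [seq l <- B | l \notin A]) F l.
Proof.
move=> uA uB AB; rewrite -big_cat; apply: perm_big; apply: uniq_perm => //.
  rewrite cat_uniq uA filter_uniq// andbT /=.
  by apply/hasPn => l; rewrite mem_filter => /andP[].
move=> l; rewrite mem_cat mem_filter.
by have [/AB->|] := boolP (l \in A).
Qed.

(** Convergence along the net of finite subsets of [L]. With no order on [L], sums can be reindexed
    by lattice translations and by negation. *)
Definition ssum (F : G -> V) (u : V) := forall e : R, 0 < e ->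
  exists2 A, finite_in A & forall B, finite_in B -> {subset A <= B} ->
    nrm (\sum_(l <- B) F l - u) <= e.

Lemma ssum_unique F u v : ssum F u -> ssum F v -> u = v.
Proof.
move=> Fu Fv; apply: (eq_ipnorm_small ipP) => e e0.
have e2 : 0 < e / 2 by rewrite divr_gt0.
have [A fA hA] := Fu _ e2; have [B fB hB] := Fv _ e2.
have fAB := finite_in_union fA fB.
have h1 := hA _ fAB (@sub_unionl A B); have h2 := hB _ fAB (@sub_unionr A B).
apply: le_trans (ipnorm_tri ipP (\sum_(l <- undup (A ++ B)) F l) _ _) _.
by rewrite (ipnormBC ipP) (splitr e) lerD.
Qed.

Lemma ssum_linear a F F' u v : ssum F u -> ssum F' v ->
  ssum (fun l => a *: F l + F' l) (a *: u + v).
Proof.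
move=> Fu Fv e e0.
have K0 : 0 < normc a + 1 by rewrite ltr_wpDl// normc_ge0.
have e2 : 0 < e / 2 by rewrite divr_gt0.
have [A fA hA] := Fu _ (divr_gt0 e2 K0); have [B fB hB] := Fv _ e2.
exists (undup (A ++ B)) => [|D fD sD]; first exact: finite_in_union.
have {}hA := hA _ fD (fun l lA => sD _ (@sub_unionl A B l lA)).
have {}hB := hB _ fD (fun l lB => sD _ (@sub_unionr A B l lB)).
rewrite big_split -scaler_sumr /= opprD addrACA -scalerBr.
apply: le_trans (ipnormD ipP _ _) _; rewrite (splitr e) lerD//.
rewrite (ipnormZ ipP); apply: le_trans (ler_wpM2l (normc_ge0 a) hA) _.
by rewrite mulrCA ler_piMr ?(ltW e2)// ler_pdivrMr// mul1r lerDl.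
Qed.

Lemma eq_ssum F F' u : (forall l, L l -> F l = F' l) -> ssum F u -> ssum F' u.
Proof.
move=> FF' Fu e e0; have [A fA hA] := Fu e e0; exists A => // B fB AB.
rewrite (_ : \sum_(l <- B) F' l = \sum_(l <- B) F l); first exact: hA.
by rewrite [LHS]big_seq [RHS]big_seq; apply: eq_bigr => l /(fB.2)/FF' ->.
Qed.

Lemma ssum_reindex (s s' : G -> G) F u : cancel s s' -> cancel s' s ->
  (forall l, L l -> L (s l)) -> (forall l, L l -> L (s' l)) ->
  ssum F u -> ssum (F \o s) u.
Proof.
move=> ss' s's Ls Ls' Fu e e0; have [A [uA LA] hA] := Fu e e0.
exists (map s' A).
  split; first by rewrite map_inj_uniq//; exact: can_inj s's.
  by move=> _ /mapP[l lA ->]; exact/Ls'/LA.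
move=> B [uB LB] AB; rewrite -(big_map s xpredT F); apply: hA.
  split; first by rewrite map_inj_uniq//; exact: can_inj ss'.
  by move=> _ /mapP[l lB ->]; exact/Ls/LB.
by move=> l lA; rewrite -(s's l) map_f// AB// map_f.
Qed.

Lemma ssum_isometry (T : V -> V) F u :
  (forall a u v, T (a *: u + v) = a *: T u + T v) ->
  (forall u, nrm (T u) = nrm u) -> ssum F u -> ssum (T \o F) (T u).
Proof.
move=> Tlin Tnrm Fu e e0; have [A fA hA] := Fu e e0; exists A => // B fB AB.
have T0 : T 0 = 0.
  have := Tlin 1 0 0; rewrite !scale1r addr0 => h.
  by apply: (@addrI _ (T 0)); rewrite addr0 -h.
have TD v w : T (v + w) = T v + T w by rewrite -[v]scale1r Tlin !scale1r.
have TB v w : T (v - w) = T v - T w.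
  by have := Tlin (-1) w v; rewrite !scaleN1r addrC => ->; rewrite addrC.
by rewrite -(big_morph T TD T0) -TB Tnrm; exact: hA.
Qed.

Lemma ssum_le F u K : ssum F u ->
  (forall B, finite_in B -> nrm (\sum_(l <- B) F l) <= K) -> nrm u <= K.
Proof.
move=> Fu FK; apply/ler_addgt0Pr => e e0; have [A fA hA] := Fu e e0.
apply: le_trans (ipnorm_leB ipP _ (\sum_(l <- A) F l)) _.
by rewrite lerD ?FK// (ipnormBC ipP) hA.
Qed.

(** The identity holds for the finite sums over a set large enough for both nets, and Cauchy-Schwarz
    passes to the limit. It yields the adjoint in the signal as well as the adjoint in the
    window. *)
Lemma ssum_adjoint F F' u u' w w' : ssum F u -> ssum F' u' ->
  (forall l, L l -> ip (F l) w = ip w' (F' l)) -> ip u w = ip w' u'.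
Proof.
move=> Fu Fu' FF'; apply/eqP; rewrite -subr_eq0; apply/eqP/eq0_normc.
have K0 : 0 <= nrm w + nrm w' by rewrite addr_ge0// ipnorm_ge0.
apply/eqP; rewrite eq_le normc_ge0 andbT; apply: (le_small K0) => e e0; rewrite add0r.
have [A fA hA] := Fu e e0; have [B fB hB] := Fu' e e0.
have fD := finite_in_union fA fB; set D := undup _ in fD.
have {}hA := hA D fD (@sub_unionl A B); have {}hB := hB D fD (@sub_unionr A B).
have e1 : ip (\sum_(l <- D) F l) w = ip w' (\sum_(l <- D) F' l).
  rewrite (ip_suml ipP) (ip_sumr ipP) [LHS]big_seq [RHS]big_seq.
  by apply: eq_bigr => l /(fD.2)/FF'.
rewrite (_ : _ - _ = - ip (\sum_(l <- D) F l - u) w + ip w' (\sum_(l <- D) F' l - u')).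
  apply: le_trans (le_normcD _ _) _; rewrite normcN mulrDl lerD//.
    by apply: le_trans (ip_CauchySchwarz ipP _ _) _; rewrite mulrC ler_wpM2l// ipnorm_ge0.
  by apply: le_trans (ip_CauchySchwarz ipP _ _) _; rewrite ler_wpM2l// ipnorm_ge0.
by rewrite (ipBl ipP) (ipBr ipP) e1 opprB addrA subrK.
Qed.

End unconditional_sums.

Section gabor_system.
Context {R : realType} {V : lmodType R[i]} {G : zmodType}.

Record projective_rep (ip : V -> V -> R[i]) (P : G -> V -> V) : Prop := {
  rep_linear : forall l a u v, P l (a *: u + v) = a *: P l u + P l v;
  rep_ip : forall l u v, ip (P l u) (P l v) = ip u v;
  rep0 : forall u, P 0 u = u;
  rep_mul : exists chi : G -> G -> R[i],
    (forall l m, chi l m * conjc (chi l m) = 1) /\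
    forall l m u, P l (P m u) = chi l m *: P (l + m) u }.

Variables (ip : V -> V -> R[i]) (P : G -> V -> V) (L : set G).
Hypothesis ipP : inner_product ip.
Hypothesis completeP : ip_complete ip.
Hypothesis repP : projective_rep ip P.
Hypothesis LN : forall l, L l -> L (- l).
Hypothesis LD : forall l m, L l -> L m -> L (l + m).
Local Notation nrm := (ipnorm ip).
Local Notation fin := (finite_in L).
Let nrm_ge0 u : 0 <= nrm u. Proof. exact: ipnorm_ge0. Qed.
Hint Resolve nrm_ge0 : core.

Lemma rep_v0 l : P l 0 = 0.
Proof.
have := rep_linear repP l 1 0 0; rewrite !scale1r addr0 => h.
by apply: (@addrI _ (P l 0)); rewrite addr0 -h.
Qed.

Lemma repD l u v : P l (u + v) = P l u + P l v.
Proof. by rewrite -[u]scale1r (rep_linear repP) !scale1r. Qed.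

Lemma repZ l a u : P l (a *: u) = a *: P l u.
Proof. by rewrite -[_ *: _]addr0 (rep_linear repP) rep_v0 addr0. Qed.

Lemma repB l u v : P l (u - v) = P l u - P l v.
Proof. by rewrite repD -scaleN1r repZ scaleN1r. Qed.

Lemma rep_norm l u : nrm (P l u) = nrm u.
Proof. by rewrite /ipnorm (rep_ip repP). Qed.

Lemma rep_surj l v : exists2 u, P l u = v & nrm u = nrm v.
Proof.
have [chi [chi1 chiM]] := rep_mul repP.
exists (conjc (chi l (- l)) *: P (- l) v).
  by rewrite repZ chiM scalerA mulrC chi1 scale1r subrr (rep0 repP).
by rewrite (ipnormZ ipP) normc_conj unimodular_normc// mul1r rep_norm.
Qed.

(** The phase is the quotient of [chi l m] by [chi m l]. In a term [<f, P l g> P l h] it meets its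
    own conjugate, so shifts act on frame operators without leaving a phase behind. *)
Lemma rep_comm l m : exists2 w : R[i], w * conjc w = 1 &
  forall u, P l (P m u) = w *: P m (P l u).
Proof.
have [chi [chi1 chiM]] := rep_mul repP.
exists (chi l m * conjc (chi m l)).
  rewrite rmorphM /= conjcK mulrACA.
  by rewrite chi1 mul1r mulrC chi1.
move=> u; rewrite !chiM scalerA -mulrA [conjc _ * _]mulrC chi1 mulr1.
by rewrite [m + l]addrC.
Qed.

Definition l2 (c : G -> R[i]) (B : seq G) := Num.sqrt (\sum_(l <- B) normc (c l) ^+ 2).

Lemma l2_ge0 c B : 0 <= l2 c B.
Proof. exact: sqrtr_ge0. Qed.
Hint Resolve l2_ge0 : core.

Lemma sqr_l2 c B : l2 c B ^+ 2 = \sum_(l <- B) normc (c l) ^+ 2.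
Proof. by rewrite sqr_sqrtr// sumr_ge0// => l _; exact: sqr_ge0. Qed.

(* The adjoint of the analysis operator of [g] on finite sequences has norm at
   most [M]. *)
Definition bess (M : R) (g : V) := 0 <= M /\ forall c B, fin B ->
  nrm (\sum_(l <- B) c l *: P l g) <= M * l2 c B.

(** An operator and its adjoint have the same norm: each direction tests the other bound on the
    extremal element, the coefficient sequence of [f] or the sum [v] itself, and divides by its
    norm. *)
Lemma bess_analysis M g : bess M g <-> 0 <= M /\ forall f B, fin B ->
  l2 (fun l => ip f (P l g)) B <= M * nrm f.
Proof.
split=> -[M0 hM]; split=> //.
- move=> f B fB; set c := fun l => _.
  have e : ip f (\sum_(l <- B) c l *: P l g) = (l2 c B ^+ 2)%:C.
    rewrite (ip_sumr ipP) sqr_l2 rmorph_sum; apply: eq_bigr => l _ /=.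
    by rewrite (ipZr ipP) -/(c l) mulrC mul_conjc.
  have := ip_CauchySchwarz ipP f (\sum_(l <- B) c l *: P l g).
  rewrite e normc_real ger0_norm ?sqr_ge0// => h.
  have [->|c0] := eqVneq (l2 c B) 0; first by rewrite mulr_ge0// ipnorm_ge0.
  have cpos : 0 < l2 c B by rewrite lt_neqAle eq_sym c0/=.
  rewrite -(ler_pM2r cpos) -expr2; apply: le_trans h _.
  by rewrite mulrAC [leRHS]mulrC ler_wpM2l// hM.
- move=> c B fB; set v := \sum_(l <- B) _.
  have [->|v0] := eqVneq (nrm v) 0; first by rewrite mulr_ge0// ipnorm_ge0.
  have vpos : 0 < nrm v by rewrite lt_neqAle eq_sym v0/=.
  rewrite -(ler_pM2r vpos) -expr2 (sqr_ipnorm ipP).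
  have -> : ip v v = \sum_(l <- B) ip (c l *: P l g) v by rewrite {1}/v (ip_suml ipP).
  apply: le_trans (Re_le_normc _) _.
  apply: le_trans (normc_sum _ _) _.
  rewrite -ler_sqr ?nnegrE ?sumr_ge0 ?mulr_ge0//; last by move=> *; exact: normc_ge0.
  have := sum_CauchySchwarz B (fun l => normc (c l)) (fun l => normc (ip v (P l g))).
  rewrite -!sqr_l2 -/(l2 c B) -!exprMn.
  move=> h; rewrite [X in X ^+ 2](_ : _ = \sum_(l <- B) normc (c l) * normc (ip v (P l g))).
    apply: le_trans h _; rewrite ler_sqr ?nnegrE ?mulr_ge0//.
    by rewrite mulrAC [leRHS]mulrC ler_wpM2l// hM.
  by apply: eq_bigr => l _; rewrite (ipZl ipP) normcM (ip_conj ipP) normc_conj.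
Qed.

Lemma bess_ge0 M g : bess M g -> 0 <= M.
Proof. by case. Qed.

Lemma bess_mono M M' g : M <= M' -> bess M g -> bess M' g.
Proof.
move=> MM' [M0 hM]; split=> [|c B fB]; first exact: le_trans MM'.
by apply: le_trans (hM c B fB) _; rewrite ler_wpM2r.
Qed.

Lemma bessD M M' g g' : bess M g -> bess M' g' -> bess (M + M') (g + g').
Proof.
move=> [M0 hM] [M0' hM']; split=> [|c B fB]; first exact: addr_ge0.
rewrite (_ : \sum_(l <- B) _ =
    \sum_(l <- B) c l *: P l g + \sum_(l <- B) c l *: P l g'); last first.
  by rewrite -big_split; apply: eq_bigr => l _; rewrite repD scalerDr.
by rewrite (le_trans (ipnormD ipP _ _))// mulrDl lerD ?hM ?hM'.
Qed.

Lemma bessZ M a g : bess M g -> bess (normc a * M) (a *: g).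
Proof.
move=> [M0 hM]; split=> [|c B fB]; first by rewrite mulr_ge0// normc_ge0.
rewrite (_ : \sum_(l <- B) _ = a *: \sum_(l <- B) c l *: P l g); last first.
  by rewrite scaler_sumr; apply: eq_bigr => l _; rewrite repZ !scalerA mulrC.
by rewrite (ipnormZ ipP) -mulrA ler_wpM2l ?normc_ge0// hM.
Qed.

Lemma bessB M M' g g' : bess M g -> bess M' g' -> bess (M + M') (g - g').
Proof.
move=> Mg /(bessZ (-1)); rewrite normcN normc1 mul1r scaleN1r.
exact: bessD.
Qed.

(** Each inequality involves one finite sum, which depends continuously on the window. *)
Lemma bess_closed M u : 0 <= M ->
  (forall e, 0 < e -> exists2 v, bess M v & nrm (u - v) <= e) -> bess M u.
Proof.
move=> M0 h; split=> // c B fB.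
have K0 : 0 <= \sum_(l <- B) normc (c l) by apply: sumr_ge0 => l _; exact: normc_ge0.
apply: (le_small K0) => e e0; have [v [_ hM] uv] := h e e0.
apply: le_trans (ipnorm_leB ipP _ (\sum_(l <- B) c l *: P l v)) _.
rewrite lerD ?hM// -sumrB mulr_suml; apply: le_trans (ipnorm_sum ipP _ _) _.
apply: ler_sum => l _; rewrite -scalerBr -repB (ipnormZ ipP) rep_norm.
by rewrite ler_wpM2l ?normc_ge0.
Qed.

Lemma bess_rep M m u : bess M u -> bess M (P m u).
Proof.
move=> /bess_analysis[M0 hM]; apply/bess_analysis; split=> // f B fB.
have [f' <- <-] := rep_surj m f.
rewrite (_ : l2 _ B = l2 (fun l => ip f' (P l u)) B) ?hM//.
congr Num.sqrt; apply: eq_bigr => l _; have [w w1 ->] := rep_comm l m.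
by rewrite (ipZr ipP) normcM normc_conj unimodular_normc// mul1r (rep_ip repP).
Qed.

(* [|<f, P l g>| = |<g, P (-l) f>|]: the analysis coefficients may be charged
   to either factor. *)
Lemma bess_analysisC M f g B : bess M f -> fin B ->
  l2 (fun l => ip f (P l g)) B <= M * nrm g.
Proof.
move=> /bess_analysis[M0 hM] [uB LB].
have -> : l2 (fun l => ip f (P l g)) B =
    l2 (fun l => ip g (P l f)) (map (@GRing.opp G) B).
  congr Num.sqrt; rewrite big_map; apply: eq_bigr => l _.
  have [chi [chi1 chiM]] := rep_mul repP.
  rewrite -(rep_ip repP (- l)) chiM addNr (rep0 repP) (ipZr ipP) normcM.
  by rewrite normc_conj unimodular_normc// mul1r (ip_conj ipP) normc_conj.
apply: hM; split; first by rewrite map_inj_uniq//; exact: oppr_inj.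
by move=> _ /mapP[l /LB Ll ->]; exact: LN.
Qed.

(** Finite sets that nearly exhaust the supremum of the coefficient mass leave mass at most
    [r n ^+ 2] outside, and the Bessel bound turns this into a Cauchy estimate for the partial
    sums. *)
Lemma synthesis_ex M K h c : bess M h -> 0 <= K ->
  (forall B, fin B -> l2 c B <= K) ->
  exists2 u, ssum ip L (fun l => c l *: P l h) u & nrm u <= M * K.
Proof.
move=> [M0 hM] K0 cK.
suff [u su] : exists u, ssum ip L (fun l => c l *: P l h) u.
  exists u => //; apply: (ssum_le ipP su) => B fB.
  by apply: le_trans (hM _ _ fB) _; rewrite ler_wpM2l// cK.
pose E := [set l2 c B ^+ 2 | B in [set B | fin B]].
have supE : has_sup E.
  split; first by exists (l2 c [::] ^+ 2); exists [::].
  exists (K ^+ 2) => _ [B fB <-]; rewrite ler_sqr ?nnegrE//; exact: cK.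
have leE B : fin B -> l2 c B ^+ 2 <= sup E.
  by move=> fB; apply: sup_upper_bound => //; exists B.
pose r n : R := (2 ^+ n)^-1.
have r0 n : 0 < r n by rewrite invr_gt0 exprn_gt0.
have [A' A'P] : exists A' : nat -> seq G, forall n,
    fin (A' n) /\ sup E - r n ^+ 2 < l2 c (A' n) ^+ 2.
  have [|A' hA'] := choice (P := fun n B => fin B /\ sup E - r n ^+ 2 < l2 c B ^+ 2).
    move=> n; have [_ [B fB <-] hB] := sup_adherent (exprn_gt0 2 (r0 n)) supE.
    by exists B.
  by exists A'.
(* Unions make the sets increase, so that each partial sum extends the previous one. *)
pose A := fix A n := if n is m.+1 then undup (A m ++ A' m.+1) else A' 0%N.
have fA n : fin (A n).
  elim: n => [|n IH]; first by have [] := A'P 0%N.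
  by apply: finite_in_union => //; have [] := A'P n.+1.
have A'A n : {subset A' n <= A n} by case: n => // n; exact: sub_unionr.
have AA n : {subset A n <= A n.+1} by exact: sub_unionl.
have l2_diff C B : fin C -> fin B -> {subset C <= B} ->
    l2 c B ^+ 2 = l2 c C ^+ 2 + l2 c [seq l <- B | l \notin C] ^+ 2.
  by move=> [uC _] [uB _] CB; rewrite !sqr_l2 (sum_diff _ uC uB CB).
have tail n B : fin B -> {subset A n <= B} ->
    l2 c [seq l <- B | l \notin A n] <= r n.
  move=> fB AB; rewrite -ler_sqr ?nnegrE ?(ltW (r0 n))//.
  have [fA' hA'] := A'P n; have := leE _ fB; rewrite (l2_diff _ _ (fA n) fB AB).
  by have := l2_diff _ _ fA' (fA n) (A'A n); have := sqr_ge0 (l2 c [seq l <- A n | l \notin A' n]); lra.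
pose u n := \sum_(l <- A n) c l *: P l h.
have near n B : fin B -> {subset A n <= B} ->
    nrm (\sum_(l <- B) c l *: P l h - u n) <= (M + 1) * r n.
  move=> fB AB; rewrite (sum_diff _ (fA n).1 fB.1 AB) addrC addKr.
  apply: le_trans (hM _ _ (finite_in_diff _ fB)) _.
  by rewrite ler_pM ?tail// lerDl.
have M1 : 0 < M + 1 by rewrite ltr_wpDl.
have rS n : (M + 1) * r n.+1 <= (M + 1) * r n / 2.
  by rewrite -mulrA ler_pM2l// /r exprS invfM mulrC.
have [v vP] := completeP (fun n => mulr_gt0 M1 (r0 n)) rS
  (fun n => near n _ (fA n.+1) (AA n)).
exists v => e e0; have [n hn] := geometric_small (3 * (M + 1)) e0.
exists (A n) => // B fB AB; apply: le_trans hn.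
apply: le_trans (ipnorm_tri ipP (u n) _ _) _.
have := near n B fB AB; have := vP n; rewrite (ipnormBC ipP v) -/(r n); lra.
Qed.

Definition frame (g h f : V) : V :=
  xget 0 [set u | ssum ip L (fun l => ip f (P l g) *: P l h) u].

Lemma frameP M N g h f : bess M g -> bess N h ->
  ssum ip L (fun l => ip f (P l g) *: P l h) (frame g h f).
Proof.
move=> Mg Nh; have [M0 hM] := (bess_analysis M g).1 Mg.
have [|u su _] := synthesis_ex Nh (mulr_ge0 M0 (nrm_ge0 f)) (c := fun l => ip f (P l g)).
  by move=> B fB; exact: hM.
by rewrite /frame; case: xgetP => [v _ //|/(_ u)].
Qed.

Lemma frame_le N K g h f : bess N h -> 0 <= K ->
  (forall B, fin B -> l2 (fun l => ip f (P l g)) B <= K) ->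
  nrm (frame g h f) <= N * K.
Proof.
move=> Nh K0 hK; have [u su uK] := synthesis_ex Nh K0 hK.
rewrite /frame; case: xgetP => [v _ sv|/(_ u)//].
by rewrite (ssum_unique ipP sv su).
Qed.

Lemma frame_norm M N g h f : bess M g -> bess N h ->
  nrm (frame g h f) <= N * (M * nrm f).
Proof.
move=> Mg Nh; have [M0 hM] := (bess_analysis M g).1 Mg.
by apply: frame_le => //; [rewrite mulr_ge0|move=> B; exact: hM].
Qed.

(** The coefficients are charged to the signal, whose Bessel constant is [M], so only the norm of
    [g] enters. In the commutator [g] becomes a difference that is small in norm. *)
Lemma frame_norm_l M N g h f : bess M f -> bess N h ->
  nrm (frame g h f) <= N * (M * nrm g).
Proof.
move=> Mf Nh; apply: frame_le => //; first by rewrite mulr_ge0// (bess_ge0 Mf).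
by move=> B fB; exact: bess_analysisC.
Qed.

Lemma frame_linear M N g h a f f' : bess M g -> bess N h ->
  frame g h (a *: f + f') = a *: frame g h f + frame g h f'.
Proof.
move=> Mg Nh; apply: (ssum_unique ipP (frameP _ Mg Nh)).
apply: eq_ssum (ssum_linear ipP a (frameP f Mg Nh) (frameP f' Mg Nh)) => l _ /=.
by rewrite scalerA -scalerDl (ip_linear ipP).
Qed.

Lemma frameB M N g h f f' : bess M g -> bess N h ->
  frame g h (f - f') = frame g h f - frame g h f'.
Proof.
move=> Mg Nh; rewrite addrC -scaleN1r (frame_linear _ _ _ Mg Nh) scaleN1r.
exact: addrC.
Qed.

Lemma frameBl M M' N g g' h f : bess M g -> bess M' g' -> bess N h ->
  frame (g - g') h f = frame g h f - frame g' h f.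
Proof.
move=> Mg Mg' Nh; rewrite [RHS]addrC -[- frame _ _ _]scaleN1r.
apply: (ssum_unique ipP (frameP _ (bessB Mg Mg') Nh)).
apply: eq_ssum (ssum_linear ipP (-1) (frameP f Mg' Nh) (frameP f Mg Nh)) => l _ /=.
by rewrite scaleN1r -scaleNr -scalerDl repB (ipBr ipP) addrC.
Qed.

Lemma frameBr M N N' g h h' f : bess M g -> bess N h -> bess N' h' ->
  frame g (h - h') f = frame g h f - frame g h' f.
Proof.
move=> Mg Nh Nh'; rewrite [RHS]addrC -[- frame _ _ _]scaleN1r.
apply: (ssum_unique ipP (frameP _ Mg (bessB Nh Nh'))).
apply: eq_ssum (ssum_linear ipP (-1) (frameP f Mg Nh') (frameP f Mg Nh)) => l _ /=.
by rewrite repB scalerBr scaleN1r addrC.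
Qed.

Lemma frame_adjoint M N g h f v : bess M g -> bess N h ->
  ip (frame g h f) v = ip f (frame h g v).
Proof.
move=> Mg Nh; apply: (ssum_adjoint ipP (frameP f Mg Nh) (frameP v Nh Mg)) => l _.
by rewrite (ipZl ipP) (ipZr ipP) -(ip_conj ipP) mulrC.
Qed.

(* Here the window [x] and not the signal is the variable: [x |-> S_(g,x) f] is
   the operator [sum_l <f, P l g> P l], whose adjoint has coefficients
   [<g, P l f>]. *)
Lemma frame_window_adjoint K M N g x f y : bess K g -> bess M x -> bess N y -> bess K f ->
  ip (frame g x f) y = ip x (frame f y g).
Proof.
move=> Kg Mx Ny Kf; have [chi [chi1 chiM]] := rep_mul repP.
have sN := ssum_reindex (@opprK G) (@opprK G) LN LN (frameP g Kf Ny).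
apply: (ssum_adjoint ipP (frameP f Kg Mx) sN) => l _ /=.
rewrite (ipZl ipP) (ipZr ipP) -(ip_conj ipP).
rewrite -(rep_ip repP l (P (- l) f) g) -(rep_ip repP l x) !chiM subrr !(rep0 repP).
by rewrite (ipZl ipP) (ipZr ipP) mulrACA chi1 mul1r.
Qed.

(** For [m] in [L] the shift permutes the terms of the sum, by [l |-> m + l], up to phases that
    cancel. *)
Lemma frame_rep M N g h f m : L m -> bess M g -> bess N h ->
  P m (frame g h f) = frame g h (P m f).
Proof.
move=> Lm Mg Nh; have [chi [chi1 chiM]] := rep_mul repP.
have s1 := ssum_isometry (rep_linear repP m) (rep_norm m) (frameP f Mg Nh).
have Ls l : L l -> L (m + l) by exact: LD.
have Ls' l : L l -> L (- m + l) by move=> Ll; apply: LD => //; exact: LN.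
have := ssum_reindex (addKr m) (addNKr m) Ls Ls' (frameP (P m f) Mg Nh).
apply: ssum_unique => //; apply: eq_ssum s1 => l _ /=.
have e u : P (m + l) u = conjc (chi m l) *: P m (P l u).
  by rewrite chiM scalerA mulrC chi1 scale1r.
rewrite repZ !e (ipZr ipP) conjcK (rep_ip repP) scalerA; congr (_ *: _).
by rewrite mulrAC chi1 mul1r.
Qed.

(** For an arbitrary [m] the sum cannot be reindexed. The commutation phases still cancel term by
    term, at the price of shifting both windows. *)
Lemma frame_rep3 M N g h f m : bess M g -> bess N h ->
  P m (frame g h f) = frame (P m g) (P m h) (P m f).
Proof.
move=> Mg Nh.
apply: (ssum_unique ipP) (frameP (P m f) (bess_rep m Mg) (bess_rep m Nh)).
apply: eq_ssum (ssum_isometry (rep_linear repP m) (rep_norm m) (frameP f Mg Nh)).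
move=> l _ /=; have [w w1 e] := rep_comm l m.
rewrite repZ !e (ipZr ipP) (rep_ip repP) scalerA; congr (_ *: _).
by rewrite mulrAC [conjc w * w]mulrC w1 mul1r.
Qed.

(** Frame operators commute with the shifts by [L], so pairing [v] with the shifts of [frame g h f]
    amounts to pairing [frame h g v] with those of [f]. *)
Lemma bess_frame K M N g h f : bess K f -> bess M g -> bess N h ->
  bess (K * M * N) (frame g h f).
Proof.
move=> Kf Mg Nh; have [K0 M0 N0] := And3 (bess_ge0 Kf) (bess_ge0 Mg) (bess_ge0 Nh).
have [_ hK] := (bess_analysis K f).1 Kf.
apply/bess_analysis; split=> [|v B fB]; first by rewrite !mulr_ge0.
rewrite (_ : l2 _ B = l2 (fun l => ip (frame h g v) (P l f)) B).
  apply: le_trans (hK _ _ fB) _; rewrite -!mulrA ler_wpM2l//.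
  exact: frame_norm.
congr Num.sqrt; rewrite [LHS]big_seq [RHS]big_seq; apply: eq_bigr => l lB.
by rewrite (frame_rep _ (fB.2 _ lB) Mg Nh) (frame_adjoint _ _ Nh Mg).
Qed.

(* The symmetrized operator [x |-> S_(g,x) f] is bounded for the Bessel norm,
   with the same constant; log-convexity of the norms of its iterates transfers
   the bound to the norm of [V]. *)
Lemma frame_window_norm K M g f x : bess M g -> bess K f -> (exists N, bess N x) ->
  nrm (frame g x f) <= K * M * nrm x.
Proof.
move=> Mg Kf [N Nx].
have [K0 M0 N0] := And3 (bess_ge0 Kf) (bess_ge0 Mg) (bess_ge0 Nx).
(* If [K * M = 0], one of the Bessel constants is 0 and the frame operator vanishes; [K1] below
   divides by [K * M]. *)
have [KM0|KM0] := eqVneq (K * M) 0.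
  rewrite KM0 mul0r; move/eqP: KM0; rewrite mulf_eq0 => /orP[] /eqP z.
    by have := frame_norm_l g Kf Nx; rewrite z mul0r mulr0.
  by have := frame_norm f Mg Nx; rewrite z mul0r mulr0.
have KMp : 0 < K * M by rewrite lt_neqAle eq_sym KM0 mulr_ge0.
(* The map [x |-> frame g x f] alternates with its adjoint [x |-> frame f x g]. Hence
   [<y (n+1), y (n+1)> = <y n, y (n+2)>] for every [n], and Cauchy-Schwarz makes the norms
   log-convex. *)
have [y y0 yS] : exists2 y : nat -> V, y 0%N = x &
    forall n, y n.+1 = if odd n then frame f (y n) g else frame g (y n) f.
  by exists (fix y n := if n is m.+1 then
    if odd m then frame f (y m) g else frame g (y m) f else x).
have By n : bess ((K * M) ^+ n * N) (y n).
  elim: n => [|n IH]; first by rewrite expr0 mul1r y0.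
  rewrite yS exprS -[_ * _ * N]mulrA; case: (odd n).
    by have := bess_frame Mg Kf IH; rewrite [M * K]mulrC.
  exact: bess_frame.
have MK g' : bess M g' -> bess (M + K) g' by apply: bess_mono; rewrite lerDl.
have KK g' : bess K g' -> bess (M + K) g' by apply: bess_mono; rewrite lerDr.
(* The Bessel constant [(K * M) ^+ n * N] of [y n] bounds the norm of [y (n+1)]; dividing by [K * M]
   adjusts the exponent. The term [nrm x] added to [K1] covers [n = 0]. *)
pose K1 := N * (M * nrm f + K * nrm g) / (K * M).
have K10 : 0 <= K1.
  by rewrite /K1 mulr_ge0 ?invr_ge0 ?(ltW KMp)// mulr_ge0// addr_ge0// mulr_ge0.
have := @logconvex_le R (fun n => nrm (y n)) (nrm x + K1) (K * M) (ltW KMp).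
rewrite yS y0 /=; apply => [n|n|[|n]] //.
- rewrite (sqr_ipnorm ipP); apply: le_trans (Re_le_normc _) _.
  rewrite [X in normc X](_ : _ = ip (y n) (y n.+2)); last first.
    rewrite [y n.+2]yS [X in ip X _]yS /=; case: (odd n) => /=.
      exact: (frame_window_adjoint (KK _ Kf) (By n) (By n.+1) (MK _ Mg)).
    exact: (frame_window_adjoint (MK _ Mg) (By n) (By n.+1) (KK _ Kf)).
  by rewrite mulrC; exact: ip_CauchySchwarz.
- by rewrite expr0 mulr1 y0 lerDl.
- have h : nrm (y n.+1) <= (K * M) ^+ n * (N * (M * nrm f + K * nrm g)).
    rewrite mulrA; have p0 : 0 <= (K * M) ^+ n * N by exact: bess_ge0 (By n).
    rewrite yS; case: (odd n).
      apply: le_trans (frame_norm g Kf (By n)) _.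
      by rewrite ler_wpM2l// lerDr mulr_ge0.
    apply: le_trans (frame_norm f Mg (By n)) _.
    by rewrite ler_wpM2l// lerDl mulr_ge0.
  apply: le_trans h _; rewrite mulrDl exprSr.
  rewrite (_ : K1 * _ = (K * M) ^+ n * (N * (M * nrm f + K * nrm g))).
    by rewrite lerDr mulr_ge0// mulr_ge0 ?exprn_ge0 ?ltW.
  by rewrite mulrCA /K1 divfK.
Qed.

(** By [frame_rep3] the left-hand side is [frame (P m g - g) (P m h) (P m f) + frame g (P m h - h)
    (P m f)]. The first term is bounded by [frame_norm_l], the second by Lax's estimate
    [frame_window_norm]; both use only the Bessel constant of [P m f], which is that of [f]. *)
Lemma frame_commutator K M N g h f m : bess K f -> bess M g -> bess N h ->
  nrm (P m (frame g h f) - frame g h f - frame g h (P m f - f)) <=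
  N * K * nrm (P m g - g) + M * K * nrm (P m h - h).
Proof.
move=> Kf Mg Nh.
have Kf' := bess_rep m Kf; have Mg' := bess_rep m Mg; have Nh' := bess_rep m Nh.
rewrite (frameB _ _ Mg Nh) opprB addrA subrK (frame_rep3 _ _ Mg Nh).
rewrite -(subrK (frame g (P m h) (P m f)) (frame (P m g) _ _)) -addrA.
rewrite -(frameBl _ Mg' Mg Nh') -(frameBr _ Mg Nh' Nh).
apply: le_trans (ipnormD ipP _ _) _; rewrite lerD//.
  by rewrite -mulrA; exact: frame_norm_l.
rewrite [M * K]mulrC; apply: frame_window_norm => //.
by exists (N + N); exact: bessB.
Qed.

(* Linear identities in [V] hold because they do after pairing with any [w]. *)
Local Ltac vec := apply: (eq_ip ipP) => ?;
  rewrite ?(ipBl ipP, ipDl ipP, ipNl ipP, ipZl ipP, ip0l ipP); ring.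

Variables (J : Type) (gamma : J -> R -> G).

(** The ball of radius [C] for the largest of three quantities: the norm, the best Bessel constant
    and the Lipschitz constants at 0 of [t |-> P (gamma j t) u]. A single constant makes this a
    Banach norm to which [bounded_inverse] applies. *)
Definition modball (C : R) (u : V) := [/\ nrm u <= C, bess C u &
  forall j t, 0 < t -> nrm (P (gamma j t) u - u) <= C * t].

Definition modspace : set V := [set u | exists C, modball C u].

Lemma modball_ge0 C u : modball C u -> 0 <= C.
Proof. by case=> [h _ _]; exact: le_trans h. Qed.

Lemma modball_mono C D u : C <= D -> modball C u -> modball D u.
Proof.
move=> CD [h1 h2 h3]; split; first exact: le_trans CD.
  exact: bess_mono h2.
by move=> j t t0; apply: le_trans (h3 j t t0) _; rewrite ler_wpM2r// ltW.
Qed.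

Lemma modballD C D u v : modball C u -> modball D v -> modball (C + D) (u + v).
Proof.
move=> [h1 h2 h3] [k1 k2 k3]; split; last move=> j t t0.
- by rewrite (le_trans (ipnormD ipP _ _))// lerD.
- exact: bessD.
rewrite repD opprD addrACA mulrDl.
by rewrite (le_trans (ipnormD ipP _ _))// lerD// ?h3// k3.
Qed.

Lemma modballZ C a u : modball C u -> modball (normc a * C) (a *: u).
Proof.
move=> [h1 h2 h3]; split; last move=> j t t0.
- by rewrite (ipnormZ ipP) ler_wpM2l// normc_ge0.
- exact: bessZ.
by rewrite repZ -scalerBr (ipnormZ ipP) -mulrA ler_wpM2l ?normc_ge0// h3.
Qed.

Lemma modball_closed C u : 0 <= C ->
  (forall e, 0 < e -> exists2 v, modball C v & nrm (u - v) <= e) -> modball C u.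
Proof.
move=> C0 h; split; last move=> j t t0.
- apply: (@le_small _ _ _ 1) => // e e0; have [v [v1 _ _] uv] := h e e0.
  by apply: le_trans (ipnorm_leB ipP _ v) _; rewrite mul1r lerD.
- by apply: bess_closed => // e e0; have [v [_ v2 _] uv] := h e e0; exists v.
- apply: (@le_small _ _ _ 2) => // e e0; have [v [_ _ v3] uv] := h e e0.
  apply: le_trans (ipnorm_leB ipP _ (P (gamma j t) v - v)) _; rewrite lerD ?v3//.
  rewrite (_ : _ - (_ - v) = P (gamma j t) (u - v) - (u - v)); last by rewrite repB; vec.
  by apply: le_trans (ipnormB ipP _ _) _; rewrite rep_norm; lra.
Qed.

Lemma modball_banach : banach_ball modball.
Proof.
split; [exact: modball_mono|exact: modballD|exact: modballZ|..].
- move=> u h; apply: (ipnorm_eq0 ipP); apply: eq0_small => // e e0.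
  by have [] := h e e0.
- move=> u r r0 rS ur.
  have [|l lP] := completeP (u := fun n => \sum_(k < n) u k) r0 rS.
    by move=> n; rewrite big_ord_recr /= [_ + u n]addrC addrK; have [] := ur n.
  exists l => n; apply: modball_closed; first by rewrite mulr_ge0// ltW.
  have r_geo m : r m <= r 0%N * (2 ^+ m)^-1.
    elim: m => [|m IH]; first by rewrite expr0 invr1 mulr1.
    apply: le_trans (rS m) _; rewrite exprS invfM mulrCA [leRHS]mulrC.
    by rewrite ler_wpM2r// invr_ge0.
  (* The radii telescope: [2 * r k - 2 * r k.+1] is at least [r k], the radius of the next
     summand. *)
  have tail i : modball (2 * r n - 2 * r (n + i)%N)
      (\sum_(k < n + i) u k - \sum_(k < n) u k).
    elim: i => [|i IH].
      rewrite addn0 !subrr -[0 in X in modball _ X](scale0r (u 0%N)).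
      by have := modballZ 0 (ur 0%N); rewrite normc0 mul0r.
    rewrite addnS big_ord_recr /= -addrA [u _ + _]addrC addrA.
    apply: modball_mono (modballD IH (ur (n + i)%N)).
    by have := rS (n + i)%N; lra.
  move=> e e0; have [m hm] := geometric_small (2 * r 0%N) e0.
  exists (\sum_(k < n + m) u k - \sum_(k < n) u k).
    by apply: modball_mono (tail m); rewrite gerBl mulr_ge0// ltW.
  rewrite opprB addrA subrK; apply: le_trans (lP (n + m)%N) _; apply: le_trans hm.
  have rmono k : r (k + m)%N <= r m.
    elim: k => // k IH; apply: le_trans (rS _) _; apply: le_trans IH.
    by rewrite ler_pdivrMr// ler_peMr// ?ler1n// ltW.
  by rewrite -mulrA ler_pM2l// (le_trans (rmono n)).
Qed.

(** In the Lipschitz bound the differences of [f], [g] and [h] contribute [K * M * N * t] each,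
    hence the 3. *)
Lemma modball_frame K M N f g h : modball K f -> modball M g -> modball N h ->
  modball (3 * (K * M * N)) (frame g h f).
Proof.
move=> Kf Mg Nh.
have [K0 M0 N0] := And3 (modball_ge0 Kf) (modball_ge0 Mg) (modball_ge0 Nh).
have KMN0 : 0 <= K * M * N by rewrite !mulr_ge0.
have [[f1 f2 f3] [g1 g2 g3] [h1 h2 h3]] := And3 Kf Mg Nh.
split; last move=> j t t0.
- apply: le_trans (frame_norm f g2 h2) _.
  apply: (@le_trans _ _ (N * (M * K))); first by rewrite !ler_wpM2l.
  by rewrite (_ : N * _ = K * M * N); [lra|ring].
- by apply: bess_mono (bess_frame f2 g2 h2); lra.
have := frame_commutator (gamma j t) f2 g2 h2.
have := frame_norm (P (gamma j t) f - f) g2 h2.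
have : N * (M * nrm (P (gamma j t) f - f)) <= N * (M * (K * t)) by rewrite !ler_wpM2l// f3.
have : N * K * nrm (P (gamma j t) g - g) <= N * K * (M * t).
  by rewrite ler_wpM2l ?g3// mulr_ge0.
have : M * K * nrm (P (gamma j t) h - h) <= M * K * (N * t).
  by rewrite ler_wpM2l ?h3// mulr_ge0.
have := ipnorm_leB ipP (P (gamma j t) (frame g h f) - frame g h f)
  (frame g h (P (gamma j t) f - f)).
nra.
Qed.

Lemma modspace0 : (exists u, modspace u) -> modspace 0.
Proof.
by move=> [u [C bu]]; exists (normc 0 * C); rewrite -(scale0r u); exact: modballZ.
Qed.

Lemma modspace_linear a u v : modspace u -> modspace v -> modspace (a *: u + v).
Proof.
move=> [C uC] [D vD]; exists (normc a * C + D).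
by apply: modballD => //; exact: modballZ.
Qed.

Lemma linear_set_bij (X : set V) (T : V -> V) : X 0 ->
  (forall a u v, X u -> X v -> X (a *: u + v)) ->
  (forall a u v, T (a *: u + v) = a *: T u + T v) ->
  set_bij X X T <-> [/\ (forall u, X u -> X (T u)),
    (forall u, X u -> T u = 0 -> u = 0) &
    (forall f, X f -> exists2 u, X u & T u = f)].
Proof.
move=> X0 Xlin Tlin.
have T0 : T 0 = 0.
  have := Tlin 1 0 0; rewrite !scale1r addr0 => h.
  by apply: (@addrI _ (T 0)); rewrite addr0 -h.
have TB u v : T (u - v) = T u - T v.
  by have := Tlin (-1) v u; rewrite !scaleN1r addrC => ->; rewrite addrC.
split=> [[TX Tinj Tsurj]|[TX Tinj Tsurj]]; split.
- by move=> u Xu; exact: TX.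
- by move=> u Xu Tu; apply: Tinj; rewrite ?in_setE// Tu T0.
- by move=> f Xf; have [u Xu uf] := Tsurj f Xf; exists u.
- by move=> u Xu; exact: TX.
- move=> u v; rewrite !in_setE => Xu Xv uv.
  apply/eqP; rewrite -subr_eq0; apply/eqP; apply: Tinj; last by rewrite TB uv subrr.
  by rewrite addrC -scaleN1r; exact: Xlin.
- by move=> f Xf; have [u Xu uf] := Tsurj f Xf; exists u.
Qed.

(** * The resolvent of a frame operator on the whole space and on [modspace] *)

Section spectrum.
Variables (M : R) (g : V) (z : R[i]).
Hypothesis gP : modball M g.
Let T u := frame g g u - z *: u.
Let M0 : 0 <= M. Proof. exact: modball_ge0 gP. Qed.
Let gB : bess M g. Proof. by case: gP. Qed.

Let Tlin a u v : T (a *: u + v) = a *: T u + T v.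
Proof.
rewrite /T (frame_linear _ _ _ gB gB) scalerDr opprD addrACA scalerBr.
by rewrite !scalerA mulrC.
Qed.

Let TB u v : T (u - v) = T u - T v.
Proof.
by have := Tlin (-1) v u; rewrite !scaleN1r addrC => ->; rewrite addrC.
Qed.

Let T0 : T 0 = 0.
Proof. by rewrite -[X in T X](subrr 0) TB subrr. Qed.

Let TD u v : T (u + v) = T u + T v.
Proof. by rewrite -[u]scale1r Tlin !scale1r. Qed.

Let TZ a u : T (a *: u) = a *: T u.
Proof. by rewrite -[_ *: u]addr0 Tlin T0 addr0. Qed.

Let Tnorm u : nrm (T u) <= (M * M + normc z) * nrm u.
Proof.
apply: le_trans (ipnormB ipP _ _) _; rewrite mulrDl (ipnormZ ipP) lerD//.
by rewrite -mulrA; exact: frame_norm.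
Qed.

Let Tball C u : modball C u -> modball ((3 * (M * M) + normc z) * C) (T u).
Proof.
move=> uC; rewrite mulrDl; apply: modballD; last first.
  by rewrite -scaleNr -normcN; exact: modballZ.
by have := modball_frame uC gP gP; rewrite (_ : 3 * _ = 3 * (M * M) * C)//; ring.
Qed.

Let TX u : modspace u -> modspace (T u).
Proof. by move=> [C uC]; eexists; exact: Tball uC. Qed.

Let Trep l u : L l -> P l (T u) = T (P l u).
Proof. by move=> Ll; rewrite repB repZ (frame_rep _ Ll gB gB). Qed.

Lemma resolvent_norm : (forall u, T u = 0 -> u = 0) ->
  (forall f, exists u, T u = f) -> exists2 D, 0 < D & forall u, nrm u <= D * nrm (T u).
Proof.
move=> Tinj Tsurj; have b := ipnorm_ball ipP completeP.
have t0 : 0 < M * M + normc z + 1 by rewrite ltr_wpDl// addr_ge0 ?mulr_ge0 ?normc_ge0.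
have [|||D D0 hD] := @bounded_inverse _ _ _ b T _ Tlin t0.
- move=> C u uC; apply: le_trans (Tnorm u) _.
  have C0 : 0 <= C by exact: le_trans uC.
  apply: (@le_trans _ _ ((M * M + normc z) * C)).
    by rewrite ler_wpM2l// addr_ge0 ?mulr_ge0 ?normc_ge0.
  by rewrite ler_wpM2r// lerDl.
- by move=> C f _; have [u uf] := Tsurj f; exists (nrm u), u.
- by move=> C u _; exact: Tinj.
(* [bounded_inverse] requires a positive radius, and [T u] may be 0; hence the [e]. *)
exists D => // u; apply: (le_small (ltW D0)) => e e0; rewrite -mulrDr.
by apply: (hD _ (nrm u)) => //; rewrite ?lerDl ?ltW// ltr_wpDl.
Qed.

(** Each property of [u] is tested after applying [T]. Since [T] commutes with the shifts by [L], it
    maps [\sum c l *: P l u] to [\sum c l *: P l (T u)], so [u] inherits a Bessel bound from [T u].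
    Next, [T (P m u - u)] is [P m (T u) - T u] minus a commutator, which is O(t) by the Bessel bound
    just obtained. *)
Lemma resolvent_modspace D u : 0 <= D -> (forall v, nrm v <= D * nrm (T v)) ->
  modspace (T u) -> modspace u.
Proof.
move=> D0 hD [K fK]; have [f1 f2 f3] := fK; have [g1 g2 g3] := gP.
have K0 := modball_ge0 fK.
have Bu : bess (D * K) u.
  split=> [|c B fB]; first exact: mulr_ge0.
  apply: le_trans (hD _) _; rewrite -mulrA ler_wpM2l//.
  rewrite (big_morph T TD T0) (_ : \sum_(l <- B) _ = \sum_(l <- B) c l *: P l (T u)).
    by case: f2 => _; exact.
  rewrite [LHS]big_seq [RHS]big_seq; apply: eq_bigr => l lB.
  by rewrite TZ Trep//; exact: fB.2.
pose C := D * (K + (M * (D * K) * M + M * (D * K) * M)).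
have DK0 : 0 <= D * K by exact: mulr_ge0.
exists (C + D * K); split.
- apply: le_trans (hD u) _; apply: (@le_trans _ _ (D * K)); first by rewrite ler_wpM2l.
  by rewrite lerDr /C mulr_ge0// addr_ge0// addr_ge0// !mulr_ge0.
- by apply: bess_mono Bu; rewrite lerDr /C mulr_ge0// addr_ge0// addr_ge0// !mulr_ge0.
move=> j t t0; set m := gamma j t.
apply: (@le_trans _ _ (C * t)); last first.
  by rewrite ler_wpM2r ?(ltW t0)// lerDl.
apply: le_trans (hD _) _; rewrite /C -mulrA ler_wpM2l// mulrDl.
have e : T (P m u - u) = P m (T u) - T u -
    (P m (frame g g u) - frame g g u - frame g g (P m u - u)).
  by rewrite /T repB repZ; vec.
rewrite e; apply: le_trans (ipnormB ipP _ _) _; rewrite lerD ?f3//.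
apply: le_trans (frame_commutator m Bu g2 g2) _; rewrite mulrDl.
by rewrite lerD// -[leRHS]mulrA ler_wpM2l ?g3// mulr_ge0.
Qed.

Lemma resolvent_symmetric u v : conjc z = z -> ip (T u) v = ip u (T v).
Proof.
move=> zr; rewrite (ipBl ipP) (ipBr ipP) (frame_adjoint _ _ gB gB).
by rewrite (ipZl ipP) (ipZr ipP) zr.
Qed.

(** [<frame g g u, u>] is real by the adjoint relation, so the imaginary part of [<T u, u>] is
    [- Im z * |u|^2]. *)
Lemma resolvent_nonreal u : conjc z != z -> nrm u <= `|complex.Im z|^-1 * nrm (T u).
Proof.
move=> znr; have z0 : 0 < `|complex.Im z|.
  rewrite normr_gt0; apply: contra znr; case: (z) => a b /= /eqP ->.
  by rewrite oppr0.
rewrite mulrC ler_pdivlMr//.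
have [u0|u0] := eqVneq (nrm u) 0; first by rewrite u0 mul0r.
have up : 0 < nrm u by rewrite lt_neqAle eq_sym u0/=.
rewrite -(ler_pM2r up); apply: le_trans (ip_CauchySchwarz ipP (T u) u).
have S0 : complex.Im (ip (frame g g u) u) = 0.
  have := frame_adjoint u u gB gB; rewrite [X in _ = X -> _](ip_conj ipP).
  case: (ip _ _) => a b [] /= /eqP; rewrite -subr_eq0 opprK -mulr2n mulrn_eq0 /=.
  by move/eqP.
have e : complex.Im (ip (T u) u) = - (complex.Im z * nrm u ^+ 2).
  rewrite (ipBl ipP) ImD S0 add0r (ipZl ipP) (ipuu ipP).
  by case: (z) => a b /=; rewrite mulr0 add0r.
rewrite (_ : _ * _ * _ = `|complex.Im (ip (T u) u)|).
  rewrite -[leRHS]ger0_norm ?normc_ge0// -ler_sqr ?nnegrE// !real_normK ?num_real//.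
  by rewrite normc_sqrE lerDr sqr_ge0.
by rewrite e normrN normrM [`|nrm u ^+ 2|]ger0_norm ?sqr_ge0// mulrC; ring.
Qed.

(* Lax: by Banach's theorem the inverse of [T] on [modspace] is bounded for the
   norm of [modspace]; being symmetric, it is bounded for the norm of [V]. *)
Lemma resolvent_lax : conjc z = z ->
  (forall u, modspace u -> T u = 0 -> u = 0) ->
  (forall f, modspace f -> exists2 u, modspace u & T u = f) ->
  exists2 D, 0 < D & forall u, modspace u -> nrm u <= D * nrm (T u).
Proof.
move=> zr Tinj Tsurj; have b := modball_banach.
have t0 : 0 < 3 * (M * M) + normc z + 1.
  by rewrite ltr_wpDl// addr_ge0 ?normc_ge0// mulr_ge0// mulr_ge0.
have [|||D D0 hD] := @bounded_inverse _ _ _ b T _ Tlin t0.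
- move=> C u uC; apply: modball_mono (Tball uC).
  by rewrite ler_wpM2r ?(modball_ge0 uC)// lerDl.
- move=> C f fC; have [|u [E uE] uf] := Tsurj f; first by exists C.
  by exists E, u.
- by move=> C u uC; apply: Tinj; exists C.
have [inv invP] : exists inv, forall f, modspace f -> modspace (inv f) /\ T (inv f) = f.
  have [f|inv invP] := choice (P := fun f u => modspace f -> modspace u /\ T u = f).
    have [Xf|nXf] := pselect (modspace f); last by exists 0 => /nXf.
    by have [u Xu uf] := Tsurj f Xf; exists u.
  by exists inv.
(* [y n] is the n-th preimage of [T u], so [y 1 = u]. Banach's bound lets the norms grow at most
   like [D ^+ n], the symmetry of [T] makes them log-convex, and the first ratio is the claim. *)
exists D => // u Xu; pose y n := iter n inv (T u).
have Xy n : modspace (y n).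
  by elim: n => [|n IH]; [exact: TX|have [] := invP _ IH].
have Ty n : T (y n.+1) = y n by have [] := invP _ (Xy n).
have y1 : y 1%N = u.
  have : y 1%N - u = 0; last by move/eqP; rewrite subr_eq0 => /eqP.
  apply: Tinj; last by rewrite TB Ty subrr.
  by rewrite addrC -scaleN1r; exact: modspace_linear.
have [K uK] := Xy 0%N.
(* The radius is made positive, as [hD] requires. *)
have uK1 : modball (K + 1) (y 0%N) by apply: modball_mono uK; rewrite lerDl.
have K1 : 0 < K + 1 by rewrite ltr_wpDl// (modball_ge0 uK).
have By n : modball (D ^+ n * (K + 1)) (y n).
  elim: n => [|n IH]; first by rewrite expr0 mul1r.
  rewrite exprS -mulrA; have [E yE] := Xy n.+1; apply: hD yE _.
    by rewrite mulr_gt0// exprn_gt0.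
  by rewrite Ty.
rewrite -{1}y1 -[T u]/(y 0%N).
apply: (@logconvex_le _ (fun n => nrm (y n)) (K + 1)) => [|n|n|n] //.
- exact: ltW.
- rewrite (sqr_ipnorm ipP); apply: le_trans (Re_le_normc _) _.
  by rewrite -{1}Ty (resolvent_symmetric _ _ zr) Ty; exact: ip_CauchySchwarz.
- by have [h _ _] := By n; rewrite mulrC.
Qed.

Hypothesis Xdense : forall f, (forall u, modspace u -> ip f u = 0) -> f = 0.

(** The lower bound extends from the dense subspace by continuity, which gives injectivity. The
    range contains that subspace, and the bound makes preimages of approximants of [f] a Cauchy
    sequence, which gives surjectivity. *)
Lemma resolvent_extend D : 0 < D ->
  (forall u, modspace u -> nrm u <= D * nrm (T u)) ->
  (forall f, modspace f -> exists2 u, modspace u & T u = f) ->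
  (forall u, T u = 0 -> u = 0) /\ (forall f, exists u, T u = f).
Proof.
move=> D0 hD Tsurj.
have dense := dense_of_orthogonal ipP completeP
  (modspace0 (ex_intro _ g (ex_intro _ M gP))) modspace_linear Xdense.
split=> [u Tu0|f].
  have K0 : 0 <= D * (M * M + normc z) + 1.
    by rewrite addr_ge0// mulr_ge0 ?(ltW D0)// addr_ge0 ?normc_ge0// mulr_ge0.
  apply: (ipnorm_eq0 ipP); apply/eqP; rewrite eq_le nrm_ge0 andbT.
  apply: (le_small K0) => e e0; have [v Xv uv] := dense u e e0.
  apply: le_trans (ipnorm_leB ipP _ v) _; rewrite add0r mulrDl mul1r lerD//.
  apply: le_trans (hD _ Xv) _; rewrite -mulrA ler_wpM2l ?(ltW D0)//.
  have := Tnorm (u - v); rewrite TB Tu0 sub0r (ipnormN ipP) => /le_trans; apply.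
  by rewrite ler_wpM2l// addr_ge0 ?normc_ge0// mulr_ge0.
pose r n : R := (2 ^+ n)^-1.
have r0 n : 0 < r n by rewrite invr_gt0 exprn_gt0.
have rS n : r n.+1 = r n / 2 by rewrite /r exprS invfM mulrC.
have [u uP] : exists u : nat -> V, forall n, modspace (u n) /\ nrm (f - T (u n)) <= r n.
  have [n|u uP] := choice (P := fun n u => modspace u /\ nrm (f - T u) <= r n).
    have [v Xv fv] := dense f _ (r0 n); have [u Xu uv] := Tsurj v Xv.
    by exists u; rewrite uv.
  by exists u.
have D2 : 0 < 2 * D by rewrite mulr_gt0.
have rS2 n : 2 * D * r n.+1 <= 2 * D * r n / 2 by rewrite rS mulrA.
have [|l lP] := completeP (u := u) (fun n => mulr_gt0 D2 (r0 n)) rS2.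
  move=> n; have [Xn hn] := uP n; have [XS hS] := uP n.+1.
  apply: le_trans (hD _ _) _; first by rewrite addrC -scaleN1r; exact: modspace_linear.
  rewrite [2 * D]mulrC -mulrA ler_pM2l// TB.
  apply: le_trans (ipnorm_tri ipP f _ _) _; rewrite (ipnormBC ipP).
  by have := r0 n; move: hS; rewrite rS; lra.
exists l; apply: (eq_ipnorm_small ipP) => e e0.
pose K := (M * M + normc z) * (4 * D) + 1.
have [n hn] := geometric_small K e0; apply: le_trans hn.
apply: le_trans (ipnorm_tri ipP (T (u n)) _ _) _; rewrite -TB /K mulrDl mul1r lerD//.
  apply: le_trans (Tnorm _) _; rewrite -mulrA ler_wpM2l//.
    by rewrite addr_ge0 ?normc_ge0// mulr_ge0.
  by apply: le_trans (lP n) _; rewrite /r !mulrA -natrM.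
by rewrite (ipnormBC ipP); have [] := uP n.
Qed.

Lemma resolvent_bijP : set_bij modspace modspace T <-> set_bij setT setT T.
Proof.
have X0 := modspace0 (ex_intro _ g (ex_intro _ M gP)).
rewrite (linear_set_bij X0 modspace_linear Tlin) linear_set_bij//; split.
  move=> [_ Tinj Tsurj].
  suff [D D0 hD] : exists2 D, 0 < D & forall u, modspace u -> nrm u <= D * nrm (T u).
    have [h1 h2] := resolvent_extend D0 hD Tsurj; split=> // [u _|f _].
      exact: h1.
    by have [u uf] := h2 f; exists u.
  have [zr|znr] := eqVneq (conjc z) z; first exact: resolvent_lax.
  exists `|complex.Im z|^-1 => [|u _]; last exact: resolvent_nonreal.
  rewrite invr_gt0 normr_gt0; apply: contra znr; case: (z) => a b /= /eqP ->.
  by rewrite oppr0.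
move=> [_ Tinj Tsurj].
have [|f|D D0 hD] := resolvent_norm.
- by move=> u; exact: Tinj.
- by have [u _ uf] := Tsurj f I; exists u.
split=> [u Xu|u Xu|f Xf]; [exact: TX|exact: Tinj|].
have [u _ uf] := Tsurj f I; exists u => //.
by apply: (resolvent_modspace (ltW D0) hD); rewrite uf.
Qed.

End spectrum.
End gabor_system.

(** * The space of square-integrable functions *)

Section L2_integrals.
Context {R : realType} {d : nat}.
Local Notation C := R[i].
Local Notation E := (euclid R d).
Local Notation leb := (@lebesgue_tuple R d).
Implicit Types f g h : E -> C.

Definition L2mass f : \bar R := (\int[leb]_x (normc (f x) ^+ 2)%:E)%E.

Lemma L2mass_ge0 f : (0 <= L2mass f)%E.
Proof. by apply: integral_ge0 => x _; rewrite lee_fin sqr_ge0. Qed.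

Lemma L2norm_mass f : L2norm f = (L2mass f `^ 2^-1)%E.
Proof.
rewrite /L2norm unlock /=; congr (_ `^ _)%E; apply: eq_integral => x _.
by rewrite ger0_norm ?normc_ge0// powR_mulrn// normc_ge0.
Qed.

Lemma square_integrableE f :
  square_integrable f <-> complex_measurable f /\ (L2mass f < +oo)%E.
Proof.
rewrite /square_integrable L2norm_mass; split=> -[mf h]; split=> //.
  by apply: lty_poweRy h; rewrite invr_neq0.
exact: poweR_lty.
Qed.

Lemma measurable_normc_sqr f : complex_measurable f ->
  measurable_fun setT (fun x => normc (f x) ^+ 2).
Proof. by move=> mf; apply: measurable_funX; exact: complex_measurable_normc. Qed.

Lemma measurable_mass f : complex_measurable f ->
  measurable_fun setT (fun x => (normc (f x) ^+ 2)%:E).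
Proof. by move=> mf; apply/measurable_EFinP; exact: measurable_normc_sqr. Qed.

Lemma le_L2mass f g : complex_measurable f -> complex_measurable g ->
  (forall x, normc (f x) <= normc (g x)) -> (L2mass f <= L2mass g)%E.
Proof.
move=> mf mg fg; apply: ge0_le_integral => //.
- by move=> x _; rewrite lee_fin sqr_ge0.
- exact: measurable_mass.
- exact: measurable_mass.
- by move=> x _; rewrite lee_fin ler_sqr ?nnegrE ?normc_ge0.
Qed.

Lemma complex_measurableJ f : complex_measurable f ->
  complex_measurable (fun x => conjc (f x)).
Proof.
move=> [mr mi]; split.
  by rewrite (_ : (fun x => _) = fun x => complex.Re (f x)) //; apply/funext => x; case: (f x).
rewrite (_ : (fun x => _) = fun x => - complex.Im (f x)); last by apply/funext => x; case: (f x).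
exact: measurable_funN.
Qed.

Lemma complex_measurableM f g : complex_measurable f -> complex_measurable g ->
  complex_measurable (fun x => f x * g x).
Proof.
move=> [fr fi] [gr gi]; split.
- rewrite (_ : (fun x => _) = fun x => complex.Re (f x) * complex.Re (g x) -
      complex.Im (f x) * complex.Im (g x)).
    by apply: measurable_funB; exact: measurable_funM.
  by apply/funext => x; case: (f x) (g x) => a b [].
- rewrite (_ : (fun x => _) = fun x => complex.Re (f x) * complex.Im (g x) +
      complex.Im (f x) * complex.Re (g x)).
    by apply: measurable_funD; exact: measurable_funM.
  by apply/funext => x; case: (f x) (g x) => a b [].
Qed.

Lemma complex_measurableB f g : complex_measurable f -> complex_measurable g ->
  complex_measurable (fun x => f x - g x).
Proof.
move=> mf mg; rewrite (_ : (fun x => _) = fun x => f x + (-1) * g x).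
  by apply: complex_measurableD => //; exact: complex_measurableZ.
by apply/funext => x; rewrite mulN1r.
Qed.

Definition complex_integrable f :=
  leb.-integrable setT (EFin \o (fun x => complex.Re (f x))) /\
  leb.-integrable setT (EFin \o (fun x => complex.Im (f x))).

Definition complex_integral f : C :=
  (\int[leb]_x complex.Re (f x)) +i* (\int[leb]_x complex.Im (f x)).

Lemma complex_integrable_dom f (h : E -> R) : complex_measurable f ->
  leb.-integrable setT (EFin \o h) -> (forall x, normc (f x) <= h x) ->
  complex_integrable f.
Proof.
move=> [mr mi] ih fh; split; apply: le_integrable ih => //.
- exact/measurable_EFinP.
- move=> x _ /=; rewrite lee_fin; apply: le_trans (normr_Re_le_normc _) _.
  exact: le_trans (fh x) (ler_norm _).
- exact/measurable_EFinP.
- move=> x _ /=; rewrite lee_fin; apply: le_trans (Im_le_normc _) _.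
  exact: le_trans (fh x) (ler_norm _).
Qed.

Lemma integrable_mass f : square_integrable f ->
  leb.-integrable setT (EFin \o (fun x => normc (f x) ^+ 2)).
Proof.
move=> /square_integrableE[mf foo]; apply/integrableP; split; first exact: measurable_mass.
rewrite (_ : \int[leb]_x _ = L2mass f)%E//; apply: eq_integral => x _ /=.
by rewrite ger0_norm// sqr_ge0.
Qed.

Lemma square_integrable_mul f g : square_integrable f -> square_integrable g ->
  complex_integrable (fun x => f x * conjc (g x)).
Proof.
move=> sf sg; have [[mf _] [mg _]] := (sf, sg).
apply: (@complex_integrable_dom _ (fun x => normc (f x) ^+ 2 + normc (g x) ^+ 2)).
- by apply: complex_measurableM => //; exact: complex_measurableJ.
- have := integrableD (@measurableT _ E) (integrable_mass sf) (integrable_mass sg).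
  exact.
- move=> x; rewrite normcM normc_conj.
  have := sqr_ge0 (normc (f x) - normc (g x)).
  by have := sqr_ge0 (normc (f x)); have := sqr_ge0 (normc (g x)); nra.
Qed.

Lemma complex_integral_linear (a : C) f g : complex_integrable f ->
  complex_integrable g ->
  complex_integrable (fun x => a * f x + g x) /\
  complex_integral (fun x => a * f x + g x) = a * complex_integral f + complex_integral g.
Proof.
move=> [fr fi] [gr gi]; case: a => a b.
have iZ (k : R) (h : E -> R) : leb.-integrable setT (EFin \o h) ->
    leb.-integrable setT (EFin \o (fun x => k * h x)).
  by move=> ih; have := integrableZl (@measurableT _ E) k ih.
have iD (h k : E -> R) : leb.-integrable setT (EFin \o h) ->
    leb.-integrable setT (EFin \o k) -> leb.-integrable setT (EFin \o (fun x => h x + k x)).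
  by move=> ih ik; have := integrableD (@measurableT _ E) ih ik.
have eR x : complex.Re ((a +i* b) * f x + g x) =
    (a * complex.Re (f x) + (- b) * complex.Im (f x)) + complex.Re (g x).
  by case: (f x) (g x) => p q [r s] /=; ring.
have eI x : complex.Im ((a +i* b) * f x + g x) =
    (a * complex.Im (f x) + b * complex.Re (f x)) + complex.Im (g x).
  by case: (f x) (g x) => p q [r s] /=; ring.
have E1 := iD _ _ (iZ a _ fr) (iZ (- b) _ fi).
have E2 := iD _ _ (iZ a _ fi) (iZ b _ fr).
rewrite /complex_integrable /complex_integral.
under [fun x => complex.Re _]eq_fun do rewrite eR.
under [fun x => complex.Im _]eq_fun do rewrite eI.
split; first by split; apply: iD.
rewrite !RintegralD//; try exact: iZ.
rewrite !RintegralZl//.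
move: (\int[leb]_x complex.Re (f x)) (\int[leb]_x complex.Im (f x)) => p q.
move: (\int[leb]_x complex.Re (g x)) (\int[leb]_x complex.Im (g x)) => r s.
by apply/eqP; rewrite eq_complex /=; apply/andP; split; apply/eqP; ring.
Qed.

Lemma eq_ae_complex_integral f g : complex_measurable f -> complex_measurable g ->
  ae_eq leb setT f g -> complex_integral f = complex_integral g.
Proof.
move=> [fr fi] [gr gi] fg; rewrite /complex_integral; congr (_ +i* _).
- congr fine; apply: ae_eq_integral => //; [exact/measurable_EFinP..|].
  by move: fg; apply: filterS => x /= h _; rewrite h.
- congr fine; apply: ae_eq_integral => //; [exact/measurable_EFinP..|].
  by move: fg; apply: filterS => x /= h _; rewrite h.
Qed.

Lemma eq_ae_L2mass f g : complex_measurable f -> complex_measurable g ->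
  ae_eq leb setT f g -> L2mass f = L2mass g.
Proof.
move=> mf mg fg; apply: ae_eq_integral => //; [exact: measurable_mass..|].
by move: fg; apply: filterS => x /= h _; rewrite h.
Qed.

Lemma L2innerE f g : L2inner f g = complex_integral (fun x => f x * conjc (g x)).
Proof. by []. Qed.

Lemma L2mass_fin f : square_integrable f ->
  L2mass f = (complex.Re (L2inner f f))%:E.
Proof.
move=> sf; rewrite L2innerE /complex_integral /= fineK.
  by apply: eq_integral => x _; rewrite mul_conjc.
apply: integrable_fin_num => //; have [h _] := square_integrable_mul sf sf.
exact: h.
Qed.

End L2_integrals.

Section L2_space.
Context {R : realType} {d : nat}.
Local Notation C := R[i].
Local Notation E := (euclid R d).
Local Notation leb := (@lebesgue_tuple R d).
Local Notation L2 := (L2space R d).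
Implicit Types u v w : L2.

Definition L2class (f : E -> C) (sf : square_integrable f) : L2 :=
  \pi_L2 (MkL2fun sf).

Lemma L2space_square u : square_integrable (u : E -> C).
Proof. exact: L2funP. Qed.

Lemma L2space_measurable u : complex_measurable (u : E -> C).
Proof. by have [] := L2space_square u. Qed.

Lemma L2repr_ae (f : @L2fun R d) : ae_eq leb setT (\pi_L2 f : L2) f.
Proof.
suff /eqP : \pi_L2 (repr (\pi_L2 f)) = \pi_L2 f.
  by rewrite eqmodE => /asboolP.
by rewrite reprK.
Qed.

Lemma L2class_ae f (sf : square_integrable f) : ae_eq leb setT (L2class sf) f.
Proof. exact: L2repr_ae. Qed.

Lemma L2space_eq u v : ae_eq leb setT u v -> u = v.
Proof.
move=> uv; rewrite -[u]reprK -[v]reprK; apply/eqP; rewrite eqmodE.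
exact/asboolP.
Qed.

Lemma L2add_ae u v : ae_eq leb setT (u + v : L2) (fun x => u x + v x).
Proof. exact: L2repr_ae. Qed.

Lemma L2scale_ae a u : ae_eq leb setT (a *: u : L2) (fun x => a * u x).
Proof. exact: L2repr_ae. Qed.

Lemma L2sub_ae u v : ae_eq leb setT (u - v : L2) (fun x => u x - v x).
Proof.
have := L2add_ae u (- v); have := L2scale_ae (-1) v.
rewrite scaleN1r; apply: filterS2 => x /= h1 h2 _.
by rewrite h2// h1// mulN1r.
Qed.

Lemma L2zero_ae : ae_eq leb setT (0 : L2) (fun=> 0).
Proof. exact: L2repr_ae. Qed.

Lemma L2sum_ae (I : Type) (s : seq I) (F : I -> L2) (f : I -> E -> C) :
  (forall i, ae_eq leb setT (F i) (f i)) ->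
  ae_eq leb setT (\sum_(i <- s) F i : L2) (fun x => \sum_(i <- s) f i x).
Proof.
move=> Ff; elim: s => [|i s IH].
  by rewrite big_nil; apply: filterS L2zero_ae => x h _; rewrite h// big_nil.
rewrite big_cons; have h3 := L2add_ae (F i) (\sum_(i <- s) F i).
apply: (filterS3 _ _ (Ff i) IH h3) => x h1 h2 {}h3 _.
by rewrite h3//= big_cons h1// h2.
Qed.

Definition L2ip u v : C := L2inner u v.

Lemma L2inner_ae (f f' g g' : E -> C) :
  complex_measurable f -> complex_measurable f' ->
  complex_measurable g -> complex_measurable g' ->
  ae_eq leb setT f f' -> ae_eq leb setT g g' -> L2inner f g = L2inner f' g'.
Proof.
move=> mf mf' mg mg' ff' gg'; rewrite !L2innerE; apply: eq_ae_complex_integral.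
- by apply: complex_measurableM => //; exact: complex_measurableJ.
- by apply: complex_measurableM => //; exact: complex_measurableJ.
- by move: ff' gg'; apply: filterS2 => x h1 h2 _; rewrite h1// h2.
Qed.

Lemma L2ip_inner : inner_product L2ip.
Proof.
have lin (a : C) u v w : L2ip (a *: u + v) w = a * L2ip u w + L2ip v w.
  rewrite /L2ip.
  have mu := L2space_measurable u; have mv := L2space_measurable v.
  have mw := L2space_measurable w.
  have mau := complex_measurableZ a mu.
  rewrite (@L2inner_ae _ (fun x => a * u x + v x) _ w)//.
  + have [_ <-] := complex_integral_linear a
      (square_integrable_mul (L2space_square u) (L2space_square w))
      (square_integrable_mul (L2space_square v) (L2space_square w)).
    rewrite L2innerE; congr complex_integral; apply/funext => x.
    by rewrite mulrDl mulrA.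
  + exact: L2space_measurable.
  + exact: complex_measurableD.
  + have := L2add_ae (a *: u) v; have := L2scale_ae a u.
    by apply: filterS2 => x h1 h2 _; rewrite h2// h1.
  + exact: ae_eq_refl.
have conj u v : L2ip v u = conjc (L2ip u v).
  rewrite /L2ip !L2innerE /complex_integral /=.
  congr (_ +i* _).
    by apply: eq_Rintegral => x _; case: (u x) (v x) => a b [c e] /=; ring.
  rewrite -mulN1r -RintegralZl//.
    by apply: eq_Rintegral => x _; case: (u x) (v x) => a b [c e] /=; ring.
  by have [] := square_integrable_mul (L2space_square u) (L2space_square v).
have pos u : 0 <= complex.Re (L2ip u u).
  rewrite /L2ip -lee_fin -L2mass_fin ?L2mass_ge0//.
  exact: L2space_square.
have def u : L2ip u u = 0 -> u = 0.
  rewrite /L2ip => u0; apply: L2space_eq.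
  have := L2mass_fin (L2space_square u); rewrite u0 /= => m0.
  have : ae_eq leb setT (fun x => (normc (u x) ^+ 2)%:E) (cst 0%E).
    apply/(ae_eq_integral_abs leb measurableT (measurable_mass (L2space_measurable u))).
    rewrite -[RHS]m0; apply: eq_integral => x _.
    by rewrite gee0_abs// lee_fin sqr_ge0.
  have := L2zero_ae; apply: filterS2 => x h0 /(_ I) [] /eqP.
  rewrite sqrf_eq0 => /eqP/eq0_normc ux _.
  by rewrite h0.
by split; [exact: lin|exact: conj|exact: pos|exact: def].
Qed.

Local Notation nrm := (ipnorm L2ip).

Lemma L2norm_ae (f g : E -> C) : complex_measurable f -> complex_measurable g ->
  ae_eq leb setT f g -> L2norm f = L2norm g.
Proof. by move=> mf mg fg; rewrite !L2norm_mass (eq_ae_L2mass mf mg fg). Qed.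

Lemma L2mass_nrm u : L2mass u = (nrm u ^+ 2)%:E.
Proof. by rewrite (L2mass_fin (L2space_square u)) (sqr_ipnorm L2ip_inner). Qed.

Lemma L2norm_nrm u : L2norm u = (nrm u)%:E.
Proof.
rewrite L2norm_mass L2mass_nrm poweR_EFin powR12_sqrt ?sqr_ge0// sqrtr_sqr.
by rewrite ger0_norm// ipnorm_ge0.
Qed.

Lemma nrmE u (f : E -> C) : complex_measurable f -> ae_eq leb setT u f ->
  (nrm u ^+ 2)%:E = L2mass f.
Proof.
move=> mf uf; rewrite -L2mass_nrm; apply: eq_ae_L2mass => //.
exact: L2space_measurable.
Qed.

Lemma nrm_le u (f : E -> C) (K : R) : 0 <= K -> complex_measurable f ->
  ae_eq leb setT u f -> (nrm u <= K) = (L2mass f <= (K ^+ 2)%:E)%E.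
Proof.
move=> K0 mf uf; rewrite -(nrmE mf uf) lee_fin ler_sqr ?nnegrE//.
exact: ipnorm_ge0.
Qed.

Lemma bounded_increments_cvg (a : nat -> R) (K : R) :
  (forall n, \sum_(k < n) `|a k.+1 - a k| <= K) -> cvgn a.
Proof.
move=> aK; pose b n := a n.+1 - a n.
have : cvgn (series b).
  apply: (@normed_cvg _ R^o); apply: nondecreasing_is_cvgn.
    by apply: nondecreasing_series => n _ _ /=.
  by exists K => _ [n _ <-]; apply: le_trans (aK n); rewrite -(big_mkord xpredT (fun k => `|a k.+1 - a k|)).
have -> : a = (fun n => a 0%N + series b n).
  by apply/funext => n; rewrite /series /= telescope_sumr// addrC subrK.
by move=> sb; apply: is_cvgD => //; exact: is_cvg_cst.
Qed.

Lemma nneseries_le (F : nat -> \bar R) K : (forall n, (0 <= F n)%E) ->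
  (forall n, (\sum_(0 <= k < n) F k <= K)%E) -> (\sum_(n <oo) F n <= K)%E.
Proof.
move=> F0 FK; apply: lime_le; first exact: is_cvg_nneseries.
exact: nearW.
Qed.

Lemma limn_einf_le (F : nat -> \bar R) K (n : nat) :
  (forall m, (n <= m)%N -> (F m <= K)%E) -> (limn_einf F <= K)%E.
Proof.
move=> FK; rewrite limn_einf_lim; apply: lime_le; first exact: is_cvg_einfs.
apply: nearW => k; apply: (@le_trans _ _ (F (maxn k n))).
  by apply: ereal_inf_lbound; exists (maxn k n) => //=; exact: leq_maxl.
exact/FK/leq_maxr.
Qed.

(* Riesz-Fischer. With [c n] the increments, [sum_n 2^n |c n|^2] has a finite
   integral, hence is finite almost everywhere, and there [sum_n |c n|]
   converges since [2 |c n| <= 2^n |c n|^2 + 2^-n]. *)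
Lemma L2_complete : ip_complete L2ip.
Proof.
move=> u_ r r0 rS ur; pose u n : L2 := u_ n; rewrite -/u in ur *.
pose c n (x : E) := u n.+1 x - u n x.
have mc n : complex_measurable (c n).
  by apply: complex_measurableB; exact: L2space_measurable.
have cr n : (L2mass (c n) <= (r n ^+ 2)%:E)%E.
  by rewrite -(@nrm_le (u n.+1 - u n)) ?(ltW (r0 n))//; exact: L2sub_ae.
pose h n (x : E) : \bar R := (2 ^+ n * normc (c n x) ^+ 2)%:E.
have h0 n x : (0 <= h n x)%E by rewrite lee_fin mulr_ge0 ?sqr_ge0.
have mh n : measurable_fun setT (h n).
  by apply/measurable_EFinP; apply: measurable_funM => //; exact: measurable_normc_sqr.
pose H (x : E) : \bar R := (\sum_(n <oo) h n x)%E.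
have mH : measurable_fun setT H.
  apply: (@emeasurable_fun_cvg _ _ _ _ (fun n x => \sum_(0 <= k < n) h k x)%E).
    by move=> n; exact: emeasurable_sum.
  by move=> x _; apply: is_cvg_nneseries.
have r_geo m : r m <= r 0%N * (2 ^+ m)^-1.
  elim: m => [|m IH]; first by rewrite expr0 invr1 mulr1.
  apply: le_trans (rS m) _; rewrite exprS invfM mulrCA [leRHS]mulrC.
  by rewrite ler_wpM2r// invr_ge0.
have hr n : 2 ^+ n * r n ^+ 2 <= r 0%N * r n.
  rewrite expr2 mulrA ler_pM2r// mulrC; have := r_geo n.
  by rewrite -ler_pdivlMr ?exprn_gt0.
have sum_r n : \sum_(k < n) r k <= 2 * r 0%N - 2 * r n.
  elim: n => [|n IH]; first by rewrite big_ord0 subrr.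
  by rewrite big_ord_recr /=; have := rS n; lra.
have Hint : (\int[leb]_x H x < +oo)%E.
  rewrite /H integral_nneseries//; apply: (@le_lt_trans _ _ (r 0%N * (2 * r 0%N))%:E); last exact: ltry.
  apply: nneseries_le => [n|n]; first by apply: integral_ge0 => x _.
  have hn k : (\int[leb]_x h k x <= (r 0%N * r k)%:E)%E.
    rewrite /h; under eq_integral do rewrite EFinM.
    rewrite ge0_integralZl_EFin//; last exact: measurable_mass.
      apply: (@le_trans _ _ (2 ^+ k * r k ^+ 2)%:E); last by rewrite lee_fin.
      by rewrite EFinM lee_wpmul2l ?lee_fin ?exprn_ge0//; exact: cr.
    by move=> x _; rewrite lee_fin sqr_ge0.
  rewrite big_mkord; apply: (@le_trans _ _ (\sum_(k < n) (r 0%N * r k)%:E)%E).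
    by apply: lee_sum => k _; exact: hn.
  rewrite sumEFin lee_fin -mulr_sumr ler_pM2l//; apply: le_trans (sum_r n) _.
  by rewrite gerBl mulr_ge0// ltW.
have H0 x : (0 <= H x)%E by apply: nneseries_ge0.
have Hae : {ae leb, forall x, H x < +oo}%E.
  have : leb.-integrable setT H.
    apply/integrableP; split => //; apply: le_lt_trans Hint.
    by under eq_integral do rewrite gee0_abs//.
  move=> /integrable_ae - /(_ measurableT); apply: filterS => x /(_ I).
  by rewrite ge0_fin_numE.
pose A := [set x | H x < +oo]%E.
have mA : measurable A.
  by rewrite -[A]setTI; exact: emeasurable_fun_infty_o.
(* Cutting off outside [A] makes the sequence converge at every point, so that its limit is
   measurable, and changes [u n] only on a null set. *)
pose g n x : C := (\1_A x : R)%:C * u n x.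
have m1 : measurable_fun setT (\1_A : E -> R) by exact: measurable_indic.
have mg n : complex_measurable (g n).
  have [mr mi] := L2space_measurable (u n); split.
    rewrite (_ : (fun x => _) = fun x => \1_A x * complex.Re (u n x)).
      exact: measurable_funM.
    by apply/funext => x; rewrite /g Re_realM.
  rewrite (_ : (fun x => _) = fun x => \1_A x * complex.Im (u n x)).
    exact: measurable_funM.
  by apply/funext => x; rewrite /g; case: (u n x) => a b /=; rewrite mul0r addr0.
have gu n : ae_eq leb setT (g n) (u n).
  by move: Hae; apply: filterS => x Ax _; rewrite /g indicE mem_set// mul1r.
have gcvg (p : C -> R) : p 0 = 0 -> (forall z z' : C, p (z - z') = p z - p z') ->
    (forall z, `|p z| <= normc z) -> forall x, cvgn (fun n => p (g n x)).
  move=> p0 pB pn x; have [Ax|nAx] := pselect (A x); last first.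
    have -> : (fun n => p (g n x)) = cst 0.
      by apply/funext => n; rewrite /g indicE memNset// mul0r p0.
    exact: is_cvg_cst.
  apply: (@bounded_increments_cvg _ (fine (H x) + 2)) => n.
  have gx k : g k x = u k x by rewrite /g indicE mem_set// mul1r.
  apply: (@le_trans _ _ (\sum_(k < n) (2 ^+ k * normc (c k x) ^+ 2 + (2 ^+ k)^-1))).
    apply: ler_sum => k _; rewrite !gx -pB; apply: le_trans (pn _) _; rewrite -/(c k x).
    move: (normc_ge0 (c k x)); move: (normc _) => y y0.
    have k0 : 0 < 2 ^+ k :> R by rewrite exprn_gt0.
    have e : 2 ^+ k * (2 ^+ k)^-1 = 1 :> R by rewrite divff// gt_eqF.
    have i0 : 0 < (2 ^+ k)^-1 :> R by rewrite invr_gt0.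
    move: (2 ^+ k) (2 ^+ k)^-1 k0 e i0 => a b a0 e b0.
    have : 0 <= b * (a * y - 1) ^+ 2 by rewrite mulr_ge0 ?sqr_ge0// ltW.
    have -> : b * (a * y - 1) ^+ 2 = (a * b) * a * y ^+ 2 - 2 * (a * b) * y + b by ring.
    by rewrite e; lra.
  rewrite big_split /=; apply: lerD.
    rewrite -lee_fin fineK ?ge0_fin_numE//.
    have := nneseries_lim_ge n (fun k _ _ => h0 k x) (P := xpredT) (m := 0).
    by rewrite big_mkord -sumEFin.
  have : \sum_(k < n) (2 ^+ k)^-1 <= 2 - 2 * (2 ^+ n)^-1 :> R.
    elim: n => [|n IH]; first by rewrite big_ord0 expr0 invr1; lra.
    rewrite big_ord_recr /= exprS invfM.
    by move: IH; move: (\sum_(k < n) _) (2 ^+ n)^-1 => s i; lra.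
  by move/le_trans; apply; rewrite gerBl mulr_ge0// invr_ge0.
pose f (x : E) : C := limn (fun n => complex.Re (g n x)) +i* limn (fun n => complex.Im (g n x)).
have cvRe x : (fun n => complex.Re (g n x)) @ \oo --> complex.Re (f x).
  apply: (gcvg (@complex.Re R)) => // [z z'|z]; first by rewrite ReD ReN.
  exact: normr_Re_le_normc.
have cvIm x : (fun n => complex.Im (g n x)) @ \oo --> complex.Im (f x).
  apply: (gcvg (@complex.Im R)) => // [[a b] [a' b']|z] //.
  exact: Im_le_normc.
have mf : complex_measurable f.
  split.
    apply: (@measurable_fun_cvg _ _ _ _ (fun n x => complex.Re (g n x))) => [n|x _].
      by have [] := mg n.
    exact: cvRe.
  apply: (@measurable_fun_cvg _ _ _ _ (fun n x => complex.Im (g n x))) => [n|x _].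
    by have [] := mg n.
  exact: cvIm.
have nrm_inc n i : nrm (u (n + i)%N - u n) <= 2 * r n - 2 * r (n + i)%N.
  elim: i => [|i IH]; first by rewrite addn0 !subrr (ipnorm0 L2ip_inner).
  apply: le_trans (ipnorm_tri L2ip_inner (u (n + i)%N) _ _) _.
  by rewrite addnS; have := ur (n + i)%N; have := rS (n + i)%N; lra.
(* Fatou's lemma in [m] carries the bound on [u m - u n] over to the pointwise limit. *)
have fg n : (L2mass (fun x => f x - g n x)%R <= ((2 * r n) ^+ 2)%:E)%E.
  pose F m x : \bar R := (normc (g m x - g n x) ^+ 2)%:E.
  have mF m : measurable_fun setT (F m) by apply: measurable_mass; apply: complex_measurableB.
  have F0 m x : setT x -> (0 <= F m x)%E by rewrite lee_fin sqr_ge0.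
  have FE x : limn_einf (F^~ x) = (normc (f x - g n x) ^+ 2)%:E.
    apply: (cvg_limn_einf_sup _).1; apply/cvg_EFin; first exact: nearW.
    rewrite normc_sqrE ReD ReN ImD (_ : complex.Im (- g n x) = - complex.Im (g n x)); last by case: (g n x).
    rewrite (_ : _ \o _ = fun m =>
      (complex.Re (g m x) - complex.Re (g n x)) * (complex.Re (g m x) - complex.Re (g n x)) +
      (complex.Im (g m x) - complex.Im (g n x)) * (complex.Im (g m x) - complex.Im (g n x))).
      by rewrite !expr2; apply: cvgD; apply: cvgM; apply: cvgB => //; exact: cvg_cst.
    apply/funext => m /=; rewrite -!expr2 normc_sqrE ReD ReN ImD.
    by rewrite (_ : complex.Im (- g n x) = - complex.Im (g n x))//; case: (g n x).
  apply: (@le_trans _ _ (\int[leb]_x limn_einf (F^~ x))%E).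
    by under [in leRHS]eq_integral do rewrite FE.
  apply: le_trans (fatou leb measurableT mF F0) _; apply: (@limn_einf_le _ _ n) => m nm.
  rewrite [leLHS](_ : _ = L2mass (fun x => g m x - g n x)%R)//.
  rewrite -(@nrm_le (u m - u n)).
  - rewrite -(subnKC nm); apply: le_trans (nrm_inc _ _) _.
    by rewrite gerBl mulr_ge0// ltW.
  - by rewrite mulr_ge0// ltW.
  - by apply: complex_measurableB.
  - have := L2sub_ae (u m) (u n); apply: (filterS3 _ _ (gu m) (gu n)) => x h1 h2 h3 _.
    by rewrite h3// h1// h2.
have sf : square_integrable f.
  rewrite (_ : f = fun x => (f x - g 0%N x) + g 0%N x); last first.
    by apply/funext => x; rewrite subrK.
  apply: square_integrableD; apply/square_integrableE; split=> //.
  - by apply: complex_measurableB.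
  - by apply: le_lt_trans (fg 0%N) _; exact: ltry.
  - rewrite (eq_ae_L2mass _ (L2space_measurable (u 0%N)) (gu 0%N))//.
    by rewrite L2mass_nrm ltry.
exists (L2class sf) => n; rewrite (@nrm_le _ (fun x => f x - g n x)).
- exact: fg.
- by rewrite mulr_ge0// ltW.
- by apply: complex_measurableB.
- have := L2sub_ae (L2class sf) (u n).
  apply: (filterS3 _ _ (L2class_ae sf) (gu n)) => x h1 h2 h3 _.
  by rewrite h3// h1// h2.
Qed.

End L2_space.

(** * Lebesgue measure under translations *)

Section translation_invariance.
Context {R : realType}.
Local Notation euc n := (n.-tuple (measurableTypeR R)).

Definition tuple_shift n (a : 'I_n -> R) (x : euc n) : euc n := [tuple tnth x i - a i | i < n].

Lemma measurable_shift n (a : 'I_n -> R) : measurable_fun setT (tuple_shift a).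
Proof.
apply/measurable_fun_tnthP => i.
rewrite (_ : _ \o _ = fun x => tnth x i - a i); last first.
  by apply/funext => x /=; rewrite tnth_mktuple.
by apply: measurable_funB => //; exact: measurable_tnth.
Qed.

Lemma lebesgue_measure_shift (a : R) (A : set R) : measurable A ->
  pushforward (@lebesgue_measure R) ((fun x => x - a) : _ -> measurableTypeR R) A =
  lebesgue_measure A.
Proof.
move=> mA; apply/esym/lebesgue_measure_unique => //=.
  by apply: measurable_funB.
move=> m _ [[b c]] _ <-; rewrite /pushforward.
rewrite (_ : _ @^-1` _ = `](b + a), (c + a)]%classic); last first.
  by apply/seteqP; split => x; rewrite /= !in_itv /= ltrBrDr lerBlDr.
rewrite !lebesgue_measure_itv/= !lte_fin ltrD2r.
by case: ifP => // _; rewrite -!EFinB; congr EFin; ring.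
Qed.

(** Induction on [n]: read through [cons], the shift is the product of a shift of the line and a
    shift in dimension [n], and a product measure is determined by its values on rectangles. *)
Lemma lebesgue_tuple_shift n (a : 'I_n -> R) (A : set (euc n)) : measurable A ->
  lebesgue_tuple n (tuple_shift a @^-1` A) = lebesgue_tuple n A.
Proof.
elim: n a A => [|n IH] a A mA.
  rewrite (_ : tuple_shift a = id) ?preimage_id//.
  by apply/funext => x; rewrite [LHS]tuple0 [RHS]tuple0.
pose cons (p : measurableTypeR R * euc n) : euc n.+1 := [tuple of p.1 :: p.2].
have mcons : measurable_fun setT cons by exact: measurable_cons.
pose b (i : 'I_n) := a (lift ord0 i).
pose sh (p : measurableTypeR R * euc n) : measurableTypeR R * euc n :=
  (p.1 - a ord0, tuple_shift b p.2).
have msh : measurable_fun setT sh.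
  apply/measurable_fun_pairP; split => /=.
    by apply: measurable_funB => //; exact: measurable_fst.
  exact: (measurableT_comp (measurable_shift b) measurable_snd).
have tnth0 q : tnth (cons q) ord0 = q.1 by [].
have tnthS q j : tnth (cons q) (lift ord0 j) = tnth q.2 j by rewrite !(tnth_nth 0).
have shE p : tuple_shift a (cons p) = cons (sh p).
  apply: eq_from_tnth => i; rewrite tnth_mktuple.
  by case: (unliftP ord0 i) => [j|] ->; rewrite ?tnthS ?tnth0// tnth_mktuple.
have mB : measurable (cons @^-1` A) by rewrite -[X in measurable X]setTI; exact: mcons.
change ((lebesgue_measure \x lebesgue_tuple n)%E (cons @^-1` (tuple_shift a @^-1` A)) =
  (lebesgue_measure \x lebesgue_tuple n)%E (cons @^-1` A)).
transitivity (pushforward (lebesgue_measure \x lebesgue_tuple n)%E sh (cons @^-1` A)).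
  rewrite /pushforward; congr (product_measure1 _ _ _).
  by apply/seteqP; split => p /=; rewrite shE.
apply/esym/product_measure_unique => //.
move=> X Y mX mY.
change ((lebesgue_measure \x lebesgue_tuple n)%E
  (((fun x => x - a ord0) @^-1` X) `*` (tuple_shift b @^-1` Y)) =
  (lebesgue_measure X * lebesgue_tuple n Y)%E).
rewrite product_measure1E.
- by rewrite -(IH b Y mY) -[in RHS](lebesgue_measure_shift (a ord0) mX).
- rewrite -[X in measurable X]setTI; suff : measurable_fun setT ((fun x => x - a ord0) :
    measurableTypeR R -> measurableTypeR R) by exact.
  by apply: measurable_funB.
- by rewrite -[X in measurable X]setTI; exact: measurable_shift.
Qed.

Lemma integral_shift n (a : 'I_n -> R) (F : euc n -> \bar R) : measurable_fun setT F ->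
  (\int[lebesgue_tuple n]_x F (tuple_shift a x) = \int[lebesgue_tuple n]_x F x)%E.
Proof.
move=> mF; have ge0 (G : euc n -> \bar R) : measurable_fun setT G -> (forall x, 0 <= G x)%E ->
    (\int[lebesgue_tuple n]_x G (tuple_shift a x) = \int[lebesgue_tuple n]_x G x)%E.
  move=> mG G0; have := @ge0_integral_pushforward _ _ _ _ R _ (measurable_shift a)
    (lebesgue_tuple n) _ G measurableT mG (fun x _ => G0 x).
  rewrite preimage_setT => <-; apply: eq_measure_integral => [|? A mA _]; first exact: measurable_shift.
  exact: (lebesgue_tuple_shift a mA).
rewrite -[LHS]/(\int[lebesgue_tuple n]_x (F \o tuple_shift a) x)%E.
rewrite [LHS]integralE [RHS]integralE funepos_comp funeneg_comp.
by congr (_ - _)%E; apply: ge0 => //; [exact: measurable_funepos|exact: measurable_funeneg].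
Qed.

Lemma ae_eq_shift n (a : 'I_n -> R) (T : Type) (f g : euc n -> T) :
  ae_eq (lebesgue_tuple n) setT f g ->
  ae_eq (lebesgue_tuple n) setT (f \o tuple_shift a) (g \o tuple_shift a).
Proof.
move=> [N [mN N0 sN]]; exists (tuple_shift a @^-1` N); split.
- by rewrite -[X in measurable X]setTI; exact: measurable_shift.
- by rewrite -N0; exact: (lebesgue_tuple_shift a mN).
- by move=> x /= h; apply: sN => /= h'; apply: h => _; exact: h'.
Qed.

End translation_invariance.

Section time_frequency_shifts.
Context {R : realType} {d : nat}.
Local Notation C := R[i].
Local Notation E := (euclid R d).
Local Notation leb := (@lebesgue_tuple R d).
Local Notation L2 := (L2space R d).
Implicit Types (l m : 'cV[R]_(d + d)) (f g : E -> C) (u v : L2).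

Definition cis (t : R) : C := cos t +i* sin t.

Lemma cisD s t : cis (s + t) = cis s * cis t.
Proof.
rewrite /cis cosD sinD; apply/eqP; rewrite eq_complex /=.
by apply/andP; split; apply/eqP; ring.
Qed.

Lemma cis0 : cis 0 = 1.
Proof. by rewrite /cis cos0 sin0. Qed.

Lemma conj_cis t : conjc (cis t) = cis (- t).
Proof. by rewrite /cis cosN sinN. Qed.

Lemma cisM_conj t : cis t * conjc (cis t) = 1.
Proof. by rewrite conj_cis -cisD subrr cis0. Qed.

Lemma normc_cis t : normc (cis t) = 1.
Proof. exact/unimodular_normc/cisM_conj. Qed.

Definition tshift l : E -> E := tuple_shift (fun i => usubmx l i 0).

Definition phase l (x : E) : R := 2 * pi * \sum_(i < d) dsubmx l i 0 * tnth x i.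

Lemma tfshiftE l f x : tfshift l f x = cis (phase l (tshift l x)) * f (tshift l x).
Proof. by []. Qed.

Lemma measurable_phase l : measurable_fun setT (phase l).
Proof.
apply: measurable_funM => //; apply: measurable_sum => i.
by apply: measurable_funM => //; exact: measurable_tnth.
Qed.

Lemma complex_measurable_cis (t : E -> R) : measurable_fun setT t ->
  complex_measurable (fun x => cis (t x)).
Proof.
move=> mt; split.
  apply: (measurableT_comp (f := @cos R)) => //.
  by apply: continuous_measurable_fun; exact: continuous_cos.
apply: (measurableT_comp (f := @sin R)) => //.
by apply: continuous_measurable_fun; exact: continuous_sin.
Qed.

Lemma complex_measurable_shift (a : 'I_d -> R) f : complex_measurable f ->
  complex_measurable (f \o tuple_shift a).
Proof.
move=> [mr mi]; split; [exact: (measurableT_comp mr (measurable_shift a))|].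
exact: (measurableT_comp mi (measurable_shift a)).
Qed.

Lemma L2mass_shift (a : 'I_d -> R) f : complex_measurable f ->
  L2mass (f \o tuple_shift a) = L2mass f.
Proof.
move=> mf; rewrite /L2mass.
by rewrite -(integral_shift a (measurable_mass mf)).
Qed.

Lemma complex_integral_shift (a : 'I_d -> R) f : complex_measurable f ->
  complex_integral (f \o tuple_shift a) = complex_integral f.
Proof.
move=> [mr mi]; rewrite /complex_integral /Rintegral.
have /measurable_EFinP mr' := mr; have /measurable_EFinP mi' := mi.
by rewrite -(integral_shift a mr') -(integral_shift a mi').
Qed.

Lemma complex_measurable_tfshift l f : complex_measurable f ->
  complex_measurable (tfshift l f).
Proof.
move=> mf; apply: (@complex_measurable_shift (fun i => usubmx l i 0) (fun x => cis (phase l x) * f x)).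
apply: complex_measurableM => //; apply: complex_measurable_cis.
exact: measurable_phase.
Qed.

Lemma normc_tfshift l f x : normc (tfshift l f x) = normc (f (tshift l x)).
Proof. by rewrite tfshiftE normcM normc_cis mul1r. Qed.

Lemma square_integrable_tfshift l f : square_integrable f ->
  square_integrable (tfshift l f).
Proof.
move=> /square_integrableE[mf foo]; apply/square_integrableE; split.
  exact: complex_measurable_tfshift.
rewrite (_ : L2mass _ = L2mass f)// -(L2mass_shift (fun i => usubmx l i 0) mf).
by apply: eq_integral => x _; rewrite normc_tfshift.
Qed.

Lemma tfshift_ae l f g : ae_eq leb setT f g -> ae_eq leb setT (tfshift l f) (tfshift l g).
Proof.
move=> /(ae_eq_shift (fun i => usubmx l i 0)); apply: filterS => x h _.
by rewrite !tfshiftE; congr (_ * _); exact: h.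
Qed.

Definition L2shift l u : L2 := L2class (square_integrable_tfshift l (L2space_square u)).

Lemma L2shift_ae l u : ae_eq leb setT (L2shift l u) (tfshift l u).
Proof. exact: L2class_ae. Qed.

Lemma L2inner_tfshift l f g : complex_measurable f -> complex_measurable g ->
  L2inner (tfshift l f) (tfshift l g) = L2inner f g.
Proof.
move=> mf mg; rewrite !L2innerE.
have mfg : complex_measurable (fun x => f x * conjc (g x)).
  by apply: complex_measurableM => //; exact: complex_measurableJ.
rewrite -(complex_integral_shift (fun i => usubmx l i 0) mfg); congr complex_integral.
apply/funext => x; rewrite !tfshiftE rmorphM /= mulrACA.
by rewrite [X in X * _](cisM_conj _) mul1r.
Qed.

(** The phase that arises when the modulation of [l] is moved past the translation of [m]. *)
Definition chi l m : C := cis (2 * pi * \sum_(i < d) dsubmx l i 0 * usubmx m i 0).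

Lemma tfshift_mul l m f x : tfshift l (tfshift m f) x = chi l m * tfshift (l + m) f x.
Proof.
have e : tshift m (tshift l x) = tshift (l + m) x.
  by apply: eq_from_tnth => i; rewrite !tnth_mktuple !mxE opprD addrA.
rewrite !tfshiftE e !mulrA -!cisD; congr (cis _ * _).
rewrite /phase -mulrDr -!mulrDr -!big_split /=; congr (_ * _).
apply: eq_bigr => i _; rewrite -e !tnth_mktuple !mxE; ring.
Qed.

Lemma L2shift_rep : projective_rep (@L2ip R d) L2shift.
Proof.
have lin l (a : C) u v : L2shift l (a *: u + v) = a *: L2shift l u + L2shift l v.
  apply: L2space_eq.
  have h1 : ae_eq leb setT (a *: u + v : L2) (fun x => a * u x + v x).
    have := L2add_ae (a *: u) v; have := L2scale_ae a u.
    by apply: filterS2 => x k1 k2 _; rewrite k2// k1.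
  have h2 := tfshift_ae l h1.
  have h3 : ae_eq leb setT (a *: L2shift l u + L2shift l v : L2)
      (fun x => a * tfshift l u x + tfshift l v x).
    have k1 := L2add_ae (a *: L2shift l u) (L2shift l v).
    have k2 := L2scale_ae a (L2shift l u).
    have k3 := L2shift_ae l u; have k4 := L2shift_ae l v.
    apply: (filterS3 _ _ k1 k2) (filterI k3 k4) => x j1 j2 [j3 j4] _.
    by rewrite j1// j2// j3// j4.
  apply: (filterS3 _ _ (L2shift_ae l (a *: u + v)) h2 h3) => x k1 k2 k3 _.
  rewrite k1// k2// k3// !tfshiftE mulrDr; congr (_ + _).
  by rewrite mulrCA.
have isom l u v : L2ip (L2shift l u) (L2shift l v) = L2ip u v.
  rewrite [RHS]/L2ip -(L2inner_tfshift l (L2space_measurable u) (L2space_measurable v)).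
  apply: L2inner_ae; try exact: L2space_measurable; try exact: L2shift_ae.
    exact/complex_measurable_tfshift/L2space_measurable.
  exact/complex_measurable_tfshift/L2space_measurable.
have id0 u : L2shift 0 u = u.
  apply: L2space_eq; apply: filterS (L2shift_ae 0 u) => x h _; rewrite h//.
  have e : tshift 0 x = x by apply: eq_from_tnth => i; rewrite tnth_mktuple !mxE subr0.
  rewrite tfshiftE e /phase big1 ?mulr0 ?cis0 ?mul1r// => i _.
  by rewrite !mxE mul0r.
have mul l m u : L2shift l (L2shift m u) = chi l m *: L2shift (l + m) u.
  apply: L2space_eq.
  have h1 := tfshift_ae l (L2shift_ae m u).
  have h2 := L2scale_ae (chi l m) (L2shift (l + m) u).
  have h3 := L2shift_ae l (L2shift m u); have h4 := L2shift_ae (l + m) u.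
  apply: (filterS3 _ _ h1 h2) (filterI h3 h4) => x j1 j2 [j3 j4] _.
  by rewrite j3// j1// j2// j4// tfshift_mul.
split; [exact: lin|exact: isom|exact: id0|exists chi; split => [l m|]; last exact: mul].
exact: cisM_conj.
Qed.

End time_frequency_shifts.

Section trigonometric_bounds.
Context {R : realType}.
Implicit Type t : R.

Lemma MVT_bound (f df : R -> R) t : 0 <= t -> (forall x : R, is_derive x (1 : R) f (df x)) ->
  exists2 c, 0 <= c <= t & f t - f 0 = df c * t.
Proof.
move=> t0 fd; have [|c ct e] := @MVT_segment R f df 0 t t0 (fun x _ => fd x).
  apply: continuous_subspaceT => x; apply: differentiable_continuous.
  by apply/derivable1_diffP; have [] := fd x.
by exists c; [move: ct; rewrite in_itv|rewrite e subr0].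
Qed.

Lemma normr_sin_le t : `|sin t| <= `|t|.
Proof.
wlog t0 : t / 0 <= t.
  move=> h; have [|t0] := leP 0 t; first exact: h.
  by have := h (- t); rewrite sinN !normrN; apply; rewrite oppr_ge0 ltW.
have [c _] := MVT_bound t0 (@is_derive_sin R); rewrite sin0 subr0 => ->.
rewrite normrM ler_piMl// ler_norml; apply/andP; split.
  by rewrite cos_geN1.
by rewrite cos_le1.
Qed.

Lemma normr_cosB1_le t : `|cos t - 1| <= `|t|.
Proof.
wlog t0 : t / 0 <= t.
  move=> h; have [|t0] := leP 0 t; first exact: h.
  by have := h (- t); rewrite cosN normrN; apply; rewrite oppr_ge0 ltW.
have [c _] := MVT_bound t0 (@is_derive_cos R); rewrite cos0 => ->.
rewrite normrM ler_piMl// normrN ler_norml; apply/andP; split.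
  by rewrite sin_geN1.
by rewrite sin_le1.
Qed.

Lemma normc_cisB1_le t : normc (cis t - 1) <= 2 * `|t|.
Proof.
rewrite -ler_sqr ?nnegrE ?normc_ge0 ?mulr_ge0// normc_sqrE /= subr0.
have := normr_sin_le t; have := normr_cosB1_le t.
rewrite -[(cos t - 1) ^+ 2]real_normK ?num_real// -[sin t ^+ 2]real_normK ?num_real//.
move: (normr_ge0 (cos t - 1)) (normr_ge0 (sin t)).
move: `|_| `|sin t| `|t| => a b c; nra.
Qed.

(** Between 0 and a phase of size at most 1/2 the cosine is at least 1/2, so the mean value theorem
    bounds the sine from below. This is what recovers [|x_j|] from modulation differences. *)
Lemma normc_cisB1_ge t : `|t| <= 2^-1 -> `|t| / 2 <= normc (cis t - 1).
Proof.
move=> th; apply: (@le_trans _ _ `|sin t|); last first.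
  by apply: le_trans (Im_le_normc _); rewrite /= subr0.
wlog t0 : t th / 0 <= t.
  move=> h; have [|t0] := leP 0 t; first exact: h.
  by have := h (- t); rewrite sinN !normrN; apply => //; rewrite oppr_ge0 ltW.
have [c /andP[c0 ct]] := MVT_bound t0 (@is_derive_sin R); rewrite sin0 subr0 => ->.
rewrite normrM mulrC ler_wpM2r//; apply: le_trans (ler_norm _).
have := normr_cosB1_le c; rewrite ler_norml (ger0_norm c0) => /andP[h _].
by move: th; rewrite ger0_norm// => th; lra.
Qed.

End trigonometric_bounds.

(** * Bessel bounds and weights *)

Section gabor_dictionary.
Context {R : realType} {d : nat}.
Local Notation C := R[i].
Local Notation E := (euclid R d).
Local Notation leb := (@lebesgue_tuple R d).
Local Notation L2 := (L2space R d).
Local Notation G := ('cV[R]_(d + d)).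
Local Notation ip := (@L2ip R d).
Local Notation nrm := (ipnorm ip).
Local Notation P := (@L2shift R d).
Variable L : set G.
Implicit Types (f g h u : L2) (l : G).

Let ipP := @L2ip_inner R d.
Let repP := @L2shift_rep R d.

Lemma analysisE g f l : analysis g f l = ip f (P l g).
Proof.
apply: L2inner_ae; try exact: L2space_measurable; try exact: ae_eq_refl.
  exact/complex_measurable_tfshift/L2space_measurable.
exact/ae_eq_sym/L2shift_ae.
Qed.

Lemma fsets_finite_in (B : set G) : fsets L B ->
  exists2 s, finite_in L s & B = [set` s].
Proof.
move=> [/finite_seqP[s ->] sL]; exists (undup s).
  by split; [exact: undup_uniq|move=> l; rewrite mem_undup => /sL].
by apply/seteqP; split => l /=; rewrite mem_undup.
Qed.

Lemma finite_in_fsets s : finite_in L s -> fsets L [set` s].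
Proof. by move=> [_ sL]; split; [exact: finite_seq|move=> l /sL]. Qed.

Lemma ell2norm_le (c : G -> C) (K : R) : 0 <= K ->
  (ell2norm L c <= K%:E)%E <-> forall B, finite_in L B -> l2 c B <= K.
Proof.
move=> K0; rewrite /ell2norm; set S := esum _ _.
have S0 : (0 <= S)%E by apply: esum_ge0 => l _; rewrite lee_fin sqr_ge0.
have -> : (S `^ 2^-1 <= K%:E)%E = (S <= (K ^+ 2)%:E)%E.
  move: S0; case: S => [s||]//.
    rewrite lee_fin => s0; rewrite poweR_EFin !lee_fin powR12_sqrt//.
    by rewrite -[in RHS](sqr_sqrtr s0) ler_sqr ?nnegrE ?sqrtr_ge0.
  by rewrite poweRyr ?invr_neq0// !leye_eq.
split=> [SK B fB|h].
  rewrite -ler_sqr ?nnegrE ?l2_ge0// sqr_l2 -lee_fin; apply: le_trans SK.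
  apply: esum_ge; exists [set` B]; first exact: finite_in_fsets.
  by rewrite -fsbig_seq ?sumEFin//; case: fB.
apply: ge_ereal_sup => _ [B /fsets_finite_in[s fs ->]] <-.
rewrite -fsbig_seq ?sumEFin; last by case: fs.
by rewrite lee_fin -sqr_l2 ler_sqr ?nnegrE ?l2_ge0// h.
Qed.

Lemma analysis_boundP g (M : R) : analysis_bound L g M <-> bess ip P L M g.
Proof.
rewrite (bess_analysis P L ipP); split=> -[M0 hM]; split=> // f.
  move=> B fB; have := hM f; rewrite L2norm_nrm -EFinM.
  move/(ell2norm_le _ (mulr_ge0 M0 (ipnorm_ge0 _ _)))/(_ _ fB).
  rewrite (_ : l2 _ B = l2 (fun l => ip f (P l g)) B)//.
  by congr Num.sqrt; apply: eq_bigr => l _; rewrite analysisE.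
rewrite L2norm_nrm -EFinM; apply/ell2norm_le => [|B fB].
  by rewrite mulr_ge0// ipnorm_ge0.
rewrite (_ : l2 _ B = l2 (fun l => ip f (P l g)) B) ?hM//.
by congr Num.sqrt; apply: eq_bigr => l _; rewrite analysisE.
Qed.

Lemma besselP g : bessel L g <-> exists M, bess ip P L M g.
Proof.
by split=> -[M]; [move/analysis_boundP|move/analysis_boundP => h]; exists M.
Qed.

(** The infimum is attained, because each inequality on a finite set is closed in the constant. *)
Lemma analysis_opnorm_bess g : bessel L g -> bess ip P L (analysis_opnorm L g) g.
Proof.
move=> ne; have M0 : 0 <= analysis_opnorm L g.
  by apply: lb_le_inf => // M [].
split=> // c B fB; apply: (@le_small _ _ _ (l2 c B)); first exact: l2_ge0.
move=> e e0; have hi : has_inf (analysis_bound L g).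
  by split => //; exists 0 => M [].
have [M /analysis_boundP[_ hM] Me] := inf_adherent e0 hi.
apply: le_trans (hM c B fB) _; rewrite [_ * e]mulrC -mulrDl ler_wpM2r ?l2_ge0//.
exact: ltW.
Qed.

Lemma analysis_opnorm_le g M : bess ip P L M g -> analysis_opnorm L g <= M.
Proof.
by move=> /analysis_boundP h; apply: ge_inf => //; exists 0 => N [].
Qed.

Lemma frame_operatorE g h f : frame_operator L g h f = frame ip P L g h f.
Proof.
rewrite /frame_operator /synthesis /frame; congr xget.
have nrmB (s : seq G) u : L2norm (fun x => \sum_(l <- s) analysis g f l * tfshift l h x - u x)%R =
    (nrm (\sum_(l <- s) ip f (P l g) *: P l h - u))%:E.
  rewrite -L2norm_nrm; apply: L2norm_ae.
  - apply: complex_measurableB; last exact: L2space_measurable.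
    elim: s => [|l s IH].
      rewrite (_ : (fun _ => _) = fun=> 0); first by split; exact: measurable_cst.
      by apply/funext => x; rewrite big_nil.
    rewrite (_ : (fun _ => _) = fun x => analysis g f l * tfshift l h x +
      \sum_(l <- s) analysis g f l * tfshift l h x); last first.
      by apply/funext => x; rewrite big_cons.
    apply: complex_measurableD => //; apply: complex_measurableZ.
    exact/complex_measurable_tfshift/L2space_measurable.
  - exact: L2space_measurable.
  - apply: ae_eq_sym.
    have h1 := L2sub_ae (\sum_(l <- s) ip f (P l g) *: P l h) u.
    have h2 := @L2sum_ae R d _ s (fun l => ip f (P l g) *: P l h)
      (fun l x => analysis g f l * tfshift l h x).
    apply: filterS2 h1 (h2 _) => [x k1 k2 _|l]; first by rewrite k1// k2.
    have k1 := L2scale_ae (ip f (P l g)) (P l h); have k2 := L2shift_ae l h.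
    by apply: filterS2 k1 k2 => x j1 j2 _; rewrite j1// j2// analysisE.
apply/seteqP; split=> u /= su e e0.
  have [A /fsets_finite_in[s fs ->] hA] := su e e0; exists s => // B fB sB.
  have := hA [set` B] (finite_in_fsets fB) sB.
  rewrite -lee_fin -nrmB => /ltW; congr (L2norm _ <= _)%E.
  by apply/funext => x; rewrite -fsbig_seq//; case: fB.
(* [ssum] uses a non-strict inequality and [synthesis] a strict one. *)
have e2 : 0 < e / 2 by rewrite divr_gt0.
have [s fs hs] := su _ e2; exists [set` s]; first exact: finite_in_fsets.
move=> _ /fsets_finite_in[B fB ->] sB.
rewrite (_ : (fun x => _) = fun x => \sum_(l <- B) analysis g f l * tfshift l h x - (u : L2) x).
  rewrite nrmB lte_fin; apply: le_lt_trans (hs B fB sB) _.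
  by rewrite ltr_pdivrMr// ltr_pMr// ltr1n.
by apply/funext => x; rewrite -fsbig_seq//; case: fB.
Qed.

End gabor_dictionary.

Section weights.
Context {R : realType} {d : nat}.
Local Notation C := R[i].
Local Notation E := (euclid R d).
Local Notation leb := (@lebesgue_tuple R d).
Local Notation L2 := (L2space R d).
Local Notation ip := (@L2ip R d).
Local Notation nrm := (ipnorm ip).
Local Notation P := (@L2shift R d).
Implicit Types (u v : L2) (f g : E -> C).

Let ipP := @L2ip_inner R d.

(* [P (freq j t)] is multiplication by [exp (2 i pi t x_j)]. *)
Definition freq (j : 'I_d) (t : R) : 'cV[R]_(d + d) := col_mx 0 (t *: delta_mx j 0).

Lemma L2shift_freq j t u : ae_eq leb setT (P (freq j t) u)
  (fun x => cis (2 * pi * t * tnth x j) * u x).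
Proof.
apply: filterS (L2shift_ae (freq j t) u) => x h _; rewrite h// tfshiftE.
have -> : tshift (freq j t) x = x.
  by apply: eq_from_tnth => i; rewrite tnth_mktuple /freq col_mxKu mxE subr0.
congr (cis _ * _); rewrite /phase /freq col_mxKd (bigD1 j)//= big1 ?addr0.
  by rewrite !mxE !eqxx mulr1 -!mulrA.
by move=> i ij; rewrite !mxE (negbTE ij) mulr0 mul0r.
Qed.

Lemma le_nrm u v f g : ae_eq leb setT u f -> ae_eq leb setT v g ->
  complex_measurable f -> complex_measurable g ->
  (forall x, normc (f x) <= normc (g x)) -> nrm u <= nrm v.
Proof.
move=> uf vg mf mg fg; rewrite (nrm_le (ipnorm_ge0 _ _) mf uf) (nrmE mg vg).
exact: le_L2mass.
Qed.

Lemma weight_ge1 (x : E) : 1 <= weight x.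
Proof. by rewrite lerDl sqrtr_ge0. Qed.

Lemma normr_tnth_le_weight (x : E) j : `|tnth x j| <= weight x.
Proof.
apply: (@le_trans _ _ (Num.sqrt (\sum_(i < d) tnth x i ^+ 2))); last by rewrite lerDr.
rewrite -sqrtr_sqr ler_wsqrtr// (bigD1 j)//= lerDl sumr_ge0// => i _.
exact: sqr_ge0.
Qed.

Lemma sqr_weight_le (x : E) : weight x ^+ 2 <= 2 + 2 * \sum_(i < d) tnth x i ^+ 2.
Proof.
have s0 : 0 <= \sum_(i < d) tnth x i ^+ 2 by apply: sumr_ge0 => i _; exact: sqr_ge0.
rewrite /weight -[in leRHS](sqr_sqrtr s0); move: (Num.sqrt _) => s.
by have := sqr_ge0 (1 - s); nra.
Qed.

Lemma measurable_weight : measurable_fun setT (@weight R d).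
Proof.
apply: measurable_funD => //; apply: (measurableT_comp (f := @Num.sqrt R)).
  by apply: continuous_measurable_fun; exact: sqrt_continuous.
by apply: measurable_sum => i; apply: measurable_funX; exact: measurable_tnth.
Qed.

Lemma complex_measurable_real (k : E -> R) : measurable_fun setT k ->
  complex_measurable (fun x => (k x)%:C).
Proof. by move=> mk; split => //=; exact: measurable_cst. Qed.

Lemma complex_measurable_weighted f : complex_measurable f ->
  complex_measurable (weighted f).
Proof.
move=> mf; apply: complex_measurableM => //; apply: complex_measurable_real.
exact: measurable_weight.
Qed.

Lemma normc_weighted f x : normc (weighted f x) = weight x * normc (f x).
Proof. by rewrite /weighted normcM normc_real ger0_norm// (le_trans _ (weight_ge1 x)). Qed.

Lemma weighted_nrm u (su : square_integrable (weighted u)) :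
  fine (L2norm (weighted u)) = nrm (L2class su).
Proof.
have mw := complex_measurable_weighted (L2space_measurable u).
rewrite -(L2norm_ae (L2space_measurable (L2class su)) mw); last exact: L2class_ae.
by rewrite L2norm_nrm.
Qed.

Lemma nrm_le_weighted u : square_integrable (weighted u) ->
  nrm u <= fine (L2norm (weighted u)).
Proof.
move=> su; rewrite (weighted_nrm su).
apply: (le_nrm (ae_eq_refl _ _ _) (L2class_ae su)) => [||x].
- exact: L2space_measurable.
- by case: su.
- by rewrite normc_weighted ler_peMl ?normc_ge0 ?weight_ge1.
Qed.

Lemma complex_measurable_cis_freq (c : R) j :
  complex_measurable (fun x : E => cis (c * tnth x j)).
Proof.
apply: complex_measurable_cis; apply: measurable_funM => //.
exact: measurable_tnth.
Qed.

Lemma freq_sub_ae j t u : ae_eq leb setT (P (freq j t) u - u : L2)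
  (fun x => (cis (2 * pi * t * tnth x j) - 1) * u x).
Proof.
have := L2sub_ae (P (freq j t) u) u; have := L2shift_freq j t u.
by apply: filterS2 => x h1 h2 _; rewrite h2// h1// mulrBl mul1r.
Qed.

Lemma complex_measurable_freq_sub j t u :
  complex_measurable (fun x => (cis (2 * pi * t * tnth x j) - 1) * u x).
Proof.
apply: complex_measurableM; last exact: L2space_measurable.
apply: complex_measurableB; first exact: complex_measurable_cis_freq.
by split; exact: measurable_cst.
Qed.

(** The constant is the 2 of [normc_cisB1_le] times the [2 * pi] of the phase, and [|x_j|] is at
    most the weight. *)
Lemma freq_lipschitz j t u : square_integrable (weighted u) -> 0 < t ->
  nrm (P (freq j t) u - u) <= 4 * pi * fine (L2norm (weighted u)) * t.
Proof.
move=> su t0; have p0 := pi_ge0 R.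
rewrite (weighted_nrm su) mulrAC.
have c0 : 0 <= 4 * pi * t by rewrite !mulr_ge0// ltW.
rewrite -[4 * pi * t]ger0_norm// -normc_real -(ipnormZ ipP).
have v_ae : ae_eq leb setT ((4 * pi * t)%:C *: L2class su : L2)
    (fun x => (4 * pi * t)%:C * weighted u x).
  have := L2scale_ae (4 * pi * t)%:C (L2class su); have := L2class_ae su.
  by apply: filterS2 => x h1 h2 _; rewrite h2// h1.
apply: (le_nrm (freq_sub_ae j t u) v_ae) => [||x].
- exact: complex_measurable_freq_sub.
- by apply: complex_measurableZ; have [] := su.
rewrite [leRHS]normcM normc_weighted normcM normc_real (ger0_norm c0) mulrA ler_wpM2r ?normc_ge0//.
apply: le_trans (normc_cisB1_le _) _; rewrite normrM ger0_norm ?mulr_ge0 ?(ltW t0)//.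
rewrite mulrA (_ : 2 * (2 * pi * t) = 4 * pi * t); last by ring.
by rewrite ler_wpM2l// normr_tnth_le_weight.
Qed.

(* On [|x_j| <= n] and for [t] of order [1 / n], multiplication by
   [exp (2 i pi t x_j) - 1] is comparable to multiplication by [t x_j]; then
   [n] tends to infinity. *)
Lemma moment_le u j (K : R) : 0 <= K ->
  (forall t, 0 < t -> nrm (P (freq j t) u - u) <= K * t) ->
  (\int[leb]_x (tnth x j ^+ 2 * normc (u x) ^+ 2)%:E <= (K ^+ 2)%:E)%E.
Proof.
move=> K0 hK; have pi0 := pi_gt0 R.
pose F n (x : E) : \bar R :=
  (((`|tnth x j| <= n%:R)%R)%:R * (tnth x j ^+ 2 * normc (u x) ^+ 2))%:E.
have F0 n x : (setT x -> 0 <= F n x)%E.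
  by move=> _; rewrite lee_fin mulr_ge0 ?ler0n// mulr_ge0 ?sqr_ge0.
have mx : measurable_fun setT (fun x : E => tnth x j) by exact: measurable_tnth.
have mF n : measurable_fun setT (F n).
  apply/measurable_EFinP; apply: measurable_funM; last first.
    apply: measurable_funM; first exact: measurable_funX.
    exact: measurable_normc_sqr (L2space_measurable u).
  rewrite (_ : (fun x => _) = \1_[set x : E | `|tnth x j| <= n%:R]).
    apply: measurable_indic; rewrite -[X in measurable X]setTI.
    apply: (measurable_fun_le (f := fun x : E => `|tnth x j|) (g := cst n%:R)) => //.
    exact: measurableT_comp.
  apply/funext => x; rewrite indicE; congr ((nat_of_bool _)%:R).
  by apply/idP/idP; rewrite inE.
have bound n : (\int[leb]_x F n x <= (K ^+ 2)%:E)%E.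
  (* With this [t] the phase [2 * pi * t * x_j] stays within 1/2 where [|x_j| <= n], as
     [normc_cisB1_ge] requires; the [+ 1] keeps [t] positive for [n = 0]. *)
  pose t : R := (4 * pi * (n%:R + 1))^-1.
  have t0 : 0 < t by rewrite invr_gt0 !mulr_gt0// ltr_wpDl.
  have := hK t t0; rewrite (nrm_le _ (complex_measurable_freq_sub j t u) (freq_sub_ae j t u)); last first.
    by rewrite mulr_ge0// ltW.
  move=> h; have pt : 0 < (pi * t) ^+ 2 by rewrite exprn_gt0// mulr_gt0.
  have : (((pi * t) ^+ 2)%R%:E * (\int[leb]_x F n x) <= ((pi * t) ^+ 2)%R%:E * (K ^+ 2)%R%:E)%E.
    rewrite -(ge0_integralZl_EFin leb measurableT (F0 n) (mF n) (sqr_ge0 (pi * t))).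
    apply: (@le_trans _ _ ((K * t) ^+ 2)%:E); last first.
      rewrite -EFinM lee_fin [(K * t) ^+ 2]exprMn mulrC ler_wpM2r ?sqr_ge0//.
      rewrite ler_sqr ?nnegrE ?mulr_ge0 ?(ltW t0) ?(ltW pi0)// ler_peMl ?(ltW t0)//.
      by apply: le_trans (pi_ge2 R); rewrite ler1n.
    apply: le_trans h; apply: ge0_le_integral => //.
    - by move=> x _; apply: mule_ge0; [rewrite lee_fin sqr_ge0|exact: F0].
    - exact: measurable_funeM.
    - by apply: measurable_mass; exact: complex_measurable_freq_sub.
    move=> x _; rewrite /F -EFinM lee_fin normcM [in leRHS]exprMn.
    case: (leP `|tnth x j| n%:R) => xn; last by rewrite mulr0n mul0r mulr0 mulr_ge0 ?sqr_ge0.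
    rewrite mulr1n mul1r mulrA ler_wpM2r ?sqr_ge0// -exprMn.
    rewrite -[X in X ^+ 2 <= _]/(pi * t * tnth x j) -[leLHS]real_normK ?num_real//.
    rewrite ler_sqr ?nnegrE ?normc_ge0//.
    have e : `|2 * pi * t * tnth x j| / 2 = `|pi * t * tnth x j|.
      by rewrite -!mulrA normrM ger0_norm// mulrC mulKf.
    rewrite -e; apply: normc_cisB1_ge.
    have c0 : 0 <= 2 * pi * t by rewrite !mulr_ge0// ltW.
    rewrite normrM (ger0_norm c0).
    apply: (@le_trans _ _ (2 * pi * t * (n%:R + 1))).
      by rewrite ler_wpM2l// (le_trans xn)// lerDl.
    rewrite /t; have n1 : n%:R + 1 != 0 :> R by rewrite gt_eqF// ltr_wpDl.
    have p1 : pi != 0 :> R by rewrite gt_eqF.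
    rewrite (_ : 2 * pi * _ * _ = 2^-1)//; move: (@pi R) p1 => p p1.
    by field; rewrite n1 p1.
  by rewrite lee_pmul2l// lte_fin.
have FE x : limn_einf (F^~ x) = (tnth x j ^+ 2 * normc (u x) ^+ 2)%:E.
  apply: (cvg_limn_einf_sup _).1; apply: cvg_near_cst.
  exists (Num.bound `|tnth x j|) => // n /= hn.
  rewrite /F (_ : _ <= _ = true) ?mulr1n ?mul1r//.
  apply: le_trans (ltW (archi_boundP (normr_ge0 _))) _.
  by rewrite ler_nat.
under eq_integral do rewrite -FE.
apply: le_trans (fatou leb measurableT mF F0) _.
by apply: (@limn_einf_le _ _ _ 0) => m _; exact: bound.
Qed.

(** Integrating [weight^2 <= 2 + 2 * |x|^2] gives at most [2 * (d + 1) * K^2]: one [K^2] from the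
    norm and one from each second moment. As [2 * (d + 1) >= 1], using it instead of its root in the
    norm bound is harmless. *)
Lemma weighted_square_integrable u (K : R) : nrm u <= K ->
  (forall j t, 0 < t -> nrm (P (freq j t) u - u) <= K * t) ->
  square_integrable (weighted u) /\ fine (L2norm (weighted u)) <= 2 * (d%:R + 1) * K.
Proof.
move=> uK hK; have K0 : 0 <= K by apply: le_trans uK; exact: ipnorm_ge0.
have mw := complex_measurable_weighted (L2space_measurable u).
have mu := measurable_mass (L2space_measurable u).
have mj j : measurable_fun setT (fun x : E => (tnth x j ^+ 2 * normc (u x) ^+ 2)%:E).
  apply/measurable_EFinP; apply: measurable_funM.
    by apply: measurable_funX; exact: measurable_tnth.
  exact: measurable_normc_sqr (L2space_measurable u).
have j0 j (x : E) : (0 <= (tnth x j ^+ 2 * normc (u x) ^+ 2)%:E)%E.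
  by rewrite lee_fin mulr_ge0 ?sqr_ge0.
have D0 : 0 <= 2 * (d%:R + 1) * K by rewrite !mulr_ge0// addr_ge0.
have mass : (L2mass (weighted u) <= ((2 * (d%:R + 1) * K) ^+ 2)%:E)%E.
  apply: (@le_trans _ _ (\int[leb]_x (2%:E * ((normc (u x) ^+ 2)%:E +
      \sum_(j < d) (tnth x j ^+ 2 * normc (u x) ^+ 2)%:E)))%E).
    apply: ge0_le_integral => //.
    - by move=> x _; rewrite lee_fin sqr_ge0.
    - exact: measurable_mass.
    - by apply: measurable_funeM; apply: emeasurable_funD => //; exact: emeasurable_sum.
    move=> x _; rewrite sumEFin -EFinD -EFinM lee_fin normc_weighted exprMn -mulr_suml.
    rewrite -[X in X + _]mul1r -mulrDl mulrA ler_wpM2r ?sqr_ge0//.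
    by apply: le_trans (sqr_weight_le x) _; rewrite mulrDr mulr1.
  rewrite ge0_integralZl_EFin//; last 2 first.
  - by move=> x _; rewrite adde_ge0 ?lee_fin ?sqr_ge0// sume_ge0.
  - by apply: emeasurable_funD => //; exact: emeasurable_sum.
  rewrite ge0_integralD//; last 3 first.
  - by move=> x _; rewrite lee_fin sqr_ge0.
  - by move=> x _; rewrite sume_ge0.
  - exact: emeasurable_sum.
  rewrite ge0_integral_sum//.
  apply: (@le_trans _ _ (2%:E * ((K ^+ 2)%:E + \sum_(j < d) (K ^+ 2)%:E))%E).
    apply: lee_wpmul2l; first by rewrite lee_fin.
    apply: leeD; last by apply: lee_sum => j _; apply: moment_le => // t; exact: hK.
    rewrite -[leLHS]/(L2mass u) L2mass_nrm lee_fin ler_sqr ?nnegrE//.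
    exact: ipnorm_ge0.
  rewrite sumEFin -EFinD -EFinM lee_fin sumr_const card_ord -mulrS -[K ^+ 2 *+ _]mulr_natl.
  rewrite mulrA [leRHS]exprMn ler_wpM2r ?sqr_ge0// -addn1 natrD.
  have : 0 <= d%:R :> R by []. nra.
have sw : square_integrable (weighted u).
  by apply/square_integrableE; split => //; apply: le_lt_trans mass _; exact: ltry.
split => //; rewrite (weighted_nrm sw) (nrm_le D0 mw (L2class_ae sw)).
exact: mass.
Qed.

End weights.

(** * Density of smooth tensor products *)

Section schur_test.
Context {R : realType} {V : lmodType R[i]} {G : zmodType}.
Variables (ip : V -> V -> R[i]) (P : G -> V -> V) (L : set G).
Hypothesis ipP : inner_product ip.
Hypothesis repP : projective_rep ip P.
Hypothesis LN : forall l, L l -> L (- l).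
Hypothesis LD : forall l m, L l -> L m -> L (l + m).
Local Notation nrm := (ipnorm ip).

(** The squared norm of a sum is a quadratic form in the Gram matrix of the shifts, whose entries
    have modulus [a (l - m)]. Rows and columns thus sum to at most [K], and
    [2 |c_l c_m| <= |c_l|^2 + |c_m|^2] bounds the form by [K], hence the root. *)
Lemma schur_bess K u : 0 <= K ->
  (forall B, finite_in L B -> \sum_(l <- B) normc (ip (P l u) u) <= K) ->
  bess ip P L (Num.sqrt K) u.
Proof.
move=> K0 hK; split=> [|c B [uB LB]]; first exact: sqrtr_ge0.
have [chi [chi1 chiM]] := rep_mul repP.
pose a l := normc (ip (P l u) u).
have gram l m : normc (ip (P l u) (P m u)) = a (l - m).
  rewrite -(rep_ip repP (- m) (P l u)) !chiM addNr (rep0 repP).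
  rewrite (ipZl ipP) (ipZr ipP) !normcM normc_conj !(unimodular_normc (chi1 _ _)) !mul1r.
  by rewrite addrC.
have sumN m : L m -> \sum_(l <- B) a (l - m) <= K.
  move=> Lm; rewrite -(big_map (fun l => l - m) xpredT a); apply: hK; split.
    by rewrite map_inj_uniq//; exact: addIr.
  by move=> _ /mapP[l /LB Ll ->]; apply: LD => //; exact: LN.
have sumN' l : L l -> \sum_(m <- B) a (l - m) <= K.
  move=> Ll; rewrite -(big_map (fun m => l - m) xpredT a); apply: hK; split.
    by rewrite map_inj_uniq// => x y /addrI/oppr_inj.
  by move=> _ /mapP[m /LB Lm ->]; apply: LD => //; exact: LN.
rewrite -ler_sqr ?nnegrE ?mulr_ge0 ?ipnorm_ge0 ?l2_ge0 ?sqrtr_ge0//.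
rewrite exprMn (sqr_sqrtr K0) sqr_l2 (sqr_ipnorm ipP).
apply: le_trans (Re_le_normc _) _.
rewrite (ip_suml ipP); apply: le_trans (normc_sum _ _) _.
apply: (@le_trans _ _ (\sum_(l <- B) \sum_(m <- B)
    2^-1 * (normc (c l) ^+ 2 + normc (c m) ^+ 2) * a (l - m))).
  apply: ler_sum => l _; rewrite (ip_sumr ipP); apply: le_trans (normc_sum _ _) _.
  apply: ler_sum => m _; rewrite (ipZl ipP) (ipZr ipP) !normcM normc_conj mulrA gram.
  rewrite ler_wpM2r ?normc_ge0//.
  by have := sqr_ge0 (normc (c l) - normc (c m)); nra.
under eq_bigr do under eq_bigr do rewrite mulrDr mulrDl.
under eq_bigr do rewrite big_split /=.
rewrite big_split /= [X in _ + X]exchange_big /=.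
have half (F : G -> G -> R) : (forall l, L l -> \sum_(m <- B) F l m <= K) ->
    \sum_(l <- B) \sum_(m <- B) 2^-1 * normc (c l) ^+ 2 * F l m <=
    2^-1 * (K * \sum_(l <- B) normc (c l) ^+ 2).
  move=> hF; rewrite !mulr_sumr big_seq [leRHS]big_seq; apply: ler_sum => l /LB Ll.
  rewrite -mulr_sumr -mulrA [K * _]mulrC mulrA [leRHS]mulrA ler_wpM2l ?hF//.
  by rewrite mulr_ge0// sqr_ge0.
apply: le_trans (lerD (half (fun l m => a (l - m)) sumN') (half (fun m l => a (l - m)) sumN)) _.
by rewrite -mulrDl (_ : 2^-1 + 2^-1 = 1 :> R) ?mul1r//; field.
Qed.

End schur_test.

Section lattice_sums.
Context {R : realType}.

(** Telescoping: [1 / (1 + k^2) <= 2 / k - 2 / (k + 1)] for [k >= 1], with equality of the two sides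
    of the claim at [T = 0]. *)
Lemma sum_inv_sqr (T : nat) : \sum_(k < T.+1) (1 + k%:R ^+ 2)^-1 <= 3 - 2 / T.+1%:R :> R.
Proof.
elim: T => [|T IH]; first by rewrite big_ord1 expr0n addr0 invr1; lra.
rewrite big_ord_recr /=; apply: le_trans (lerD IH (lexx _)) _.
have t0 : 0 <= T%:R :> R by [].
rewrite -!natr1; move: (T%:R : R) t0 => t t0.
have a0 : 0 < 1 + (t + 1) ^+ 2 by rewrite ltr_wpDr// sqr_ge0.
have b0 : 0 < t + 1 by lra.
have c0 : 0 < t + 1 + 1 by lra.
suff : (1 + (t + 1) ^+ 2)^-1 <= 2 / (t + 1) - 2 / (t + 1 + 1) by lra.
have -> : 2 / (t + 1) - 2 / (t + 1 + 1) = 2 / ((t + 1) * (t + 1 + 1)).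
  by field; rewrite !gt_eqF.
rewrite ler_pdivlMr ?mulr_gt0// mulrC ler_pdivrMr//.
by nra.
Qed.

Definition decay n (v : 'I_n -> R) : R := \prod_i (1 + v i ^+ 2)^-1.

(** Sign and absolute value put the integer vectors with entries of size at most [T] into a finite
    type of functions, over which a sum of products factors. [inord] is faithful only under that
    bound. *)
Definition int_code T n (v : 'cV[int]_n) : {ffun 'I_n -> bool * 'I_T.+1} :=
  [ffun i => (v i 0 < 0, inord (absz (v i 0)))].

Lemma int_code_inj T n (v w : 'cV[int]_n) :
  (forall i, (absz (v i 0%R) <= T)%N) -> (forall i, (absz (w i 0%R) <= T)%N) ->
  int_code T v = int_code T w -> v = w.
Proof.
move=> vT wT vw; apply/matrixP => i j; rewrite ord1.
have := congr1 (fun f : {ffun 'I_n -> bool * 'I_T.+1} => f i) vw.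
rewrite !ffunE => -[s /(congr1 (@nat_of_ord _))]; rewrite !inordK ?ltnS// => a.
by rewrite [LHS]intEsign [RHS]intEsign s a.
Qed.

(** The sum over all codes factors by distributivity into one sum per coordinate. Each is at most 6,
    the bound 3 of [sum_inv_sqr] for either sign. *)
Lemma int_decay_sum n (s : seq 'cV[int]_n) : uniq s ->
  \sum_(v <- s) decay (fun i => (v i 0)%:~R) <= 6 ^+ n.
Proof.
move=> us; pose T := (\sum_(v <- s) \sum_i absz (v i 0%R))%N.
have sT v i : v \in s -> (absz (v i 0%R) <= T)%N.
  move=> vs; rewrite /T (big_rem v)//= (bigD1 i)//= -addnA.
  exact: leq_addr.
pose F (f : {ffun 'I_n -> bool * 'I_T.+1}) : R := \prod_i (1 + (f i).2%:R ^+ 2)^-1.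
have F0 f : 0 <= F f by apply: prodr_ge0 => i _; rewrite invr_ge0 addr_ge0// sqr_ge0.
have -> : \sum_(v <- s) decay (fun i => (v i 0)%:~R) = \sum_(f <- map (@int_code T n) s) F f.
  rewrite big_map big_seq [RHS]big_seq; apply: eq_bigr => v vs; apply: eq_bigr => i _.
  rewrite ffunE /= inordK ?ltnS ?sT// [v i 0 in LHS]intEsign.
  by rewrite rmorphM rmorphXn rmorphN1 exprMn sqrr_sign mul1r.
have um : uniq (map (@int_code T n) s).
  rewrite map_inj_in_uniq// => v w vs ws; apply: int_code_inj => i; exact: sT.
rewrite (big_uniq _ um) /=; apply: (@le_trans _ _ (\sum_f F f)).
  by rewrite [leRHS](bigID (mem (map (@int_code T n) s)))/= lerDl sumr_ge0.
rewrite -(bigA_distr_bigA (fun i (p : bool * 'I_T.+1) => (1 + p.2%:R ^+ 2)^-1 : R)).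
rewrite -[n in leRHS]card_ord -prodr_const; apply: ler_prod => i _.
rewrite sumr_ge0/=; last by move=> p _; rewrite invr_ge0 addr_ge0// sqr_ge0.
rewrite -(pair_big xpredT xpredT (fun (b : bool) (k : 'I_T.+1) => (1 + k%:R ^+ 2)^-1 : R)) /=.
rewrite big_bool /=; have := sum_inv_sqr T.
have : 0 <= 2 / T.+1%:R :> R by rewrite divr_ge0.
move: (\sum_(k < T.+1) _) (2 / _) => S e; lra.
Qed.

Lemma floor_decay (x : R) : (1 + x ^+ 2)^-1 <= 3 * (1 + (Num.floor x)%:~R ^+ 2)^-1.
Proof.
have := floor_le x; have := floorD1_gt x; rewrite intrD mulr1z.
move: ((Num.floor x)%:~R : R) => y h1 h2.
rewrite ler_pdivlMr; last by rewrite ltr_wpDr// sqr_ge0.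
rewrite mulrC ler_pdivrMr; last by rewrite ltr_wpDr// sqr_ge0.
have f1 : (x - y) ^+ 2 <= 1 by rewrite expr_le1// ?subr_ge0//; lra.
by have := sqr_ge0 (2 * x - y); nra.
Qed.

(* A lattice point [l = A z] is determined by its integer part [m] and by
   [z - floor (A^-1 m)], which takes finitely many values. *)
Lemma lattice_decay_sum n (L : set 'cV[R]_n) : is_lattice L ->
  exists2 K, 0 <= K & forall B, finite_in L B -> \sum_(l <- B) decay (fun i => l i 0) <= K.
Proof.
move=> [A uA ->]; pose A' := invmx A.
pose m (l : 'cV[R]_n) : 'cV[int]_n := \col_i Num.floor (l i 0).
pose mR (l : 'cV[R]_n) : 'cV[R]_n := map_mx intr (m l).
pose r (l : 'cV[R]_n) : 'cV[int]_n :=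
  \col_i (Num.floor ((A' *m l) i 0) - Num.floor ((A' *m mR l) i 0)).
pose rho := \sum_i \sum_j `|A' i j|.
have rho0 : 0 <= rho by apply: sumr_ge0 => i _; apply: sumr_ge0.
pose T := Num.bound (rho + 1).
(* The entries of [l - mR l] are fractional parts, so [A'] maps it to a vector with entries of size
   at most [rho]; taking the two floors costs at most 1 more. *)
have rT l i : (absz (r l i 0%R) <= T)%N.
  have h : `|(A' *m l) i 0 - (A' *m mR l) i 0| <= rho.
    have -> : (A' *m l) i 0 - (A' *m mR l) i 0 = (A' *m (l - mR l)) i 0.
      by rewrite mulmxBr !mxE.
    rewrite mxE; apply: le_trans (ler_norm_sum _ _ _) _.
    rewrite /rho [leRHS](bigD1 i)//=; apply: (@le_trans _ _ (\sum_j `|A' i j|)); last first.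
      by rewrite lerDl sumr_ge0// => k _; rewrite sumr_ge0.
    apply: ler_sum => j _; rewrite normrM ler_piMr// !mxE.
    have := floor_le (l j 0); have := floorD1_gt (l j 0); rewrite intrD mulr1z => h1 h2.
    by rewrite ger0_norm; lra.
  have : `|(r l i 0)%:~R| <= rho + 1 :> R.
    rewrite mxE intrB; have := floor_le ((A' *m l) i 0); have := floorD1_gt ((A' *m l) i 0).
    have := floor_le ((A' *m mR l) i 0); have := floorD1_gt ((A' *m mR l) i 0).
    rewrite !intrD !mulr1z; move: h; rewrite !ler_norml => /andP[? ?] ? ? ? ?.
    by apply/andP; split; lra.
  rewrite -intr_norm => h'.
  have := le_lt_trans h' (archi_boundP (addr_ge0 rho0 ler01)); rewrite -/T.
  by rewrite -abszE -pmulrn ltr_nat => /ltnW.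
(* [3 ^+ n] pays for rounding by [floor_decay], [6 ^+ n] sums over integer vectors, and the cardinal
   counts the possible codes of [r l]. *)
exists (3 ^+ n * 6 ^+ n * #|{ffun 'I_n -> bool * 'I_T.+1}|%:R).
  by rewrite !mulr_ge0 ?exprn_ge0.
move=> B [uB LB].
have inj l l' : l \in B -> l' \in B -> int_code T (r l) = int_code T (r l') ->
    m l = m l' -> l = l'.
  move=> /LB[z _ zl] /LB[z' _ zl'] /(int_code_inj (rT l) (rT l')) rr mm.
  suff zz : z = z' by rewrite -zl -zl' zz.
  apply/matrixP => i j; rewrite ord1; have := congr1 (fun v : 'cV_n => v i 0) rr.
  rewrite [r l i 0]mxE [r l' i 0]mxE /mR mm => /addIr; rewrite -zl -zl' !mulKmx//.
  by rewrite !mxE !intrKfloor.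
apply: (@le_trans _ _ (\sum_(l <- B) 3 ^+ n * decay (fun i => (m l i 0)%:~R))).
  apply: ler_sum => l _; rewrite -[n in 3 ^+ n]card_ord -prodr_const -big_split /=.
  apply: ler_prod => i _; rewrite invr_ge0 addr_ge0 ?sqr_ge0//= mxE.
  exact: floor_decay.
rewrite -mulr_sumr -mulrA ler_wpM2l ?exprn_ge0//.
(* On lattice points with the same code, [m] is injective by [inj], so each fibre sums over distinct
   integer vectors. *)
rewrite (partition_big (fun l => int_code T (r l)) xpredT)//=.
apply: (@le_trans _ _ (\sum_(f : {ffun 'I_n -> bool * 'I_T.+1}) 6 ^+ n)); last first.
  by rewrite sumr_const mulr_natr.
apply: ler_sum => f _.
rewrite -big_filter -(big_map m xpredT (fun v => decay (fun i => (v i 0)%:~R))).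
apply: int_decay_sum; rewrite map_inj_in_uniq ?filter_uniq//.
move=> l l'; rewrite !mem_filter => /andP[/eqP e lB] /andP[/eqP e' lB'].
by apply: inj => //; rewrite e e'.
Qed.

Lemma latticeN n (L : set 'cV[R]_n) l : is_lattice L -> L l -> L (- l).
Proof.
move=> [A _ ->] [z _ <-]; exists (- z) => //.
by rewrite (_ : map_mx _ _ = - map_mx intr z) ?mulmxN//; apply/matrixP => i j; rewrite !mxE rmorphN.
Qed.

Lemma latticeD n (L : set 'cV[R]_n) l l' : is_lattice L -> L l -> L l' -> L (l + l').
Proof.
move=> [A _ ->] [z _ <-] [z' _ <-]; exists (z + z') => //.
rewrite (_ : map_mx _ _ = map_mx intr z + map_mx intr z') ?mulmxDr//.
by apply/matrixP => i j; rewrite !mxE rmorphD.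
Qed.

End lattice_sums.

(** * Test functions with controlled second differences *)

Section c11_functions.
Context {R : realType}.
Implicit Types (f g : R -> R) (x s t D C : R).

(* Locally C^{1,1}, in terms of first and second differences. *)
Definition c11 f := forall D, exists2 C, 0 <= C & forall x s, `|x| <= D -> `|s| <= 1 ->
  [/\ `|f x| <= C, `|f (x + s) - f x| <= C * `|s| &
      `|f (x + 2 * s) - 2 * f (x + s) + f x| <= C * s ^+ 2].

Lemma c11_cst (c : R) : c11 (fun=> c).
Proof.
move=> D; exists `|c| => // x s _ _; rewrite subrr normr0 mulr_ge0//; split => //.
rewrite (_ : c - 2 * c + c = 0); last by ring.
by rewrite normr0 mulr_ge0// sqr_ge0.
Qed.

Lemma c11D f g : c11 f -> c11 g -> c11 (fun x => f x + g x).
Proof.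
move=> cf cg D; have [A A0 hA] := cf D; have [B B0 hB] := cg D.
exists (A + B) => [|x s xD s1]; first exact: addr_ge0.
have [a1 a2 a3] := hA x s xD s1; have [b1 b2 b3] := hB x s xD s1.
rewrite ![(A + B) * _]mulrDl; split.
- by rewrite (le_trans (ler_normD _ _))// lerD.
- by rewrite opprD addrACA (le_trans (ler_normD _ _))// lerD.
rewrite (_ : _ - _ + (f x + g x) = f (x + 2 * s) - 2 * f (x + s) + f x +
  (g (x + 2 * s) - 2 * g (x + s) + g x)); last by ring.
by rewrite (le_trans (ler_normD _ _))// lerD.
Qed.

(** Discrete Leibniz rule. [4 = 1 + 2 + 1] counts its terms for the second difference, and [D + 2]
    leaves room for the point [x + 2 * s]. *)
Lemma c11M f g : c11 f -> c11 g -> c11 (fun x => f x * g x).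
Proof.
move=> cf cg D; have [A A0 hA] := cf (D + 2); have [B B0 hB] := cg (D + 2).
exists (4 * (A * B)) => [|x s xD s1]; first by rewrite !mulr_ge0.
have AB0 : 0 <= A * B by exact: mulr_ge0.
have near y : `|y - x| <= 2 -> `|y| <= D + 2.
  by move=> yx; rewrite -(subrK x y) (le_trans (ler_normD _ _))// addrC lerD.
have x0 : `|x| <= D + 2 by apply: near; rewrite subrr normr0.
have x1 : `|x + s| <= D + 2 by apply: near; rewrite addrAC subrr add0r (le_trans s1)// ler1n.
have x2 : `|x + 2 * s| <= D + 2.
  by apply: near; rewrite addrAC subrr add0r normrM ger0_norm// ler_piMr.
have [f0 f01 f02] := hA x s x0 s1; have [g0 g01 g02] := hB x s x0 s1.
have [f1 f12 _] := hA (x + s) s x1 s1.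
have [f2 _ _] := hA (x + 2 * s) s x2 s1.
rewrite -addrA (_ : s + s = 2 * s) in f12; last by ring.
split.
- by rewrite normrM; apply: (@le_trans _ _ (A * B)); [exact: ler_pM|lra].
- rewrite (_ : _ - _ = f (x + s) * (g (x + s) - g x) + (f (x + s) - f x) * g x); last by ring.
  apply: le_trans (ler_normD _ _) _; rewrite !normrM.
  apply: (@le_trans _ _ (A * (B * `|s|) + A * `|s| * B)).
    by rewrite lerD// ler_pM.
  have : 0 <= A * B * `|s| by rewrite mulr_ge0.
  by lra.
rewrite (_ : _ + f x * g x = f (x + 2 * s) * (g (x + 2 * s) - 2 * g (x + s) + g x) +
  (2 * ((f (x + 2 * s) - f (x + s)) * (g (x + s) - g x)) +
  (f (x + 2 * s) - 2 * f (x + s) + f x) * g x)); last by ring.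
apply: le_trans (ler_normD _ _) _; apply: le_trans (lerD (lexx _) (ler_normD _ _)) _.
rewrite !normrM (ger0_norm (ler0n _ 2)).
apply: (@le_trans _ _ (A * (B * s ^+ 2) + (2 * (A * `|s| * (B * `|s|)) + A * s ^+ 2 * B))).
  by rewrite lerD ?ler_pM// lerD ?ler_pM// ?mulr_ge0// ler_pM.
rewrite -[s ^+ 2]real_normK ?num_real//; have := normr_ge0 s; move: `|s| => y y0.
by rewrite le_eqVlt; apply/orP; left; apply/eqP; ring.
Qed.

Lemma c11X f n : c11 f -> c11 (fun x => f x ^+ n).
Proof.
move=> cf; elim: n => [|n IH]; first exact: (c11_cst 1).
rewrite (_ : (fun x => _) = fun x => f x * f x ^+ n); first exact: c11M.
by apply/funext => x; rewrite exprS.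
Qed.

Definition ramp (t : R) : R := Num.max t 0 ^+ 2.

Lemma ramp_ge0 t : 0 <= ramp t.
Proof. exact: sqr_ge0. Qed.

Lemma ramp_le0 t : t <= 0 -> ramp t = 0.
Proof. by move=> t0; rewrite /ramp max_r// expr0n. Qed.

Lemma ramp_gt0 t : 0 < t -> ramp t = t ^+ 2.
Proof. by move=> t0; rewrite /ramp max_l// ltW. Qed.

(** According to the signs at the three points, the second difference is [0], [2 * s^2], [y^2] or
    [2 * s^2 - y^2], where [y] is one of the end points and [|y| <= |s|] because the sign changes
    there. *)
Lemma ramp_diff2 t s : `|ramp (t + 2 * s) - 2 * ramp (t + s) + ramp t| <= 2 * s ^+ 2.
Proof.
have sq (y z : R) : - z <= y -> y <= z -> y ^+ 2 <= z ^+ 2.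
  by move=> h1 h2; rewrite -subr_ge0 subr_sqr; apply: mulr_ge0; lra.
have sN : (- s) ^+ 2 = s ^+ 2 by rewrite sqrrN.
have s0 := sqr_ge0 s.
have rampE x : x <= 0 /\ ramp x = 0 \/ 0 < x /\ ramp x = x ^+ 2.
  by have [a|a] := leP x 0; [left; rewrite ramp_le0|right; rewrite ramp_gt0].
rewrite ler_norml; have [[a ->]|[a ->]] := rampE t;
  have [[b ->]|[b ->]] := rampE (t + s);
  have [[c ->]|[c ->]] := rampE (t + 2 * s); try (exfalso; lra).
- by apply/andP; split; lra.
- have h : (t + 2 * s) ^+ 2 <= s ^+ 2 by apply: sq; lra.
  by have := sqr_ge0 (t + 2 * s); move=> *; apply/andP; split; lra.
- have h : t ^+ 2 <= s ^+ 2 by apply: sq; lra.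
  by have := sqr_ge0 t; move=> *; apply/andP; split; lra.
- have h : t ^+ 2 <= (- s) ^+ 2 by apply: sq; lra.
  by have := sqr_ge0 t; move=> *; apply/andP; split; lra.
- have h : (t + 2 * s) ^+ 2 <= (- s) ^+ 2 by apply: sq; lra.
  by have := sqr_ge0 (t + 2 * s); move=> *; apply/andP; split; lra.
- by apply/andP; split; lra.
Qed.

Lemma ramp_diff t s : `|ramp (t + s) - ramp t| <= `|s| * (2 * `|t| + `|s|).
Proof.
have maxE x : x <= 0 /\ Num.max x 0 = 0 \/ 0 <= x /\ Num.max x 0 = x.
  by have [a|/ltW a] := leP x 0; [left|right].
have h : `|Num.max (t + s) 0 - Num.max t 0| <= `|s|.
  have := ler_norm s; have := ler_norm (- s); rewrite normrN ler_norml => s1 s2.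
  have [[a ->]|[a ->]] := maxE t; have [[b ->]|[b ->]] := maxE (t + s);
    apply/andP; split; lra.
have h' : `|Num.max (t + s) 0 + Num.max t 0| <= 2 * `|t| + `|s|.
  rewrite ger0_norm; last by rewrite addr_ge0// le_max lexx orbT.
  have := ler_norm s; have := ler_norm t; have := normr_ge0 s; have := normr_ge0 t.
  by have [[a ->]|[a ->]] := maxE t; have [[b ->]|[b ->]] := maxE (t + s) => *; lra.
by rewrite /ramp subr_sqr normrM ler_pM.
Qed.

Lemma c11_ramp (e p : R) : `|e| = 1 -> c11 (fun x => ramp (e * (x - p))).
Proof.
move=> e1 D; have [D0|D0] := ltP D 0.
  by exists 0 => // x s xD; have := le_lt_trans (le_trans (normr_ge0 x) xD) D0; rewrite ltxx.
pose T := D + `|p|; have T0 : 0 <= T by rewrite addr_ge0.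
exists (T ^+ 2 + 2 * T + 2) => [|x s xD s1]; first by have := sqr_ge0 T; lra.
have tT : `|e * (x - p)| <= T.
  by rewrite normrM e1 mul1r (le_trans (ler_normB _ _))// lerD.
have es : `|e * s| = `|s| by rewrite normrM e1 mul1r.
have es2 : (e * s) ^+ 2 = s ^+ 2 by rewrite -[LHS]real_normK ?num_real// es real_normK ?num_real.
have e1s : e * (x + s - p) = e * (x - p) + e * s by ring.
have e2s : e * (x + 2 * s - p) = e * (x - p) + 2 * (e * s) by ring.
rewrite e1s e2s; move: (e * (x - p)) (e * s) tT es es2 => t h tT es es2.
have s0 := normr_ge0 s; have t0 := normr_ge0 t.
split.
- rewrite ger0_norm ?ramp_ge0//; apply: (@le_trans _ _ (`|t| ^+ 2)).
    rewrite real_normK ?num_real//; have [a|a] := leP t 0.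
      by rewrite ramp_le0// sqr_ge0.
    by rewrite ramp_gt0.
  have : `|t| ^+ 2 <= T ^+ 2 by rewrite ler_sqr ?nnegrE.
  by lra.
- apply: le_trans (ramp_diff _ _) _; rewrite es mulrC ler_wpM2r//.
  by have := sqr_ge0 T; lra.
- apply: le_trans (ramp_diff2 _ _) _; rewrite es2 ler_wpM2r ?sqr_ge0//.
  by have := sqr_ge0 T; lra.
Qed.

(** On (p, q) the product of the ramps is at most [(q - p)^4], so the denominator keeps the values
    in [0, 1) and is never 0. *)
Definition hat (p q x : R) : R := ramp (x - p) * ramp (q - x) / ((q - p) ^+ 4 + 1).

(* Increases to the indicator function of the interval (p, q) as n grows. *)
Definition plateau (p q : R) (n : nat) (x : R) : R := 1 - (1 - hat p q x) ^+ n.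

Lemma hat_itv p q x : 0 <= hat p q x < 1.
Proof.
have d0 : 0 < (q - p) ^+ 4 + 1 by rewrite ltr_wpDl// exprn_even_ge0.
rewrite /hat; apply/andP; split; first by apply: divr_ge0; [apply: mulr_ge0; exact: ramp_ge0|exact: ltW].
rewrite ltr_pdivrMr// mul1r.
have q0 : 0 <= (q - p) ^+ 4 by rewrite exprn_even_ge0.
have [a|a] := leP (x - p) 0; first by rewrite (ramp_le0 a) mul0r; lra.
have [b|b] := leP (q - x) 0; first by rewrite (ramp_le0 b) mulr0; lra.
rewrite !ramp_gt0// (_ : (q - p) ^+ 4 = (q - p) ^+ 2 * (q - p) ^+ 2); last by rewrite -exprD.
rewrite ltr_pwDr// ler_pM ?sqr_ge0//; rewrite ler_sqr ?nnegrE; lra.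
Qed.

Lemma hat_gt0 p q x : p < x < q -> 0 < hat p q x.
Proof.
move=> /andP[px xq]; rewrite /hat divr_gt0//; last by rewrite ltr_wpDl// exprn_even_ge0.
by rewrite !ramp_gt0 ?subr_gt0// mulr_gt0// exprn_gt0// subr_gt0.
Qed.

Lemma hat_out p q x : ~~ (p < x < q) -> hat p q x = 0.
Proof.
rewrite negb_and -!leNgt /hat => /orP[xp|qx].
  by rewrite (@ramp_le0 (x - p)) ?subr_le0// !mul0r.
by rewrite (@ramp_le0 (q - x)) ?subr_le0// mulr0 mul0r.
Qed.

Lemma plateau_itv p q n x : 0 <= plateau p q n x <= 1.
Proof.
have /andP[h0 h1] := hat_itv p q x; rewrite /plateau subr_ge0 gerBl.
have g0 : 0 <= 1 - hat p q x by lra.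
by rewrite exprn_ge0// andbT exprn_ile1//; lra.
Qed.

Lemma plateau_out p q n x : ~~ (p < x < q) -> plateau p q n x = 0.
Proof. by move=> h; rewrite /plateau hat_out// subr0 expr1n subrr. Qed.

Lemma plateau_cvg p q x : p < x < q -> (fun n => plateau p q n x) @ \oo --> (1 : R).
Proof.
move=> h; have h0 := hat_gt0 h; have /andP[_ h1] := hat_itv p q x.
rewrite -[X in _ --> X]subr0; apply: cvgB; first exact: cvg_cst.
by apply: cvg_expr; rewrite ger0_norm; lra.
Qed.

Lemma c11_hat p q : c11 (hat p q).
Proof.
rewrite (_ : hat p q = fun x => ramp (1 * (x - p)) * ramp (-1 * (x - q)) * ((q - p) ^+ 4 + 1)^-1).
  apply: c11M; last exact: c11_cst.
  by apply: c11M; apply: c11_ramp; rewrite ?normrN normr1.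
by apply/funext => x; rewrite /hat mul1r mulN1r opprB.
Qed.

Lemma c11_plateau p q n : c11 (plateau p q n).
Proof.
have cB f g : c11 f -> c11 g -> c11 (fun x => f x - g x).
  move=> cf cg; rewrite (_ : (fun x => _) = fun x => f x + -1 * g x).
    by apply: c11D => //; apply: c11M => //; exact: c11_cst.
  by apply/funext => x; rewrite mulN1r.
apply: (cB); first exact: c11_cst.
apply: c11X; apply: (cB); first exact: c11_cst.
exact: c11_hat.
Qed.

Lemma measurable_plateau p q n : measurable_fun setT (plateau p q n).
Proof.
have mr (h : R -> R) : measurable_fun setT h -> measurable_fun setT (fun x => ramp (h x)).
  by move=> mh; apply: measurable_funX; exact: measurable_maxr.
apply: measurable_funB => //; apply: measurable_funX; apply: measurable_funB => //.
apply: measurable_funM => //; apply: measurable_funM; apply: mr.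
  exact: measurable_funB.
exact: measurable_funB.
Qed.

End c11_functions.

Section one_dimensional_decay.
Context {R : realType}.
Implicit Types (k : R -> R) (a b x s D C : R).

Definition nice D C k := [/\ measurable_fun setT k, (forall x, D < `|x| -> k x = 0) &
  forall x s, `|s| <= 1 -> [/\ `|k x| <= C, `|k (x + s) - k x| <= C * `|s| &
      `|k (x + 2 * s) - 2 * k (x + s) + k x| <= C * s ^+ 2]].

(** Beyond radius [D + 2] none of the points [x], [x + s], [x + 2 * s] reaches the support, so the
    local constant there is a global one. *)
Lemma c11_nice D k : 0 <= D -> measurable_fun setT k ->
  (forall x, D < `|x| -> k x = 0) -> c11 k -> exists C, nice D C k.
Proof.
move=> D0 mk k0 ck; have [C C0 hC] := ck (D + 2).
exists C; split=> // x s s1; have [xD|xD] := leP `|x| (D + 2); first exact: hC.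
have far y : `|y - x| <= 2 -> k y = 0.
  move=> yx; apply: k0; have := ler_normD (x - y) y; rewrite subrK distrC.
  by lra.
have e0 : k x = 0 by apply: far; rewrite subrr normr0.
have e1 : k (x + s) = 0 by apply: far; rewrite addrAC subrr add0r (le_trans s1)// ler1n.
have e2 : k (x + 2 * s) = 0.
  by apply: far; rewrite addrAC subrr add0r normrM ger0_norm// ler_piMr.
rewrite e0 e1 e2 mulr0 subrr addr0 normr0; split=> //; first exact: mulr_ge0.
by apply: mulr_ge0 => //; exact: sqr_ge0.
Qed.

(** The weights 1/4, 1/2, 1/4 sum to 1, so the integral is preserved. If a factor of [F] changes
    sign under translation by [s], the remaining factor undergoes a quarter of a second
    difference. *)
Definition avg s (F : R -> R[i]) x : R[i] :=
  (4^-1)%:C * F x + ((2^-1)%:C * F (x + s) + (4^-1)%:C * F (x + 2 * s)).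

(** One coordinate of the integrand of the inner product of the shift of [k] by [(a, b)] with [k],
    without the constant phase [cis (- 2 * pi * a * b)]. *)
Definition gram_factor k a b x : R[i] := cis (2 * pi * b * x) * (k (x - a) * k x)%:C.

(** Half a period of the oscillation. For [|b| < 1] no decay in [b] has to be gained, and the step 0
    turns [avg] into the identity. *)
Definition avg_step b : R := if 1 <= `|b| then (2 * b)^-1 else 0.

Lemma avg_step_le b : `|avg_step b| <= 2^-1.
Proof.
rewrite /avg_step; case: ifP => [b1|_]; last by rewrite normr0 invr_ge0.
by rewrite normfV normrM ger0_norm// lef_pV2 ?posrE ?mulr_gt0 ?ler_peMr// (lt_le_trans ltr01).
Qed.

Lemma avg_gram_factor_out D C k a b x : nice D C k -> D + 1 < `|x| ->
  avg (avg_step b) (gram_factor k a b) x = 0.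
Proof.
move=> [_ k0 _] xD; have s1 := avg_step_le b; move: (avg_step b) s1 => s s1.
have far y : `|y - x| <= 1 -> gram_factor k a b y = 0.
  move=> yx; have ky : k y = 0.
    by apply: k0; have := ler_normD (x - y) y; rewrite subrK distrC; lra.
  by rewrite /gram_factor ky mulr0; exact: mulr0.
have e0 : gram_factor k a b x = 0 by apply: far; rewrite subrr normr0.
have e1 : gram_factor k a b (x + s) = 0 by apply: far; rewrite addrAC subrr add0r; lra.
have e2 : gram_factor k a b (x + 2 * s) = 0.
  by apply: far; rewrite addrAC subrr add0r normrM ger0_norm//; lra.
by rewrite /avg e0 e1 e2 !mulr0 !addr0.
Qed.

(* With [s = 1 / (2 b)], averaging turns the oscillating factor into a second
   difference of [x |-> k (x - a) * k x]. *)
Lemma avg_gram_factor_le D C k a b x : 0 <= D -> nice D C k ->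
  normc (avg (avg_step b) (gram_factor k a b) x) <=
  2 * C ^+ 2 * (1 + 4 * D ^+ 2) * ((1 + a ^+ 2)^-1 * (1 + b ^+ 2)^-1).
Proof.
move=> D0 [_ k0 kC]; have C0 : 0 <= C.
  by have [|h _ _] := kC 0 0; [rewrite normr0|apply: le_trans h].
have a1 : 0 < 1 + a ^+ 2 by rewrite ltr_wpDr// sqr_ge0.
have b1 : 0 < 1 + b ^+ 2 by rewrite ltr_wpDr// sqr_ge0.
(* For [|a| > 2 * D] the supports of [k] and its translate are disjoint. Otherwise [1 + 4 * D ^+ 2]
   compensates the decay claimed in [a]. *)
have [aD|aD] := ltP (2 * D) `|a|.
  have zero y : gram_factor k a b y = 0.
    rewrite /gram_factor; have [yD|yD] := ltP D `|y|.
      by rewrite (k0 y)// mulr0; exact: mulr0.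
    have -> : k (y - a) = 0.
      by apply: k0; have := ler_normD (a - y) y; rewrite subrK distrC; lra.
    by rewrite mul0r; exact: mulr0.
  rewrite /avg !zero !mulr0 !addr0 normc0 !mulr_ge0 ?invr_ge0 ?sqr_ge0 ?(ltW a1) ?(ltW b1)//.
  by rewrite addr_ge0// mulr_ge0// sqr_ge0.
have aD2 : 1 + a ^+ 2 <= 1 + 4 * D ^+ 2.
  rewrite lerD2l -[a ^+ 2]real_normK ?num_real// (_ : 4 * D ^+ 2 = (2 * D) ^+ 2); last by ring.
  by rewrite ler_sqr ?nnegrE// mulr_ge0.
suff h : normc (avg (avg_step b) (gram_factor k a b) x) <= 2 * C ^+ 2 * (1 + b ^+ 2)^-1.
  apply: le_trans h _; rewrite -[leRHS]mulrA; apply: ler_wpM2l; first by rewrite mulr_ge0// sqr_ge0.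
  rewrite [leRHS]mulrA ler_peMl ?invr_ge0 ?(ltW b1)//.
  by rewrite ler_pdivlMr// mul1r.
have kC' y : `|k y| <= C by have [|h _ _] := kC y 0; [rewrite normr0|exact: h].
(* For [|b| < 1] nothing is averaged, and the factor 2 compensates [(1 + b^2)^-1 >= 1/2]. *)
rewrite /avg /avg_step; case: ifPn => bb; last first.
  rewrite mulr0 addr0 -!mulrDl -!rmorphD (_ : 4^-1 + (2^-1 + 4^-1) = 1 :> R); last by field.
  rewrite rmorph1 mul1r /gram_factor normcM normc_cis mul1r normc_real normrM.
  apply: (@le_trans _ _ (C * C)); first by rewrite ler_pM.
  rewrite -expr2 -mulrA mulrCA -[leLHS]mulr1 ler_wpM2l ?sqr_ge0//.
  rewrite ler_pdivlMr// mul1r.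
  move: bb; rewrite -ltNge => bb.
  have : b ^+ 2 <= 1 ^+ 2 by rewrite -[b ^+ 2]real_normK ?num_real// ler_sqr ?nnegrE// ltW.
  by rewrite expr1n; lra.
have bn0 : b != 0.
  by apply/eqP => b0; move: bb; rewrite b0 normr0 leNgt ltr01.
set s : R := (2 * b)^-1.
have s1 : `|s| <= 1.
  have := avg_step_le b; rewrite /avg_step bb -/s => /le_trans; apply.
  by rewrite invf_le1// ler1n.
have cis_s y : cis (2 * pi * b * (y + s)) = - cis (2 * pi * b * y).
  rewrite (_ : 2 * pi * b * (y + s) = 2 * pi * b * y + pi); last first.
    by rewrite /s; move: (@pi R) => p; field.
  by rewrite cisD /cis cospi sinpi; apply/eqP; rewrite eq_complex /=; apply/andP; split; apply/eqP; ring.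
have e2 : x + 2 * s = x + s + s by ring.
rewrite /gram_factor cis_s e2 cis_s cis_s opprK -e2.
pose f := fun y => k (y - a).
rewrite (_ : _ + _ = cis (2 * pi * b * x) * (4^-1 * (f (x + 2 * s) * k (x + 2 * s) -
   2 * (f (x + s) * k (x + s)) + f x * k x))%:C); last first.
  rewrite /f; case: (cis _) => p q; apply/eqP; rewrite eq_complex /=.
  by apply/andP; split; apply/eqP; field.
rewrite normcM normc_cis mul1r normc_real normrM ger0_norm ?invr_ge0//.
have [f0 f01 f02] := kC (x - a) s s1; have [g0 g01 g02] := kC x s s1.
have [f1 f12 _] := kC (x - a + s) s s1.
have fE y : x - a + y = x + y - a by ring.
have fE2 : x - a + s + s = x + 2 * s - a by ring.
rewrite fE2 !fE -/(f x) -/(f (x + s)) -/(f (x + 2 * s)) in f0 f01 f02 f1 f12.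
have f2 : `|f (x + 2 * s)| <= C by exact: kC'.
have E : f (x + 2 * s) * k (x + 2 * s) - 2 * (f (x + s) * k (x + s)) + f x * k x =
  f (x + 2 * s) * (k (x + 2 * s) - 2 * k (x + s) + k x) +
  (2 * ((f (x + 2 * s) - f (x + s)) * (k (x + s) - k x)) +
  (f (x + 2 * s) - 2 * f (x + s) + f x) * k x) by ring.
have h : `|f (x + 2 * s) * k (x + 2 * s) - 2 * (f (x + s) * k (x + s)) + f x * k x| <=
    4 * C ^+ 2 * s ^+ 2.
  rewrite E; apply: le_trans (ler_normD _ _) _; apply: le_trans (lerD (lexx _) (ler_normD _ _)) _.
  rewrite !normrM (ger0_norm (ler0n _ 2)).
  apply: (@le_trans _ _ (C * (C * s ^+ 2) + (2 * (C * `|s| * (C * `|s|)) + C * s ^+ 2 * C))).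
    by rewrite lerD ?ler_pM// lerD ?ler_pM// ?mulr_ge0// ler_pM.
  rewrite -[s ^+ 2]real_normK ?num_real//; have := normr_ge0 s; move: `|s| => y y0.
  by rewrite le_eqVlt; apply/orP; left; apply/eqP; ring.
apply: (@le_trans _ _ (4^-1 * (4 * C ^+ 2 * s ^+ 2))); first by rewrite ler_wpM2l ?invr_ge0.
have b2 : 1 <= b ^+ 2 by rewrite -[b ^+ 2]real_normK ?num_real// exprn_ege1.
have b20 : 0 < b ^+ 2 by rewrite (lt_le_trans ltr01).
rewrite (_ : 4^-1 * _ = C ^+ 2 * (4 * b ^+ 2)^-1); last by rewrite /s; field.
rewrite [2 * C ^+ 2]mulrC -[leRHS]mulrA; apply: ler_wpM2l; first exact: sqr_ge0.
rewrite ler_pdivlMr// mulrC ler_pdivrMr; last exact: mulr_gt0.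
by lra.
Qed.

End one_dimensional_decay.

Section boxes.
Context {R : realType}.
Local Notation euc n := (n.-tuple (measurableTypeR R)).

Definition box n (D : R) : set (euc n) := [set x | forall i, `|tnth x i| <= D].

Lemma measurable_box n D : measurable (@box n D).
Proof.
rewrite (_ : box D = \big[setI/setT]_(i < n) [set x : euc n | `|tnth x i| <= D]).
  apply: bigsetI_measurable => i _; rewrite -[X in measurable X]setTI.
  apply: (measurable_fun_le (f := fun x : euc n => `|tnth x i|) (g := cst D)) => //.
  by apply: measurableT_comp => //; exact: measurable_tnth.
apply/seteqP; split=> [x xD|x].
  by elim/big_ind: _ => // i _; exact: xD.
by move=> xD i; move: xD; rewrite (bigD1 i)//= => -[].
Qed.

Lemma box_finite n D : (lebesgue_tuple n (@box n D) < +oo)%E.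
Proof.
elim: n => [|n IH]; first by rewrite /= diracE ltry.
pose cons (p : measurableTypeR R * euc n) : euc n.+1 := [tuple of p.1 :: p.2].
change ((lebesgue_measure \x lebesgue_tuple n)%E (cons @^-1` (box D)) < +oo)%E.
have mI : measurable ([set` `[- D, D]] : set (measurableTypeR R)) by exact: measurable_itv.
apply: (@le_lt_trans _ _ ((lebesgue_measure \x lebesgue_tuple n)%E
    ([set` `[- D, D]] `*` box D))).
  apply: le_measure; rewrite ?inE.
  - rewrite -[X in measurable X]setTI; apply: measurable_cons => //; exact: measurable_box.
  - by apply: measurableX => //; exact: measurable_box.
  move=> [x t] /= h; split.
    by have := h ord0; rewrite /= in_itv /= ler_norml.
  by move=> i; have := h (lift ord0 i); rewrite !(tnth_nth 0).
rewrite product_measure1E//; last exact: measurable_box.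
apply: lte_mul_pinfty => //.
  by rewrite /= lebesgue_measure_itv /=; case: ifP.
Qed.

End boxes.

Section tensors.
Context {R : realType} {d : nat}.
Local Notation C := R[i].
Local Notation E := (euclid R d).
Local Notation leb := (@lebesgue_tuple R d).
Local Notation L2 := (L2space R d).
Local Notation ip := (@L2ip R d).
Local Notation nrm := (ipnorm ip).
Local Notation P := (@L2shift R d).

Definition tensor (F : 'I_d -> R -> C) (x : E) : C := \prod_i F i (tnth x i).

Definition cmeasurable (F : R -> C) :=
  measurable_fun setT (fun x => complex.Re (F x)) /\
  measurable_fun setT (fun x => complex.Im (F x)).

Lemma complex_measurable_tensor F : (forall i, cmeasurable (F i)) ->
  complex_measurable (tensor F).
Proof.
move=> mF; rewrite /tensor.
elim: (index_enum _) => [|i s IH].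
  rewrite (_ : (fun _ => _) = fun=> 1); first by split; exact: measurable_cst.
  by apply/funext => x; rewrite big_nil.
rewrite (_ : (fun _ => _) = fun x => F i (tnth x i) * \prod_(i <- s) F i (tnth x i)).
  apply: complex_measurableM => //; have [mr mi] := mF i.
  by split; [apply: (measurableT_comp mr)|apply: (measurableT_comp mi)]; exact: measurable_tnth.
by apply/funext => x; rewrite big_cons.
Qed.

Lemma normc_prod (I : Type) (s : seq I) (F : I -> C) :
  normc (\prod_(i <- s) F i) = \prod_(i <- s) normc (F i).
Proof. exact: (big_morph _ (@normcM R) (@normc1 R)). Qed.

Lemma integrable_box_indic (D : R) :
  leb.-integrable setT (EFin \o (\1_(box D) : E -> R)).
Proof.
have mB := @measurable_box R d D.
apply/integrableP; split; first exact/measurable_EFinP.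
rewrite (eq_integral (fun x => (\1_(box D) x)%:E)); last first.
  by move=> t _; rewrite gee0_abs// lee_fin.
by rewrite integral_indic// setIT; exact: box_finite.
Qed.

Section bounded_tensors.
Variables (F : 'I_d -> R -> C) (M : 'I_d -> R) (D : R).
Hypothesis mF : forall i, cmeasurable (F i).
Hypothesis FM : forall i y, normc (F i y) <= M i.
Hypothesis F0 : forall i y, D < `|y| -> F i y = 0.

Let M0 : 0 <= \prod_i M i.
Proof. by apply: prodr_ge0 => i _; apply: le_trans (FM i 0); exact: normc_ge0. Qed.

Lemma normc_tensor_le x : normc (tensor F x) <= (\prod_i M i) * \1_(box D) x.
Proof.
rewrite /tensor normc_prod indicE; have [xD|xD] := boolP (x \in box D).
  by rewrite mulr1; apply: ler_prod => i _; rewrite normc_ge0 FM.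
rewrite mulr0; have [i iD] : exists i, D < `|tnth x i|.
  apply: contrapT => h; move: xD; rewrite notin_setE; apply => i.
  by rewrite leNgt; apply/negP => hi; apply: h; exists i.
by rewrite (bigD1 i)//= F0// normc0 mul0r.
Qed.

Let integrable_box (c : R) :
  leb.-integrable setT (EFin \o (fun x => c * (\1_(box D) x : R))).
Proof.
by have := integrableZl (@measurableT _ E) c (integrable_box_indic D).
Qed.

Lemma integrable_tensor : complex_integrable (tensor F).
Proof.
apply: complex_integrable_dom (integrable_box (\prod_i M i)) normc_tensor_le.
exact: complex_measurable_tensor.
Qed.

Lemma integral_tensor_le : normc (complex_integral (tensor F)) <=
  2 * ((\prod_i M i) * fine (leb (box D))).
Proof.
have [iR iI] := integrable_tensor; set K := \prod_i M i.
have Rle (p : C -> R) : leb.-integrable setT (EFin \o (fun x => p (tensor F x))) ->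
    (forall z, `|p z| <= normc z) -> `|\int[leb]_x p (tensor F x)| <= K * fine (leb (box D)).
  move=> ip pn; apply: le_trans (le_normr_Rintegral _ ip) _ => //.
  apply: (@le_trans _ _ (\int[leb]_x (K * (\1_(box D) x : R)))).
    apply: le_Rintegral => //; first exact: integrable_norm.
    by move=> x _; apply: le_trans (pn _) (normc_tensor_le x).
  rewrite RintegralZl//; last exact: integrable_box_indic.
  by rewrite /Rintegral integral_indic ?setIT//; exact: measurable_box.
have h1 := Rle _ iR normr_Re_le_normc; have h2 := Rle _ iI (@Im_le_normc R).
rewrite /complex_integral; move: h1 h2.
move: (\int[leb]_x complex.Re (tensor F x)) (\int[leb]_x complex.Im (tensor F x)) => p q h1 h2.
have -> : p +i* q = p%:C + 'i * q%:C by rewrite [LHS]complexE.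
apply: le_trans (le_normcD _ _) _; rewrite normcM !normc_real.
rewrite (_ : normc 'i = 1) ?mul1r; last by rewrite /= expr0n add0r expr1n sqrtr1.
by lra.
Qed.

Lemma square_integrable_tensor : square_integrable (tensor F).
Proof.
apply/square_integrableE; split; first exact: complex_measurable_tensor.
apply: (@le_lt_trans _ _ (\int[leb]_x ((\prod_i M i) ^+ 2 * (\1_(box D) x : R))%:E)%E).
  apply: ge0_le_integral => //.
  - by move=> x _; rewrite lee_fin sqr_ge0.
  - by apply: measurable_mass; exact: complex_measurable_tensor.
  - apply/measurable_EFinP; apply: measurable_funM => //; apply: measurable_indic.
    exact: measurable_box.
  move=> x _; rewrite lee_fin; have := normc_tensor_le x.
  rewrite indicE; case: (_ \in _) => /=; rewrite ?mulr1 ?mulr0 => h.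
    by rewrite ler_sqr ?nnegrE ?normc_ge0.
  suff -> : normc (tensor F x) = 0 by rewrite expr0n.
  by apply/eqP; rewrite eq_le h normc_ge0.
by have /integrable_lty := integrable_box ((\prod_i M i) ^+ 2); apply.
Qed.

End bounded_tensors.

Lemma complex_integrable_shift (a : 'I_d -> R) (f : E -> C) : complex_integrable f ->
  complex_integrable (f \o tuple_shift a).
Proof.
have h (p : C -> R) : leb.-integrable setT (EFin \o (fun x => p (f x))) ->
    leb.-integrable setT (EFin \o (fun x => p (f (tuple_shift a x)))).
  move=> /integrableP[mp ip]; apply/integrableP; split.
    exact: (measurableT_comp mp (measurable_shift a)).
  rewrite (_ : \int[leb]_x _ = \int[leb]_x `|(EFin \o (fun x => p (f x))) x|)%E//.
  rewrite -(integral_shift a (F := fun x => `|(EFin \o (fun x => p (f x))) x|%E))//.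
  exact: (measurableT_comp (@abse_measurable R setT) mp).
by move=> [iR iI]; split; exact: h.
Qed.

Lemma complex_integralZ (c : C) (f : E -> C) : complex_integrable f ->
  complex_integrable (fun x => c * f x) /\
  complex_integral (fun x => c * f x) = c * complex_integral f.
Proof.
have i0 : complex_integrable (fun _ : E => 0 : C).
  by split; rewrite (_ : _ \o _ = cst 0%E)//; exact: integrable0.
have I0 : complex_integral (fun _ : E => 0 : C) = 0.
  by rewrite /complex_integral /Rintegral !integral0.
move=> fi; have [h1 h2] := complex_integral_linear c fi i0.
rewrite I0 addr0 in h2; rewrite (_ : (fun x => c * f x) = fun x => c * f x + 0)//.
by apply/funext => x; rewrite addr0.
Qed.

(** Averaging in one coordinate combines translates of the whole tensor with weights of sum 1, so
    translation invariance suffices and no iterated integral is formed. *)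
Lemma tensor_avg (F : 'I_d -> R -> C) (i : 'I_d) (s : R) :
  complex_measurable (tensor F) -> complex_integrable (tensor F) ->
  complex_integral (tensor (fun j => if j == i then avg s (F i) else F j)) =
  complex_integral (tensor F).
Proof.
move=> mF iF; pose a t (j : 'I_d) : R := if j == i then - t else 0.
have fE t x : tensor F (tuple_shift (a t) x) =
    F i (tnth x i + t) * \prod_(j | j != i) F j (tnth x j).
  rewrite /tensor (bigD1 i)//= tnth_mktuple /a eqxx opprK; congr (_ * _).
  by apply: eq_bigr => j /negbTE ji; rewrite tnth_mktuple /a ji subr0.
rewrite (_ : tensor _ = fun x => (4^-1)%:C * tensor F x +
   ((2^-1)%:C * (tensor F \o tuple_shift (a s)) x + (4^-1)%:C * (tensor F \o tuple_shift (a (2 * s))) x)).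
  have i1 := complex_integrable_shift (a s) iF; have i2 := complex_integrable_shift (a (2 * s)) iF.
  have [j2 e2] := complex_integralZ (4^-1)%:C i2.
  have [j1 e1] := complex_integral_linear (2^-1)%:C i1 j2.
  have [_ ->] := complex_integral_linear (4^-1)%:C iF j1.
  rewrite e1 e2 !complex_integral_shift// -!mulrDl -!rmorphD.
  by rewrite (_ : 4^-1 + (2^-1 + 4^-1) = 1 :> R) ?rmorph1 ?mul1r//; field.
apply/funext => x; rewrite /= !fE {1 2}/tensor (bigD1 i)//= [X in _ = _ * X + _](bigD1 i)//= eqxx.
rewrite (eq_bigr (fun j => F j (tnth x j))); last by move=> j /negbTE ->.
by rewrite /avg; ring.
Qed.

Lemma cmeasurable_avg s F : cmeasurable F -> cmeasurable (avg s F).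
Proof.
move=> [mr mi].
have mS (p : R -> R) (t : R) : measurable_fun setT p -> measurable_fun setT (fun x : R => p (x + t)).
  move=> mp; apply: (measurableT_comp mp (g := fun x : R => x + t)).
  exact: measurable_funD.
split.
- rewrite (_ : (fun x => _) = fun x => 4^-1 * complex.Re (F x) + (2^-1 * complex.Re (F (x + s)) +
    4^-1 * complex.Re (F (x + 2 * s)))); last by apply/funext => x; rewrite /avg !ReD !Re_realM.
  apply: measurable_funD; first exact: measurable_funM.
  by apply: measurable_funD; apply: measurable_funM => //; exact: (mS (fun x => complex.Re (F x))).
- rewrite (_ : (fun x => _) = fun x => 4^-1 * complex.Im (F x) + (2^-1 * complex.Im (F (x + s)) +
    4^-1 * complex.Im (F (x + 2 * s)))); last first.
    apply/funext => x; rewrite /avg !ImD; case: (F x) (F (x + s)) (F (x + 2 * s)) => p1 q1 [p2 q2] [p3 q3] /=.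
    by ring.
  apply: measurable_funD; first exact: measurable_funM.
  by apply: measurable_funD; apply: measurable_funM => //; exact: (mS (fun x => complex.Im (F x))).
Qed.

Lemma normc_avg_le (s : R) (F : R -> C) (y M : R) : (forall x, normc (F x) <= M) -> normc (avg s F y) <= M.
Proof.
move=> FM; have nZ (t : R) (z : C) : 0 <= t -> normc (t%:C * z) = t * normc z.
  by move=> t0; rewrite normcM normc_real ger0_norm.
rewrite /avg; apply: le_trans (le_normcD _ _) _.
apply: le_trans (lerD (lexx _) (le_normcD _ _)) _; rewrite !nZ ?invr_ge0//.
by have := FM y; have := FM (y + s); have := FM (y + 2 * s); lra.
Qed.

Section gram.
Variables (k : 'I_d -> R -> R) (D K : R).
Hypothesis D0 : 0 <= D.
Hypothesis kP : forall i, nice D K (k i).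

Definition testfun : E -> C := tensor (fun i y => (k i y)%:C).

Let kK i y : `|k i y| <= K.
Proof. by have [_ _ /(_ y 0)[]] := kP i; rewrite ?normr0. Qed.

Let cm i : cmeasurable (fun y => (k i y)%:C).
Proof. by have [mk _ _] := kP i; split => //=; exact: measurable_cst. Qed.

Let kn i y : normc (k i y)%:C <= K.
Proof. by rewrite normc_real. Qed.

Let k0 i y : D < `|y| -> (k i y)%:C = 0.
Proof. by move=> yD; have [_ h _] := kP i; rewrite h. Qed.

Lemma testfun_square : square_integrable testfun.
Proof. exact: (square_integrable_tensor cm kn k0). Qed.

Definition testfun_class : L2 := L2class testfun_square.

Let c : R := 2 * K ^+ 2 * (1 + 4 * D ^+ 2).

(** Averaging every coordinate leaves the integral unchanged, and the averaged integrand is bounded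
    by [c ^+ d] times the decay and supported in a box. The leading 2 comes from estimating real and
    imaginary parts separately. *)
Lemma gram_testfun_le l : normc (ip (P l testfun_class) testfun_class) <=
  2 * (c ^+ d * fine (leb (box (D + 1)))) * decay (fun i => l i 0).
Proof.
pose a i : R := usubmx l i 0; pose b i : R := dsubmx l i 0.
pose G i := gram_factor (k i) (a i) (b i).
pose A i := avg (avg_step (b i)) (G i).
have K0 (i : 'I_d) : 0 <= K by exact: le_trans (normr_ge0 _) (kK i 0).
have GK i y : normc (G i y) <= K ^+ 2.
  by rewrite /G /gram_factor normcM normc_cis mul1r normc_real normrM expr2 ler_pM.
have AK i y : normc (A i y) <= K ^+ 2 by exact: normc_avg_le.
have G0 i y : D + 1 < `|y| -> G i y = 0.
  move=> yD; have [_ h _] := kP i.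
  have ky : k i y = 0 by apply: h; apply: lt_trans yD; rewrite ltrDl.
  by rewrite /G /gram_factor ky mulr0; exact: mulr0.
have A0 i y : D + 1 < `|y| -> A i y = 0 by exact: avg_gram_factor_out (kP i).
have mG i : cmeasurable (G i).
  have [mk _ _] := kP i.
  have ms : measurable_fun setT (fun y : R => k i (y - a i) * k i y).
    apply: measurable_funM => //; apply: (measurableT_comp mk (g := fun y : R => y - a i)).
    exact: measurable_funB.
  have mc (t : R -> R) : continuous t -> measurable_fun setT (fun y : R => t (2 * pi * b i * y)).
    move=> ct; apply: (measurableT_comp (f := t)) => //.
    exact: continuous_measurable_fun.
  split.
    rewrite (_ : (fun x => _) = fun y => cos (2 * pi * b i * y) * (k i (y - a i) * k i y)).
      by apply: measurable_funM => //; apply: mc; exact: continuous_cos.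
    by apply/funext => y; rewrite /G /gram_factor /= mulr0 subr0.
  rewrite (_ : (fun x => _) = fun y => sin (2 * pi * b i * y) * (k i (y - a i) * k i y)).
    by apply: measurable_funM => //; apply: mc; exact: continuous_sin.
  by apply/funext => y; rewrite /G /gram_factor /= mulr0 add0r.
have mA i : cmeasurable (A i) by exact: cmeasurable_avg.
(* Interpolates between [G] and [A]: one more coordinate is averaged at each step of the induction
   in [Fint]. *)
pose F m (i : 'I_d) := if (i < m)%N then A i else G i.
have mF m i : cmeasurable (F m i) by rewrite /F; case: ifP.
have FK m i y : normc (F m i y) <= K ^+ 2 by rewrite /F; case: ifP.
have F0 m i y : D + 1 < `|y| -> F m i y = 0 by rewrite /F; case: ifP => _; [exact: A0|exact: G0].
have Fint m : (m <= d)%N -> complex_integral (tensor (F m)) = complex_integral (tensor G).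
  elim: m => [_|m IH md]; first by [].
  rewrite -(IH (ltnW md)) -(@tensor_avg (F m) (Ordinal md) (avg_step (b (Ordinal md)))).
  - congr (complex_integral (tensor _)); apply/funext => j; rewrite /F ltnS.
    rewrite leq_eqVlt -val_eqE /=; case: eqP => //= jm.
    by rewrite ltnn /A (_ : j = Ordinal md)//; exact: val_inj.
  - by apply: complex_measurable_tensor; exact: mF.
  - exact: (integrable_tensor (mF m) (FK m) (F0 m)).
(* The constant part of the phase, which is evaluated at the translated point. *)
pose t0 : R := - (2 * pi * \sum_i b i * a i).
have -> : ip (P l testfun_class) testfun_class = cis t0 * complex_integral (tensor G).
  have iG : complex_integrable (tensor G) := integrable_tensor mG GK G0.
  have [_ <-] := complex_integralZ (cis t0) iG.
  have mk : complex_measurable testfun by case: testfun_square.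
  rewrite [LHS](@L2inner_ae _ _ _ (tfshift l testfun) _ testfun).
  - rewrite L2innerE; congr complex_integral; apply/funext => x.
    rewrite tfshiftE (_ : conjc (testfun x) = testfun x); last first.
      rewrite /testfun /tensor rmorph_prod; apply: eq_bigr => i _ /=.
      by rewrite oppr0.
    have -> : phase l (tshift l x) = t0 + \sum_i 2 * pi * b i * tnth x i.
      rewrite /phase /t0 !mulr_sumr -sumrN -big_split /=; apply: eq_bigr => i _.
      by rewrite tnth_mktuple -/(a i) -/(b i); move: (@pi R) => p; ring.
    rewrite cisD (big_morph cis (@cisD R) (@cis0 R)) /testfun /tensor -!mulrA -!big_split /=.
    congr (_ * _); apply: eq_bigr => i _; rewrite /G /gram_factor tnth_mktuple.
    by rewrite -/(a i) rmorphM.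
  - exact: L2space_measurable.
  - exact: complex_measurable_tfshift.
  - exact: L2space_measurable.
  - by [].
  - have := L2shift_ae l testfun_class; have := tfshift_ae l (L2class_ae testfun_square).
    by apply: filterS2 => x h1 h2 _; rewrite h2// h1.
  - exact: L2class_ae.
rewrite normcM normc_cis mul1r -(Fint d (leqnn d)).
have FA : F d = A by apply/funext => i; rewrite /F ltn_ord.
rewrite FA.
have Ale i y : normc (A i y) <= c * ((1 + a i ^+ 2)^-1 * (1 + b i ^+ 2)^-1).
  exact: avg_gram_factor_le.
apply: le_trans (integral_tensor_le mA Ale A0) _.
rewrite big_split /= prodr_const card_ord.
rewrite (_ : decay _ = \prod_i ((1 + a i ^+ 2)^-1 * (1 + b i ^+ 2)^-1)).
  by rewrite -!mulrA [fine _ * _]mulrC.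
by rewrite big_split /decay big_split_ord; congr (_ * _); apply: eq_bigr => i _; rewrite /a /b mxE.
Qed.

(** On the support [|x_j| <= D], so the modulation differs from 1 by at most [4 * pi * D * t]. *)
Lemma testfun_freq_sub j (t : R) : 0 < t ->
  nrm (P (freq j t) testfun_class - testfun_class) <= 4 * pi * D * t * nrm testfun_class.
Proof.
move=> t0; set b := 4 * pi * D * t.
have b0 : 0 <= b by rewrite /b mulr_ge0 ?(ltW t0)// mulr_ge0// mulr_ge0// pi_ge0.
rewrite -[b]ger0_norm// -normc_real -(ipnormZ (@L2ip_inner R d)).
have ku := L2class_ae testfun_square; have [mk _] := testfun_square.
apply: (@le_nrm _ _ _ _ (fun x => (cis (2 * pi * t * tnth x j) - 1) * testfun x)
  (fun x => b%:C * testfun x)).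
- have := freq_sub_ae j t testfun_class.
  by move: ku; apply: filterS2 => x h1 h2 _; rewrite h2// h1.
- have := L2scale_ae b%:C testfun_class.
  by move: ku; apply: filterS2 => x h1 h2 _; rewrite h2// h1.
- apply: complex_measurableM => //; apply: complex_measurableB.
    exact: complex_measurable_cis_freq.
  by split; exact: measurable_cst.
- exact: complex_measurableZ.
move=> x; rewrite !normcM normc_real (ger0_norm b0).
have [xD|xD] := leP `|tnth x j| D; last first.
  by rewrite /testfun /tensor (bigD1 j)//= k0// mul0r normc0 !mulr0.
apply: ler_wpM2r; first exact: normc_ge0.
apply: le_trans (normc_cisB1_le _) _; rewrite !normrM.
rewrite (ger0_norm (pi_ge0 R)) (ger0_norm (ltW t0)) (ger0_norm (ler0n _ 2)).
rewrite /b (_ : 4 * pi * D * t = 2 * (2 * pi * t * D)); last by move: (@pi R) => p; ring.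
apply: ler_wpM2l => //; apply: ler_wpM2l => //.
by rewrite mulr_ge0 ?(ltW t0)// mulr_ge0// pi_ge0.
Qed.

Lemma testfun_modspace (L : set 'cV[R]_(d + d)) : is_lattice L ->
  modspace ip P L (@freq R d) testfun_class.
Proof.
move=> latL; have [S S0 hS] := lattice_decay_sum latL; pose M := 2 * (c ^+ d * fine (leb (box (D + 1)))).
have c0 : 0 <= c.
  apply: mulr_ge0; first by apply: mulr_ge0 => //; exact: sqr_ge0.
  by rewrite addr_ge0// mulr_ge0// sqr_ge0.
have M0 : 0 <= M by rewrite mulr_ge0// mulr_ge0 ?exprn_ge0// fine_ge0.
have kb : bess ip P L (Num.sqrt (M * S)) testfun_class.
  have LN l : L l -> L (- l) by apply: latticeN.
  have LD l m : L l -> L m -> L (l + m) by apply: latticeD.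
  apply: (schur_bess (@L2ip_inner R d) (@L2shift_rep R d) LN LD); first exact: mulr_ge0.
  move=> B fB; apply: (@le_trans _ _ (\sum_(l <- B) M * decay (fun i => l i 0))).
    by apply: ler_sum => l _; exact: gram_testfun_le.
  by rewrite -mulr_sumr ler_wpM2l// hS.
pose n := nrm testfun_class; have n0 : 0 <= n := ipnorm_ge0 _ _.
have b0 : 0 <= 4 * pi * D * n by rewrite mulr_ge0// mulr_ge0// mulr_ge0// pi_ge0.
exists (n + Num.sqrt (M * S) + 4 * pi * D * n); split.
- by rewrite -addrA lerDl addr_ge0// sqrtr_ge0.
- by apply: bess_mono kb; rewrite -addrA addrCA lerDl addr_ge0.
move=> j t t0; apply: le_trans (testfun_freq_sub j t0) _.
rewrite mulrAC -/n; apply: ler_wpM2r; first exact: ltW.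
by rewrite lerDr addr_ge0// sqrtr_ge0.
Qed.

End gram.
End tensors.

(** * Totality of the test functions *)

(** The sets over which [phi] integrates to 0 form a Dynkin system; the vanishing of the full
    integral is what closes it under complements. It contains a generating pi-system, hence every
    measurable set. *)
Lemma ae_eq0_pi_system d (T : measurableType d) (R : realType)
    (mu : {measure set T -> \bar R}) (G : set (set T)) (phi : T -> \bar R) :
  @measurable _ T = <<s G >> -> setI_closed G -> mu.-integrable setT phi ->
  (\int[mu]_x phi x = 0)%E -> (forall A, G A -> (\int[mu]_(x in A) phi x = 0)%E) ->
  ae_eq mu setT phi (cst 0%E).
Proof.
move=> GE GI iphi phi0 phiG; have mphi := measurable_int _ iphi.
suff h A : measurable A -> (\int[mu]_(x in A) phi x = 0)%E.
  by apply: integral_ae_eq => // A _ mA; rewrite h// integral0.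
rewrite GE; apply: (@dynkin_induction _ T G (fun A => \int[mu]_(x in A) phi x = 0)%E) => //.
- move=> S mS S0; have := phi0; rewrite -(setUv S) integral_setU.
  + by rewrite S0 add0e.
  + by [].
  + exact: measurableC.
  + by rewrite setUv.
  + by rewrite disj_set2E setICr.
- move=> F mF tF F0; rewrite integral_bigcup//; first by apply: eseries0 => i _ _; exact: F0.
  apply: integrableS iphi => //; exact: bigcup_measurable.
Qed.

Section open_boxes.
Context {R : realType} {d : nat}.
Local Notation E := (d.-tuple (measurableTypeR R)).
Implicit Types p q : 'I_d -> R.

Definition open_box p q : set E := [set x | forall i, p i < tnth x i < q i].

Definition open_boxes : set (set E) := [set A | exists p q, A = open_box p q].

Lemma measurable_open_box p q : measurable (open_box p q).
Proof.
rewrite (_ : open_box p q = \big[setI/setT]_(i < d)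
   ((fun x : E => tnth x i) @^-1` [set` `]p i, q i[])).
  apply: bigsetI_measurable => i _; rewrite -[X in measurable X]setTI.
  apply: (measurable_tnth i) => //; exact: measurable_itv.
apply/seteqP; split=> [x xD|x].
  by elim/big_ind: _ => // i _; rewrite /= in_itv /=; exact: xD.
by move=> xD i; move: xD; rewrite (bigD1 i)//= in_itv /= => -[].
Qed.

Lemma open_boxesI : setI_closed open_boxes.
Proof.
move=> A B [p [q ->]] [p' [q' ->]].
exists (fun i => Num.max (p i) (p' i)), (fun i => Num.min (q i) (q' i)).
apply/seteqP; split=> [x [h h'] i|x h].
  have /andP[a b] := h i; have /andP[a' b'] := h' i.
  by rewrite gt_max lt_min a b a' b'.
by split=> i; have := h i; rewrite gt_max lt_min => /andP[/andP[a b] /andP[a' b']]; rewrite ?a ?b ?a' ?b'.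
Qed.

Lemma measurable_open_boxes : @measurable _ E = <<s open_boxes >>.
Proof.
apply/seteqP; split; last first.
  apply: smallest_sub; first exact: sigma_algebra_measurable.
  by move=> A [p [q ->]]; exact: measurable_open_box.
have sB := smallest_sigma_algebra setT open_boxes.
apply: smallest_sub => //; elim/big_ind: _ => [A []|A B hA hB X [|]|i _ _ [A mA <-]].
- exact: hA.
- exact: hB.
pose f (x : E) : measurableTypeR R := tnth x i.
suff : measurable `<=` image_set_system setT f <<s open_boxes >> by apply.
change ((@ocitv R).-sigma.-measurable `<=` image_set_system setT f <<s open_boxes >>).
rewrite RGenOInfty.measurableE; apply: smallest_sub; first exact: sigma_algebra_image.
move=> B [a ->]; rewrite /image_set_system /=.
(* The half-space of points whose coordinate [i] exceeds [a] is exhausted by boxes that only the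
   face at [a] does not let grow. *)
rewrite (_ : _ `&` _ = \bigcup_n open_box (fun j => if j == i then a else - n%:R) (fun=> n%:R)).
  have [_ _] := sB; apply => n; apply: sub_sigma_algebra; by do 2 eexists.
apply/seteqP; split=> [x [_]|x [n _ xn]]; last first.
  by split=> //; have /andP[+ _] := xn i; rewrite eqxx /= in_itv /= andbT.
rewrite /= in_itv /= andbT => ax; pose m := Num.bound (\sum_j `|tnth x j|).
have xm j : `|tnth x j| < m%:R.
  apply: le_lt_trans (archi_boundP _); last by apply: sumr_ge0.
  by rewrite (bigD1 j)//= lerDl sumr_ge0.
exists m => // j; have := xm j; rewrite ltr_norml => /andP[h1 ->].
by rewrite andbT; case: eqP => [->|].
Qed.

End open_boxes.

Section density.
Context {R : realType} {d : nat}.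
Local Notation C := R[i].
Local Notation E := (euclid R d).
Local Notation leb := (@lebesgue_tuple R d).
Local Notation L2 := (L2space R d).
Local Notation ip := (@L2ip R d).
Local Notation P := (@L2shift R d).
Implicit Types p q : 'I_d -> R.

Definition plateaus p q n (x : E) : R := \prod_i plateau (p i) (q i) n (tnth x i).

Definition range_bound p q : R := \sum_i (`|p i| + `|q i|).

Lemma range_bound_ge0 p q : 0 <= range_bound p q.
Proof. by apply: sumr_ge0 => i _; exact: addr_ge0. Qed.

Lemma le_range_bound p q i y : p i < y < q i -> `|y| <= range_bound p q.
Proof.
move=> /andP[py yq]; apply: (@le_trans _ _ (`|p i| + `|q i|)).
  rewrite ler_norml; have := ler_norm (q i); have := ler_norm (- p i); rewrite normrN.
  by have := normr_ge0 (p i); have := normr_ge0 (q i) => *; apply/andP; split; lra.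
by rewrite /range_bound (bigD1 i)//= lerDl sumr_ge0// => j _; exact: addr_ge0.
Qed.

Lemma plateaus_nice p q n :
  exists K, forall i, nice (range_bound p q) K (plateau (p i) (q i) n).
Proof.
have h i : exists K, nice (range_bound p q) K (plateau (p i) (q i) n).
  apply: c11_nice; [exact: range_bound_ge0|exact: measurable_plateau| |exact: c11_plateau].
  move=> x xD; apply: plateau_out; apply/negP => /le_range_bound.
  by rewrite leNgt xD.
have [K hK] := choice h; exists (\sum_i `|K i|) => i.
have KS : K i <= \sum_j `|K j|.
  by rewrite (bigD1 i)//= (le_trans (ler_norm _))// lerDl sumr_ge0.
have [m z k] := hK i; split=> // x s s1; have [k1 k2 k3] := k x s s1; split.
- exact: le_trans KS.
- by apply: le_trans k2 _; apply: ler_wpM2r.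
- by apply: le_trans k3 _; apply: ler_wpM2r => //; exact: sqr_ge0.
Qed.

Lemma plateaus_itv p q n x : 0 <= plateaus p q n x <= 1.
Proof.
apply/andP; split; first by apply: prodr_ge0 => i _; have /andP[] := plateau_itv (p i) (q i) n (tnth x i).
by apply: prodr_ile1 => i _; exact: plateau_itv.
Qed.

Lemma plateaus_out p q n x : ~ open_box p q x -> plateaus p q n x = 0.
Proof.
move=> xQ; have [i xi] : exists i, ~~ (p i < tnth x i < q i).
  by apply: contrapT => h; apply: xQ => i; apply/negPn/negP => xi; apply: h; exists i.
by rewrite /plateaus (bigD1 i)//= plateau_out// mul0r.
Qed.

Lemma plateaus_cvg p q x : (fun n => plateaus p q n x) @ \oo --> (\1_(open_box p q) x : R).
Proof.
rewrite indicE; have [|xQ] := boolP (x \in _).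
  rewrite inE => xQ; rewrite (_ : (true%:R : R) = \prod_(i < d) 1); last by rewrite big1.
  by apply: cvg_big => [|i _]; [exact: mul_continuous|exact: plateau_cvg].
rewrite (_ : (fun n => _) = fun=> 0); first exact: cvg_cst.
by apply/funext => n; apply: plateaus_out => h; move: xQ; rewrite notin_setE.
Qed.

Lemma measurable_plateaus p q n : measurable_fun setT (plateaus p q n).
Proof.
apply: measurable_prod => i _; apply: (measurableT_comp (@measurable_plateau R (p i) (q i) n)).
exact: measurable_tnth.
Qed.

Section test_functions.
Variable phi : E -> R.
Hypothesis mphi : measurable_fun setT phi.
Hypothesis iphi : forall p q,
  leb.-integrable setT (EFin \o (fun x => phi x * \1_(open_box p q) x)).
Hypothesis phi0 : forall p q n, (\int[leb]_x (phi x * plateaus p q n x)%:E = 0)%E.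

(** Dominated convergence: the plateaus tend to the indicator function of the open box, vanish
    outside it and are at most 1. *)
Let box0 p q : (\int[leb]_x (phi x * \1_(open_box p q) x)%:E = 0)%E.
Proof.
pose F := EFin \o (fun x => phi x * \1_(open_box p q) x).
have [|||||_ _] := @dominated_convergence _ E R leb setT measurableT
  (fun n x => (phi x * plateaus p q n x)%:E) F (fun x => `|F x|%E).
- by move=> n; apply/measurable_EFinP; apply: measurable_funM => //; exact: measurable_plateaus.
- exact: measurable_int (iphi p q).
- apply: aeW => x _; apply: cvg_EFin; first exact: nearW.
  by apply: cvgM; [exact: cvg_cst|exact: plateaus_cvg].
- exact: integrable_norm.
- apply: aeW => x n _; rewrite lee_fin !normrM ler_wpM2l// indicE.
  have /andP[b0 b1] := plateaus_itv p q n x; rewrite ger0_norm//.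
  have [xQ|xQ] := boolP (x \in _); first by rewrite normr1.
  by rewrite plateaus_out ?normr0// => h; move: xQ; rewrite notin_setE.
rewrite (_ : (fun n => _) = fun=> 0%E); last by apply/funext => n; exact: phi0.
by move=> /cvg_lim <-//; rewrite lim_cst.
Qed.

(** [phi] is integrable on bounded boxes only, so the pi-system argument is run on each [Q N], whose
    intersection with an open box is again one; the [Q N] exhaust the space. *)
Lemma ae_eq0_plateaus : ae_eq leb setT phi (fun=> 0).
Proof.
pose Q N := open_box (fun _ : 'I_d => - N%:R) (fun=> N%:R : R).
have h N : ae_eq leb setT (EFin \o (fun x => phi x * \1_(Q N) x)) (cst 0%E).
  apply: (ae_eq0_pi_system measurable_open_boxes open_boxesI) => //; first exact: iphi.
    exact: box0.
  move=> A [p [q ->]]; rewrite integral_mkcond.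
  have [p' [q' e]] : open_boxes (open_box p q `&` Q N) by apply: open_boxesI; do 2 eexists.
  rewrite -[RHS](box0 p' q') -e; apply: eq_integral => x _.
  rewrite /patch /= !indicE in_setI; case: (x \in open_box p q) => //=.
  by rewrite mulr0.
have := ae_foralln (fun N => h N); apply: filterS => x hx _.
pose m := Num.bound (\sum_j `|tnth x j|).
have xm : Q m x.
  move=> j; have : `|tnth x j| < m%:R.
    apply: le_lt_trans (archi_boundP _); last by apply: sumr_ge0.
    by rewrite (bigD1 j)//= lerDl sumr_ge0.
  by rewrite ltr_norml.
have := hx m I; rewrite /= indicE mem_set// mulr1 => -[].
by [].
Qed.

End test_functions.

(** The plateaus are real, so orthogonality splits into the vanishing of the integrals of the real
    and the imaginary part of [f] against them. *)
Lemma testfuns_total (f : L2) :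
  (forall (k : 'I_d -> R -> R) (D K : R) (D0 : 0 <= D) (kP : forall i, nice D K (k i)),
    ip f (testfun_class kP) = 0) ->
  f = 0.
Proof.
move=> f0; have [mr mi] := L2space_measurable f.
have h p q n : complex_integral (fun x => f x * (plateaus p q n x)%:C) = 0.
  have [K kP] := plateaus_nice p q n; have D0 := range_bound_ge0 p q.
  have sk := testfun_square kP.
  rewrite -(f0 _ _ _ D0 kP) /L2ip (@L2inner_ae _ _ f f _ (testfun (fun i => plateau (p i) (q i) n))).
  - rewrite L2innerE; congr complex_integral; apply/funext => x.
    rewrite /plateaus /testfun /tensor rmorph_prod; congr (_ * _).
    by rewrite rmorph_prod; apply: eq_bigr => i _; rewrite /= oppr0.
  - exact: L2space_measurable.
  - exact: L2space_measurable.
  - exact: L2space_measurable.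
  - by case: sk.
  - exact: ae_eq_refl.
  - exact: L2class_ae.
(* On a bounded box [|f| <= |f|^2 + 1], and the right-hand side is integrable there. *)
have ib p q (pr : C -> R) : measurable_fun setT (fun x => pr (f x)) ->
    (forall z, `|pr z| <= normc z) ->
    leb.-integrable setT (EFin \o (fun x => pr (f x) * \1_(open_box p q) x)).
  move=> mpr prn; have D0 := range_bound_ge0 p q.
  have i2 := integrableD measurableT (integrable_mass (L2space_square f))
    (@integrable_box_indic R d (range_bound p q)).
  apply: le_integrable i2 => //.
    apply/measurable_EFinP; apply: measurable_funM => //.
    by apply: measurable_indic; exact: measurable_open_box.
  move=> x _; rewrite /= lee_fin normrM indicE.
  have [xQ|_] := boolP (x \in _); last by rewrite normr0 mulr0.
  rewrite normr1 mulr1 indicE mem_set; last first.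
    by move=> i; apply: le_range_bound; move: xQ; rewrite inE; apply.
  apply: le_trans (prn _) _; apply: le_trans (ler_norm _).
  by have := sqr_ge0 (normc (f x) - 2^-1); rewrite /=; lra.
have zero (pr : C -> R) : measurable_fun setT (fun x => pr (f x)) ->
    (forall z, `|pr z| <= normc z) -> (forall z x, pr (z * x%:C) = pr z * x) ->
    (forall p q n, \int[leb]_x pr (f x * (plateaus p q n x)%:C) = 0) ->
    ae_eq leb setT (fun x => pr (f x)) (fun=> 0).
  move=> mpr prn prZ pr0; apply: ae_eq0_plateaus => // [p q|p q n]; first exact: ib.
  have := pr0 p q n; rewrite /Rintegral (eq_integral (fun x => (pr (f x) * plateaus p q n x)%:E)).
    move=> h0; rewrite -[LHS]fineK ?h0//; apply: integrable_fin_num => //.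
    have i1 := ib p q _ mpr prn; apply: (le_integrable _ _ _ i1) => //.
      by apply/measurable_EFinP; apply: measurable_funM => //; exact: measurable_plateaus.
    move=> x _; rewrite /= lee_fin !normrM ler_wpM2l// indicE.
    have /andP[b0 b1] := plateaus_itv p q n x; rewrite ger0_norm//.
    have [xQ|xQ] := boolP (x \in _); first by rewrite normr1.
    by rewrite plateaus_out ?normr0// => hx; move: xQ; rewrite notin_setE.
  by move=> x _; rewrite prZ.
have zR : ae_eq leb setT (fun x => complex.Re (f x)) (fun=> 0).
  apply: zero => // [|z x|p q n]; first exact: normr_Re_le_normc.
    by case: z => a b /=; ring.
  by have := h p q n; rewrite /complex_integral => -[].
have zI : ae_eq leb setT (fun x => complex.Im (f x)) (fun=> 0).
  apply: zero => // [|z x|p q n]; first exact: Im_le_normc.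
    by case: z => a b /=; ring.
  by have := h p q n; rewrite /complex_integral => -[].
apply: L2space_eq; have z0 := @L2zero_ae R d.
move: zR zI z0; apply: filterS3 => x hR hI h0 _.
by rewrite h0//; apply/eqP; rewrite eq_complex hR// hI// !eqxx.
Qed.

End density.

(** * The weighted Bessel space *)

Section weighted_bessel_space.
Context {R : realType} {d : nat}.
Variable L : set 'cV[R]_(d + d).
Hypothesis latL : is_lattice L.
Local Notation L2 := (L2space R d).
Local Notation ip := (@L2ip R d).
Local Notation nrm := (ipnorm ip).
Local Notation P := (@L2shift R d).
Local Notation frame := (frame ip P L).
Local Notation modball := (modball ip P L (@freq R d)).
Local Notation modspace := (modspace ip P L (@freq R d)).
Local Notation N := (@L2w_bessel_norm R d L).
Implicit Types (u g h f : L2).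

Let LN l : L l -> L (- l).
Proof. exact: latticeN. Qed.

Let LD l m : L l -> L m -> L (l + m).
Proof. exact: latticeD. Qed.

(** Together with [modball_L2w_bessel] this makes [L2w_bessel_norm] equivalent to the norm with
    balls [modball], so boundedness passes from one to the other. *)
Lemma L2w_bessel_modball u : L2w_bessel L u -> modball ((4 * pi + 1) * N u) u.
Proof.
move=> [su bu]; have b := analysis_opnorm_bess bu.
set W := fine (L2norm (weighted u)); set M := analysis_opnorm L u.
have [p0 M0] := (pi_ge0 R, bess_ge0 b).
have uW : nrm u <= W by exact: nrm_le_weighted.
have W0 : 0 <= W by exact: le_trans (ipnorm_ge0 _ _) uW.
have NE : (4 * pi + 1) * N u = 4 * pi * W + (4 * pi * M + (W + M)).
  by rewrite /N -/W -/M; move: (@pi R) => p; ring.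
have pW0 : 0 <= 4 * pi * W by rewrite mulr_ge0// mulr_ge0.
have pM0 : 0 <= 4 * pi * M by rewrite mulr_ge0// mulr_ge0.
rewrite NE; split.
- by apply: le_trans uW _; lra.
- by apply: bess_mono b; lra.
move=> j t t0; apply: le_trans (freq_lipschitz j su t0) _.
by rewrite -/W ler_wpM2r ?(ltW t0)// lerDl addr_ge0// addr_ge0.
Qed.

Lemma modball_L2w_bessel C u : modball C u ->
  L2w_bessel L u /\ N u <= (2 * (d%:R + 1) + 1) * C.
Proof.
move=> [uC bu hu]; have [su Wu] := weighted_square_integrable uC hu.
split; first by split=> //; apply/besselP; exists C.
by rewrite [leRHS]mulrDl mul1r lerD// analysis_opnorm_le.
Qed.

Lemma L2w_besselE : L2w_bessel L = modspace.
Proof.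
apply/seteqP; split=> [u /L2w_bessel_modball uX|u [C /modball_L2w_bessel[]//]].
by eexists; exact: uX.
Qed.

Lemma modspace_total f : (forall u, modspace u -> ip f u = 0) -> f = 0.
Proof.
move=> f0; apply: testfuns_total => k D K D0 kP; apply: f0.
exact: testfun_modspace.
Qed.

Lemma frame_operator_bounded g h : L2w_bessel L g -> L2w_bessel L h ->
  bounded_operator_on (L2w_bessel L) N (frame_operator L g h).
Proof.
move=> /L2w_bessel_modball gM /L2w_bessel_modball hM.
set c := 4 * pi + 1 in gM hM *.
have [[_ gb _] [_ hb _]] := (gM, hM).
have ball u : L2w_bessel L u ->
    modball (3 * (c * N u * (c * N g) * (c * N h))) (frame_operator L g h u).
  move=> /L2w_bessel_modball uM; rewrite frame_operatorE.
  exact: (modball_frame (@L2ip_inner R d) (@L2_complete R d) (@L2shift_rep R d) LN LD uM gM hM).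
split.
- by move=> u uX; have [] := modball_L2w_bessel (ball u uX).
- move=> u v _ _ a; rewrite !frame_operatorE.
  exact: (frame_linear (@L2ip_inner R d) (@L2_complete R d) a u v gb hb).
exists ((2 * (d%:R + 1) + 1) * (3 * (c * (c * N g) * (c * N h)))) => u; rewrite inE => uX.
have [_ Nu] := modball_L2w_bessel (ball u uX); apply: le_trans Nu _.
rewrite le_eqVlt; apply/orP; left; apply/eqP.
by move: (N u) (N g) (N h) (d%:R : R) => n1 n2 n3 n5; clearbody c; ring.
Qed.

Lemma frame_operator_spectrum g : L2w_bessel L g ->
  spectrum (L2w_bessel L) (frame_operator L g g) = spectrum setT (frame_operator L g g).
Proof.
move=> /L2w_bessel_modball gM; rewrite L2w_besselE.
have -> : frame_operator L g g = frame g g by apply/funext => f; exact: frame_operatorE.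
apply/seteqP; split=> z /= h1 h2; apply: h1; move: h2;
  apply (resolvent_bijP (@L2ip_inner R d) (@L2_complete R d) (@L2shift_rep R d) LN LD z gM modspace_total).
Qed.

End weighted_bessel_space.

Theorem corollary4p3 (R : realType) (d : nat) (L : set 'cV[R]_(d + d))
    (latticeL : is_lattice L) :
  (forall g h : L2space R d, L2w_bessel L g -> L2w_bessel L h ->
     bounded_operator_on (L2w_bessel L) (L2w_bessel_norm L)
       (frame_operator L g h)) /\
  (forall g : L2space R d, L2w_bessel L g ->
     spectrum (L2w_bessel L) (frame_operator L g g) =
     spectrum setT (frame_operator L g g)).
Proof.
split=> [g h|g]; first exact: frame_operator_bounded.
exact: frame_operator_spectrum.
Qed.
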